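(* Assume (A1)–(A7), let $L>0$ and $\nu^0\in\mathcal P_2(\Omega_L)$. For every $\tau>0$ set $\nu_\tau^0:=\nu^0$, choose iteratively for $k=0,1,2,\dots$ $$\nu_\tau^{k+1}\in\operatorname*{arg\,min}_{\nu\in\mathcal P_2(\Omega_L)}\Big\{\mathcal J(\nu)+\frac1{2\tau}\mathcal W_2^2(\nu,\nu_\tau^k)\Big\},$$ and let $\nu_{\tau,0}:=\nu^0$, $\nu_{\tau,t}:=\nu_\tau^k$ for $t\in((k-1)\tau,k\tau]$, $k\geq 1$. Then there exist $(\tau_\ell)_{\ell\in\mathbb N}\subset(0,1)$ with $\tau_\ell\searrow0$ and a curve $\nu_t\in AC^2_{\mathrm{loc}}([0,+\infty);\mathcal P_2(\Omega_L))$ such that for every $t\in[0,+\infty)$ $$\lim_{\ell\to\infty}\mathcal W_2(\nu_{\tau_\ell,t},\nu_t)=0.$$ In particular, $\nu_t$ is a minimizing movement for $\mathcal J$ in $(\mathcal P_2(\Omega_L),\mathcal W_2)$ starting from $\nu^0$.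
   Context: Let $\mathcal C$ be a separable Banach space, $\mathcal M=\mathcal C^*$ its topological dual with the dual norm, and $Y$ a Hilbert space. Let $K:\mathcal M\to Y$, $\mathcal F:Y\to\mathbb R$, $\mathcal R:\mathcal M\to[0,+\infty]$. Put $\mathrm{Dom}(\mathcal R):=\{u\in\mathcal M:\mathcal R(u)<+\infty\}$. Let $B:=\{u\in\mathcal M:\mathcal R(u)\le1\}$ and let $\tilde{\mathcal B}:=\overline{\mathrm{Ext}(B)}^{*}$ be the weak$^*$-closure of its set of extremal points. Fix a (nonempty) weak$^*$-closed subset $\mathcal B\subset\tilde{\mathcal B}$ and a metric $d_{\mathcal B}$ metrizing the weak$^*$-convergence on $\mathcal B$, such that $(\mathcal B,d_{\mathcal B})$ is geodesically complete, i.e. any two points are joined by a geodesic; a geodesic in a metric space $(X,d)$ is a curve $\gamma:[0,1]\to X$ with $d(\gamma_s,\gamma_t)=|s-t|d(\gamma_0,\gamma_1)$ for all $s,t$. Assumptions: (A1) $K$ is linear and weak$^*$-to-weak continuous. (A2) $\mathcal F$ is bounded from below, convex, and twice Fréchet differentiable on $Y$. (A3) $\mathcal R$ is convex, weak$^*$-lower semicontinuous and positively one-homogeneous: $\mathcal R(\lambda u)=\lambda\mathcal R(u)$ for all $\lambda\ge0$, $u\in\mathcal M$. (A4) For every $\alpha\ge0$ the sublevel set $\{u\in\mathcal M:\mathcal R(u)\le\alpha\}$ is weak$^*$-compact. (A5) $K$ is sequentially weak$^*$-to-strong continuous on $\mathrm{Dom}(\mathcal R)$. (A6) (no loss of mass)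 For every $n\in\mathbb N$, $\alpha^1,\dots,\alpha^n\ge0$ and $u^1,\dots,u^n\in\mathcal B$: $\mathcal R(\sum_j\alpha^ju^j)=\sum_j\alpha^j\mathcal R(u^j)$. (A7) $0\notin\mathcal B$. Notation: $\Omega_L:=[0,L]\times\mathcal B$ with metric $d_\Omega((c,u),(\tilde c,\tilde u)):=(|c-\tilde c|^2+d_{\mathcal B}^2(u,\tilde u))^{1/2}$ (a compact metric space); $\mathcal P_2(\Omega_L)$ is the set of Borel probability measures on $\Omega_L$ with the 2-Wasserstein distance $\mathcal W_2$ induced by $d_\Omega$; and for $\nu\in\mathcal P_2(\Omega_L)$ $$\mathcal J(\nu):=\mathcal F\Big(\int_{\Omega_L}c^2Ku\,d\nu(c,u)\Big)+\int_{\Omega_L}c^2\,d\nu(c,u).$$ A curve $\gamma$ in a metric space $(X,d)$ belongs to $AC^2_{\mathrm{loc}}([0,\infty);X)$ if on each $[a,b]\subset[0,\infty)$ there is $m\in L^2(a,b)$ with $d(\gamma_s,\gamma_t)\le\int_s^tm(r)\,dr$ for $a\le s\le t\le b$. Minimizing movement for $F:X\to(-\infty,\infty]$ on a complete metric space $(X,d)$ starting from $x_0\in\mathrm{Dom}(F)$: a curve $x:[0,\infty)\to X$ for which there are sequences of time steps $\boldsymbol\tau_k=(\tau_{k,m})_{m\ge1}\subset(0,\infty)$ with $\sum_m\tau_{k,m}=\infty$ and $\sup_m\tau_{k,m}\to0$ as $k\to\infty$, and points $x_k^m$ ($m\ge0$) with $x_k^m\in\arg\min_{v\in X}\{F(v)+\frac1{2\tau_{k,m}}d^2(v,x_k^{m-1})\}$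 for $m\ge1$, such that $F(x_k^0)\to F(x_0)$, $\limsup_kd(x_k^0,x_0)<\infty$, and the piecewise constant interpolations $\bar x_k(0)=x_k^0$, $\bar x_k(t)=x_k^m$ for $t\in(\sum_{i<m}\tau_{k,i},\sum_{i\le m}\tau_{k,i}]$ satisfy $\bar x_k(t)\to x_t$ for all $t\ge0$. *)

(* Defs.v *)
From HB Require Import structures.
From mathcomp Require Import all_boot all_order all_algebra.
From mathcomp Require Import all_classical all_reals all_analysis.

Set Implicit Arguments.
Unset Strict Implicit.
Unset Printing Implicit Defensive.

Import Order.TTheory GRing.Theory Num.Theory.
Import numFieldNormedType.Exports.

Local Open Scope classical_set_scope.
Local Open Scope ring_scope.

Section dual.
Context {R : realType} (E : normedModType R).

Definition dual_pred : {pred E -> R^o} :=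
  fun f => `[< linear f /\ continuous f >].

Record dual := Dual { dual_fun :> E -> R^o; _ : dual_fun \in dual_pred }.

HB.instance Definition _ := [isSub for dual_fun].
HB.instance Definition _ := gen_eqMixin dual.
HB.instance Definition _ := gen_choiceMixin dual.

Lemma dual_submod_closed : submod_closed dual_pred.
Proof.
split.
  apply/asboolP; split; last exact: cst_continuous.
  by move=> a x y; rewrite scaler0 addr0.
move=> a f g /asboolP[lf cf] /asboolP[lg cg]; apply/asboolP; split.
  move=> b x y; rewrite !fctE lf lg !scalerDr !scalerA -!addrA [a * b]mulrC.
  by congr (_ + _); rewrite addrCA.
move=> x; apply: cvgD; last exact: cg.
by apply: cvgZl_tmp; exact: cf.
Qed.

HB.instance Definition _ :=
  GRing.isSubmodClosed.Build _ _ dual_pred dual_submod_closed.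
HB.instance Definition _ := [SubChoice_isSubLmodule of dual by <:].

Lemma dual_linear (f : dual) : linear f.
Proof. by case: f => f /= /asboolP[]. Qed.

Lemma dual_continuous (f : dual) : continuous (f : E -> R^o).
Proof. by case: f => f /= /asboolP[]. Qed.

HB.instance Definition _ (f : dual) :=
  GRing.isLinear.Build R E R^o *:%R f (@dual_linear f).

Lemma dualDE (f g : dual) x : (f + g) x = f x + g x.
Proof. by []. Qed.

Lemma dualZE a (f : dual) x : (a *: f) x = a * f x.
Proof. by []. Qed.

Definition dual_ball_image (f : dual) : set R :=
  [set `|f x| | x in [set x : E | `|x| <= 1]].

Definition dual_norm (f : dual) : R := sup (dual_ball_image f).

Lemma dual_ball_image_has_sup (f : dual) : has_sup (dual_ball_image f).
Proof.
split; first by exists `|f 0|, 0 => //=; rewrite normr0.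
have /bounded_funP/(_ 1)[M HM] :=
  @continuous_linear_bounded _ _ _ 0 f (@dual_continuous f 0).
by exists M => _ [x /= x1 <-]; exact: HM.
Qed.

Lemma dual_norm_ub (f : dual) x : `|x| <= 1 -> `|f x| <= dual_norm f.
Proof.
move=> x1; apply: sup_upper_bound; first exact: dual_ball_image_has_sup.
by exists x.
Qed.

Lemma dual_norm_le (f : dual) M :
  (forall x, `|x| <= 1 -> `|f x| <= M) -> dual_norm f <= M.
Proof.
move=> fM; apply: ge_sup; first by case: (dual_ball_image_has_sup f).
by move=> _ [x x1 <-]; exact: fM.
Qed.

Let ler_dual_normD (f g : dual) :
  dual_norm (f + g) <= dual_norm f + dual_norm g.
Proof.
apply: dual_norm_le => x x1; rewrite dualDE (le_trans (ler_normD _ _))//.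
by apply: lerD; exact: dual_norm_ub.
Qed.

Let dual_normZ_le a (f : dual) : dual_norm (a *: f) <= `|a| * dual_norm f.
Proof.
apply: dual_norm_le => x x1; rewrite dualZE normrM ler_wpM2l//.
exact: dual_norm_ub.
Qed.

Let dual_norm_ge0 (f : dual) : 0 <= dual_norm f.
Proof.
by apply: (le_trans (normr_ge0 (f 0))); apply: dual_norm_ub; rewrite normr0.
Qed.

Let dual_normZ a (f : dual) : dual_norm (a *: f) = `|a| * dual_norm f.
Proof.
apply/eqP; rewrite eq_le dual_normZ_le /=.
have [->|a0] := eqVneq a 0; first by rewrite normr0 mul0r dual_norm_ge0.
have := dual_normZ_le a^-1 (a *: f); rewrite scalerA mulVf// scale1r => h.
rewrite (le_trans (ler_wpM2l (normr_ge0 a) h))//.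
by rewrite mulrA normfV mulfV ?mul1r ?normr_eq0.
Qed.

Let dual_norm0_eq0 (f : dual) : dual_norm f = 0 -> f = 0.
Proof.
move=> f0; apply/val_inj/funext => x; change (f x = 0).
have [->|x0] := eqVneq x 0; first by rewrite linear0.
have nx0 : `|x| != 0 by rewrite normr_eq0.
have : `|f (`|x|^-1 *: x)| <= 0.
  by rewrite -f0 dual_norm_ub// normrZ normfV normr_id mulVf.
by rewrite normr_le0 linearZ/= scaler_eq0 invr_eq0 (negbTE nx0) => /eqP.
Qed.

HB.instance Definition _ := Lmodule_isNormed.Build R dual
  ler_dual_normD dual_normZ dual_norm0_eq0.

(** The type [dual E] itself carries the norm topology; the two aliases below
    carry the weak-star topology of [dual E] and the weak topology of [E]. *)
Definition weak_star : Type :=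
  initial_topology (fun f : dual => (f : E -> R^o) : {ptws E -> R^o}).
HB.instance Definition _ := Topological.on weak_star.

Definition weak : Type :=
  initial_topology (fun x : E => (fun f : dual => f x) : {ptws dual -> R^o}).
HB.instance Definition _ := Topological.on weak.

Definition weak_star_closed (A : set dual) : Prop := @closed weak_star A.
Definition weak_star_closure (A : set dual) : set dual := @closure weak_star A.
Definition weak_star_compact (A : set dual) : Prop := @compact weak_star A.
Definition weak_star_cvg (u_ : nat -> dual) (u : dual) : Prop :=
  (u_ : nat -> weak_star) @ \oo --> (u : weak_star).
Definition weak_star_lsc (f : dual -> \bar R) : Prop :=
  lower_semicontinuous (f : weak_star -> \bar R).

End dual.

Definition weak_star_to_weak_continuous {R : realType} (E Y : normedModType R)
    (K : dual E -> Y) : Prop :=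
  continuous (K : weak_star E -> weak Y).

Definition separable_space {R : realType} (E : normedModType R) : Prop :=
  exists2 D : set E, countable D & dense D.

Definition hilbert {R : realType} (Y : completeNormedModType R) : Prop :=
  exists ip : Y -> Y -> R,
    [/\ forall x y, ip x y = ip y x,
        forall z, linear (fun x => ip x z : R^o) &
        forall x, ip x x = `|x| ^+ 2].

(** The first derivative is seen as a map into the normed space [dual Y]. *)
Definition twice_differentiable {R : realType} (Y : normedModType R)
    (F : Y -> R^o) : Prop :=
  exists2 DF : Y -> dual Y,
    forall x, is_diff x F (DF x) & forall x, differentiable DF x.

Definition extreme_points {R : realType} (E : lmodType R) (A : set E) : set E :=
  [set u | A u /\ forall v w (t : R), A v -> A w -> 0 < t < 1 ->
    u = t *: v + (1 - t) *: w -> v = w].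

Definition ereal_convex {R : realType} (E : lmodType R) (f : E -> \bar R) : Prop :=
  forall u v (t : R), 0 < t < 1 ->
    (f (t *: u + (1 - t) *: v)%R <= t%:E * f u + (1 - t)%:E * f v)%E.

Section bochner.
Context d (T : measurableType d) {R : realType} (V : normedModType R).
Implicit Types (mu : probability T R) (s f : T -> V).

Definition simple s : Prop :=
  finite_set (range s) /\ forall v, measurable (s @^-1` [set v]).

Definition simple_integral mu s : V :=
  \sum_(v \in range s) fine (mu (s @^-1` [set v])) *: v.

Definition is_bochner mu f (y : V) : Prop :=
  exists s_ : nat -> T -> V,
    [/\ forall n, simple (s_ n),
        forall n, measurable_fun setT (fun x => `|f x - s_ n x|),
        (\int[mu]_x `|f x - s_ n x|%:E)%E @[n --> \oo] --> 0%E &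
        simple_integral mu (s_ n) @[n --> \oo] --> y].

(** Junk value [point] when [f] is not Bochner integrable. *)
Definition bochner mu f : V := get (is_bochner mu f).

End bochner.

Section metric.
Context {R : realType}.

Definition is_metric (X : Type) (d : X -> X -> R) : Prop :=
  [/\ forall x y, d x y = 0 <-> x = y,
      forall x y, d x y = d y x &
      forall x y z, d x z <= d x y + d y z].

Definition metric_open (X : Type) (d : X -> X -> R) : set (set X) :=
  [set A | forall x, A x -> exists2 e : R, 0 < e & forall y, d x y < e -> A y].

Definition is_geodesic (X : Type) (d : X -> X -> R) (g : R -> X) : Prop :=
  forall s t, s \in `[0, 1] -> t \in `[0, 1] ->
    d (g s) (g t) = `|s - t| * d (g 0) (g 1).

Definition geodesically_complete (X : Type) (d : X -> X -> R) : Prop :=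
  forall x y, exists g : R -> X, [/\ is_geodesic d g, g 0 = x & g 1 = y].

(** Curves on [0, +oo) are functions on [R] whose values at negative times are
    irrelevant. *)
Definition AC2loc (X : Type) (d : X -> X -> R) (g : R -> X) : Prop :=
  forall a b : R, 0 <= a -> a <= b ->
  exists m : R -> R,
    [/\ measurable_fun `[a, b] m,
        (\int[lebesgue_measure]_(r in `[a, b]) (m r ^+ 2)%:E < +oo)%E &
        forall s t, a <= s -> s <= t -> t <= b ->
          d (g s) (g t) <= \int[lebesgue_measure]_(r in `[s, t]) m r].

(** [x] minimises [v |-> F v + d^2(v, y) / (2 tau)]. *)
Definition prox_step (X : Type) (d : X -> X -> R) (F : X -> \bar R)
    (tau : R) (y x : X) : Prop :=
  forall v, (F x + ((2 * tau)^-1 * d x y ^+ 2)%:E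
             <= F v + ((2 * tau)^-1 * d v y ^+ 2)%:E)%E.

Definition minimizing_scheme (X : Type) (d : X -> X -> R) (F : X -> \bar R)
    (x0 : X) (x : R -> nat -> X) : Prop :=
  forall tau, 0 < tau ->
    x tau 0%N = x0 /\ forall k, prox_step d F tau (x tau k) (x tau k.+1).

(** Only the time steps [tau m] with [1 <= m] are used. *)
Definition piecewise_constant (X : Type) (tau : nat -> R) (x : nat -> X)
    (xbar : R -> X) : Prop :=
  xbar 0 = x 0%N /\
  forall m t, (1 <= m)%N ->
    \sum_(1 <= i < m) tau i < t -> t <= \sum_(1 <= i < m.+1) tau i ->
    xbar t = x m.

Definition minimizing_movement (X : Type) (d : X -> X -> R) (F : X -> \bar R)
    (x0 : X) (x : R -> X) : Prop :=
  (F x0 < +oo)%E /\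
  exists (tau : nat -> nat -> R) (p : nat -> nat -> X) (pbar : nat -> R -> X),
    [/\ [/\ forall k m, (1 <= m)%N -> 0 < tau k m,
            forall k, (\sum_(1 <= m <oo) (tau k m)%:E = +oo)%E &
            ereal_sup [set (tau k m)%:E | m in [set m | (1 <= m)%N]]
              @[k --> \oo] --> 0%E],
        forall k m, (1 <= m)%N -> prox_step d F (tau k m) (p k m.-1) (p k m),
        F (p k 0%N) @[k --> \oo] --> F x0,
        (limn_esup (fun k => (d (p k 0%N) x0)%:E) < +oo)%E &
        (forall k, piecewise_constant (tau k) (p k) (pbar k)) /\
        forall t, 0 <= t -> d (pbar k t) (x t) @[k --> \oo] --> 0].

End metric.

Section wasserstein.
Context {R : realType} (X : pointedType) (d : X -> X -> R).

Definition borel := g_sigma_algebraType (metric_open d).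

(** No moment condition: the metric spaces considered are compact. Elements
    are total functions on sets, so that two of them at [W2] distance 0 agree
    on Borel sets but need not be Leibniz equal. *)
Definition P2 := probability borel R.

Definition coupling (mu nu : P2) : set (probability (borel * borel)%type R) :=
  [set g | forall A : set borel, measurable A ->
     g (fst @^-1` A) = mu A /\ g (snd @^-1` A) = nu A].

(** The infimum is finite when [d] is bounded and measurable. *)
Definition W2 (mu nu : P2) : R :=
  Num.sqrt (fine (ereal_inf
    [set (\int[g]_p (d p.1 p.2 ^+ 2)%:E)%E | g in coupling mu nu])).

End wasserstein.

Section Omega.
Context {R : realType}.

(** The proof arguments provide the base point that measurable types need. *)
Definition Omega (M : choiceType) (L : R) (L0 : 0 < L) (B : set M)
  (B0 : B !=set0) : Type := (`[0, L]%classic * B)%type.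

Definition mass (M : Type) (L : R) (B : set M) (w : `[0, L]%classic * B) : R :=
  val w.1.
Definition atom (M : Type) (L : R) (B : set M) (w : `[0, L]%classic * B) : M :=
  val w.2.

Section instances.
Context (M : choiceType) (L : R) (L0 : 0 < L) (B : set M) (B0 : B !=set0).

Let mem0L : (0 : R) \in `[0, L]%classic.
Proof. by rewrite inE /= in_itv /= lexx ltW. Qed.

HB.instance Definition _ := gen_eqMixin (Omega L0 B0).
HB.instance Definition _ := gen_choiceMixin (Omega L0 B0).
HB.instance Definition _ := isPointed.Build (Omega L0 B0)
  (SigSub mem0L, SigSub (mem_set (svalP (cid B0)))).

Definition dOmega (dB : B -> B -> R) (w w' : Omega L0 B0) : R :=
  Num.sqrt (`|mass w - mass w'| ^+ 2 + dB w.2 w'.2 ^+ 2).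

End instances.

Definition P2Omega (M : choiceType) (L : R) (L0 : 0 < L) (B : set M)
    (B0 : B !=set0) (dB : B -> B -> R) : Type :=
  P2 (@dOmega M L L0 B B0 dB).

Definition W2Omega (M : choiceType) (L : R) (L0 : 0 < L) (B : set M)
    (B0 : B !=set0) (dB : B -> B -> R) (mu nu : P2Omega L0 B0 dB) : R :=
  W2 mu nu.

Definition J (C Y : normedModType R) (K : dual C -> Y) (F : Y -> R)
    (L : R) (L0 : 0 < L) (B : set (dual C)) (B0 : B !=set0)
    (dB : B -> B -> R) (nu : P2Omega L0 B0 dB) : R :=
  F (bochner nu (fun w => mass w ^+ 2 *: K (atom w)))
  + \int[nu]_w (mass w ^+ 2).

End Omega.

(* Main.v *)
(** Testing the minimality of each step against the previous point and summing,
    the discrete solutions satisfy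
      [W2(nu_s, nu_t)^2 <= 2 (t - s + tau) (J nu_s - J nu_t)].
    Since [(P2, W2)] is sequentially compact and [J] is continuous on it, a
    diagonal subsequence converges at rational, hence at all, times to a curve
    with [W2(x_s, x_t)^2 <= 2 (t - s) (J x_s - J x_t)], and this inequality alone
    gives an [L^2] speed: the dyadic difference quotients are bounded in [L^2],
    their [L^2] norms increase, and the squared norms of their increments are at
    most the increments of the squared norms, so that a subsequence of them is
    dominated by a single [L^2] function.

    All couplings come from one construction: two probability spaces with
    finitely many labels are glued along any coupling matrix of the laws of the
    labels.  Gluing along small cells containing the middle point replaces
    disintegration in the triangle inequality.  For compactness, the masses of
    countably many cells converge along a subsequence; the limit masses are
    realised by nested intervals of [[0, 1[], and the limit measure is the image
    of Lebesgue measure under the corresponding coding map.  In [J], the Bochner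
    integrals are compared through inner products. *)

Require Import Defs.
From HB Require Import structures.
From mathcomp Require Import all_boot all_order all_algebra.
From mathcomp Require Import all_classical all_reals all_analysis.
From mathcomp Require finmap.
From mathcomp Require Import measurable_realfun ring lra.

Set Implicit Arguments.
Unset Strict Implicit.
Unset Printing Implicit Defensive.

Import Order.TTheory GRing.Theory Num.Theory.
Import numFieldNormedType.Exports.

Local Open Scope classical_set_scope.
Local Open Scope ring_scope.

(** * Extraction of subsequences *)

Section extraction.
Context {R : realType}.

(** [W2] is only a pseudometric, since measures at distance zero may differ as functions; the
    argument is therefore run with pseudometrics and sequences. Compactness enters as a countable
    family of coordinates with values in [[0, 1]] whose convergence forces convergence of the
    points: one extraction then serves all rational times at once, and the same family yields the
    minimizers.

    Two obstacles shape the rest. Cells are not closed, so the mass of a limit measure on a cell can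
    differ from the limit of the masses; the sequence is therefore compared with the space of codes,
    whose masses are exact, and only distances are carried over to the limit measure. The cost is
    quadratic, so integrands are controlled by a modulus [e + C d^2]: a coupling integrates it to
    [e + C W2^2], and every sequentially continuous function on a compact space has one, which is
    the kind of regularity that (A5) gives for [K]. *)

Lemma homo_ltn_ge_id (s : nat -> nat) : {homo s : m n / (m < n)%N} ->
  forall n, (n <= s n)%N.
Proof.
move=> hs; elim=> [//|n IH]; exact: leq_ltn_trans IH (hs _ _ (ltnSn n)).
Qed.

Lemma homo_ltn_cvgnyy (s : nat -> nat) : {homo s : m n / (m < n)%N} ->
  s n @[n --> \oo] --> \oo.
Proof.
move=> hs; apply/cvgnyPge => A; near=> n.
apply: leq_trans (homo_ltn_ge_id hs n); near: n; exact: nbhs_infty_ge.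
Unshelve. all: by end_near. Qed.

Lemma cvg_subsequence (T : topologicalType) (u : nat -> T) (l : T)
  (s : nat -> nat) : {homo s : m n / (m < n)%N} -> u @ \oo --> l ->
  u (s n) @[n --> \oo] --> l.
Proof. by move=> hs ul; exact: cvg_comp (homo_ltn_cvgnyy hs) ul. Qed.

Lemma extract_subsequence (P : nat -> nat -> Prop) :
  (forall k N, exists2 n, (N <= n)%N & P k n) ->
  exists2 s : nat -> nat, {homo s : m n / (m < n)%N} & forall k, P k (s k).
Proof.
move=> H.
have {H} H : forall kN : nat * nat, exists n, (kN.2 <= n)%N /\ P kN.1 n.
  by move=> [k N]; have [n Nn Pn] := cid2 (H k N); exists n.
have [f fP] := choice H.
pose s := fix s k := if k is k'.+1 then f (k, (s k').+1) else f (0%N, 0%N).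
exists s.
  apply: homo_ltn; first exact: ltn_trans.
  by move=> i; have [] := fP (i.+1, (s i).+1).
by case=> [|k]; [have [] := fP (0%N, 0%N) | have [] := fP (k.+1, (s k).+1)].
Qed.

(** Without first countability a cluster point need not be the limit of a subsequence, but countably
    many real observables can be made to converge: the [k]-th index is picked where the first [k] of
    them are within [1/(k+1)] of their values at [g]. This serves both the product topology and the
    weak-star one. *)
Lemma cluster_extraction (T : topologicalType) (u : nat -> T) (g : T)
    (phi : nat -> T -> R) :
  cluster (u @ \oo) g -> (forall j, continuous (phi j)) ->
  exists2 s : nat -> nat, {homo s : m n / (m < n)%N} &
    forall j, phi j (u (s n)) @[n --> \oo] --> phi j g.
Proof.
move=> clug cphi.
have [k N|s hs sP] := @extract_subsequence (fun k n => forall j, (j < k)%N ->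
    `|phi j g - phi j (u n)| < k.+1%:R^-1).
  have nb : nbhs g [set f | forall j, (j < k)%N ->
      `|phi j g - phi j f| < k.+1%:R^-1].
    have e0 : 0 < k.+1%:R^-1 :> R by rewrite invr_gt0.
    move: (k.+1%:R^-1) e0 => e e0; elim: k => [|k IH].
      by apply: nearW => f j.
    have : nbhs g [set f | `|phi k g - phi k f| < e].
      have /cvgrPdist_lt := cphi k g; exact.
    move=> /(filterI IH); apply: filterS => f [/= IHf fk] j.
    by rewrite ltnS leq_eqVlt => /orP[/eqP->//|/IHf].
  have uN : (u @ \oo) (u @` [set n | (N <= n)%N]).
    rewrite nbhs_simpl /=; exists N => // n Nn; exists n => //.
  have [_ [[n Nn <-] h]] := clug _ _ uN nb.
  by exists n.
exists s => // j; apply/cvgrPdist_lt => e e0; near=> n.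
apply: (lt_trans (sP n j _)).
  by near: n; exact: nbhs_infty_gt.
by near: n; exact: near_infty_natSinv_lt (PosNum e0).
Unshelve. all: by end_near. Qed.

(** Tychonoff's theorem in [[0, 1]^nat] replaces the iterated extraction. *)
Lemma bounded_diagonal (a : nat -> nat -> R) :
  (forall n j, 0 <= a n j <= 1) ->
  exists2 s : nat -> nat, {homo s : m n / (m < n)%N} &
    forall j, cvgn (fun n => a (s n) j).
Proof.
move=> a01.
have cpt : compact [set f : {ptws nat -> R} | forall j, `[0, 1]%classic (f j)].
  apply: (@tychonoff nat (fun _ => R) (fun _ => `[0, 1]%classic)) => j.
  exact: segment_compact.
have [|g [_ clg]] := @cpt ((a : nat -> {ptws nat -> R}) @ \oo) _.
  by rewrite nbhs_simpl /=; exists 0%N => // n _ j; rewrite /= in_itv /= a01.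
have [|s hs sP] := @cluster_extraction _ (a : nat -> {ptws nat -> R}) g
  (fun j f => f j) clg.
  by move=> j; exact: (@proj_continuous nat (fun _ => R) j).
by exists s => // j; apply/cvg_ex; exists (g j); exact: sP.
Qed.

End extraction.

(** * Square-integrable speed from an energy inequality *)

Section step_functions.
Context {R : realType}.

(** Every preimage is a countable union of fibres, hence [g] is arbitrary. Measurability is often
    reduced to this case below, by approximation with functions of a countable label. *)
Lemma measurable_fun_fibers d d' (T : measurableType d) (T' : measurableType d')
    (I : countType) (a : T -> I) (g : I -> T') :
  (forall i, measurable (a @^-1` [set i])) -> measurable_fun setT (g \o a).
Proof.
move=> ma _ Y mY; rewrite setTI.
rewrite (_ : _ @^-1` Y = \bigcup_(i in [set i | Y (g i)]) a @^-1` [set i]).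
  rewrite bigcup_mkcond; apply: countable_bigcupT_measurable => // i.
  by case: ifPn.
by apply/seteqP; split => [x Yx|x [i Yi xi]]; [exists (a x) | rewrite /= xi].
Qed.

Lemma measurable_truncn_fiber (h : R) n : 0 < h ->
  measurable [set r : R | Num.truncn (r / h) = n].
Proof.
move=> h0.
have mlt k : measurable [set r | r < k%:R * h].
  by rewrite -set_itvNyo.
(* [Num.truncn] vanishes on negative reals, so the fibre of [0] is a half-line. *)
case: n => [|n].
  rewrite (_ : mkset _ = [set r | r < 1%:R * h]) //.
  apply/seteqP; split => r /=.
    by move=> /eqP; rewrite -leqn0 truncn_le_nat ltr_pdivrMr.
  by move=> rh; apply/eqP; rewrite -leqn0 truncn_le_nat ltr_pdivrMr.
rewrite (_ : mkset _ = [set r | r < n.+2%:R * h] `\` [set r | r < n.+1%:R * h]).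
  exact: measurableD.
apply/seteqP; split => r /=.
  by move=> rn; rewrite -!ltr_pdivrMr// -!truncn_le_nat rn leqnn ltnn.
rewrite -!ltr_pdivrMr// -!truncn_le_nat => -[h1 /negP]; rewrite -ltnNge => h2.
by apply/eqP; rewrite eqn_leq h1.
Qed.

Lemma measurable_step_function (h : R) (g : nat -> R) (D : set R) : 0 < h ->
  measurable_fun D (fun r : R => g (Num.truncn (r / h))).
Proof.
move=> h0; apply: measurable_funTS.
apply: (@measurable_fun_fibers _ _ _ _ _ (fun r : R => Num.truncn (r / h)) g) => n.
exact: measurable_truncn_fiber.
Qed.

Lemma integral_step_function (h : R) (g : nat -> R) i n : 0 < h ->
  (forall k, 0 <= g k) ->
  (\int[lebesgue_measure]_(r in `[(i%:R * h)%R, ((i + n)%N%:R * h)%R[)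
     (g (Num.truncn (r / h)))%:E)%E = (h * \sum_(k < n) g (i + k)%N)%:E.
Proof.
move=> h0 g0; elim: n => [|n IH].
  by rewrite addn0 big_ord0 mulr0 set_itvco0 integral_set0.
have le1 : i%:R * h <= (i + n)%:R * h by rewrite ler_pM2r// ler_nat leq_addr.
have le2 : (i + n)%:R * h <= (i + n.+1)%:R * h.
  by rewrite ler_pM2r// ler_nat leq_add2l.
have -> : `[(i%:R * h), ((i + n.+1)%:R * h)[%classic =
    `[(i%:R * h), ((i + n)%:R * h)[ `|` `[((i + n)%:R * h), ((i + n.+1)%:R * h)[.
  by rewrite -itv_bndbnd_setU.
rewrite ge0_integral_setU//=; last 3 first.
- apply/measurable_EFinP; exact: measurable_step_function.
- by move=> r _; rewrite lee_fin.
- rewrite disj_set2E; apply/eqP/seteqP; split => // r [] /=.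
  rewrite !in_itv/= => /andP[_ h1] /andP[h2 _].
  by have := lt_le_trans h1 h2; rewrite ltxx.
rewrite IH big_ord_recr/= mulrDr EFinD; congr (_ + _)%E.
rewrite (eq_integral (cst (g (i + n)%N)%:E)).
  rewrite integral_cst//= lebesgue_measure_itv/= lte_fin ltr_pM2r// ltr_nat.
  rewrite ltn_add2l ltnSn -EFinB -mulrBl -natrB ?leq_add2l// addnS subSnn mul1r.
  by rewrite -EFinM mulrC.
move=> r; rewrite inE /= in_itv/= => /andP[h1 h2]; congr (g _)%:E.
apply/eqP; rewrite eqn_leq truncn_le_nat truncn_ge_nat.
  by rewrite ltr_pdivrMr// ler_pdivlMr// h1 -addnS h2.
by rewrite divr_ge0 ?(ltW h0)// (le_trans _ h1)// mulr_ge0// ltW.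
Qed.

(** Split off the first term and iterate [(x + y)^2 <= 2 x^2 + 2 y^2]. The weights do not depend on
    [n], so the bound survives in an infinite series. *)
Lemma sqr_sum_le_weighted (b : nat -> R) n :
  (\sum_(k < n) b k) ^+ 2 <= \sum_(k < n) 2 ^+ k.+1 * b k ^+ 2.
Proof.
elim: n b => [|n IH] b; first by rewrite !big_ord0 expr0n.
rewrite !big_ord_recl/= expr1.
apply: (@le_trans _ _ (2 * b 0%N ^+ 2 + 2 * (\sum_(i < n) b i.+1) ^+ 2)).
  set s := \sum_(i < n) _; have := sqr_ge0 (b 0%N - s); nra.
rewrite lerD2l (le_trans (ler_wpM2l _ (IH (fun k => b k.+1))))//.
by rewrite mulr_sumr; apply: ler_sum => i _; rewrite mulrA -exprS.
Qed.

Lemma sum_blocks (F : nat -> R) A B :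
  \sum_(i < A * B) F i = \sum_(I < A) \sum_(t < B) F (I * B + t)%N.
Proof.
rewrite -(big_mkord xpredT) big_nat_mul big_mkord; apply: eq_bigr => I _.
rewrite -{1}[(I * B)%N]add0n big_addn -mulnBl subSnn mul1n big_mkord.
by apply: eq_bigr => t _; rewrite addnC.
Qed.

End step_functions.

Section energy_curves.
Context {R : realType} (S : Type) (W : S -> S -> R) (x : R -> S) (E : R -> R)
  (c : R).
Hypotheses (W0 : forall y, W y y = 0) (Wsym : forall y z, W y z = W z y)
  (Wtri : forall y z w, W y w <= W y z + W z w).
Hypothesis E_ge : forall t, 0 <= t -> c <= E t.
Hypothesis W_le : forall s t, 0 <= s -> s <= t ->
  W (x s) (x t) ^+ 2 <= 2 * (t - s) * (E s - E t).

Let W_ge0 y z : 0 <= W y z.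
Proof. by have := Wtri y z y; rewrite W0 [W z y]Wsym; lra. Qed.

(** * Dyadic difference quotients on a fixed time interval *)

Section dyadic.
Variable T : R.
Hypothesis T0 : 0 < T.

(** [q n i] is the mean speed on a grid cell, [m n] the resulting step function, and [e n] the
    squared [L^2] norm of [m n] on [[0, T[]. *)
Let h n : R := T / 2 ^+ n.
Let q n i : R := W (x (i%:R * h n)) (x (i.+1%:R * h n)) / h n.
Let m n (r : R) : R := q n (Num.truncn (r / h n)).
Let e n : R := h n * \sum_(i < 2 ^ n) q n i ^+ 2.

Let h_gt0 n : 0 < h n. Proof. by rewrite divr_gt0// exprn_gt0. Qed.
Let q_ge0 n i : 0 <= q n i. Proof. by rewrite divr_ge0// ltW. Qed.
Let hqE n i : h n * q n i = W (x (i%:R * h n)) (x (i.+1%:R * h n)).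
Proof. by rewrite /q mulrC divfK// gt_eqF. Qed.
Let hD k l : h k = (2 ^ l)%:R * h (k + l).
Proof. by rewrite /h exprD natrX; field; rewrite !expf_neq0. Qed.

Let W_le_sum n i k :
  W (x (i%:R * h n)) (x ((i + k)%:R * h n)) <= h n * \sum_(l < k) q n (i + l).
Proof.
elim: k => [|k IH]; first by rewrite addn0 big_ord0 mulr0 W0.
apply: (le_trans (Wtri _ (x ((i + k)%:R * h n)) _)).
by rewrite big_ord_recr/= mulrDr lerD// hqE addnS.
Qed.

(** By [W_le] each term of [e n] is at most twice the drop of [E] over a cell, and the drops
    telescope. *)
Let e_le n : e n <= 2 * (E 0 - c).
Proof.
have tel N : \sum_(i < N) (E (i%:R * h n) - E (i.+1%:R * h n)) =
    E 0 - E (N%:R * h n).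
  elim: N => [|N IH]; first by rewrite big_ord0 mul0r subrr.
  by rewrite big_ord_recr/= IH; ring.
apply: (@le_trans _ _ (2 * (E 0 - E ((2 ^ n)%:R * h n)))); last first.
  by rewrite ler_pM2l// lerB// E_ge// mulr_ge0// ltW.
rewrite -tel /e !mulr_sumr; apply: ler_sum => i _.
have hn0 : h n != 0 by rewrite gt_eqF.
have hi : i%:R * h n <= i.+1%:R * h n by rewrite ler_pM2r// ler_nat.
have := W_le (mulr_ge0 (ler0n _ i) (ltW (h_gt0 n))) hi.
rewrite -mulrBl -natrB// subSnn mul1r => H.
have -> : h n * q n i ^+ 2 =
    (h n)^-1 * W (x (i%:R * h n)) (x (i.+1%:R * h n)) ^+ 2.
  by rewrite /q; field.
by rewrite mulrC ler_pdivrMr// (le_trans H)// mulrAC.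
Qed.

(* Refining the grid can only increase the discrete energy, by at least the
   squared [L^2] distance of the two difference quotients. *)
Let e_refine k l :
  e k + h (k + l) * \sum_(i < 2 ^ (k + l)) (q (k + l) i - q k (i %/ 2 ^ l)) ^+ 2
  <= e (k + l).
Proof.
rewrite /e (hD k l).
set h' := h (k + l); set B := (2 ^ l)%N; set Q := q (k + l).
have B0 : (0 < B)%N by rewrite expn_gt0.
rewrite expnD -/B (sum_blocks (fun i => Q i ^+ 2)).
rewrite (sum_blocks (fun i => (Q i - q k (i %/ B)) ^+ 2)).
rewrite !mulr_sumr -big_split/=; apply: ler_sum => I _.
under [X in _ + h' * X <= _]eq_bigr => t _.
  rewrite divnMDl// divn_small// addn0 sqrrB.
  over.
(* The triangle inequality makes the coarse quotient at most the mean of the fine ones. Expanding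
   the squares, the sum of [(Q - q k I)^2] over the block is then at most the sum of [Q^2] minus
   [B (q k I)^2]. *)
have hc : B%:R * q k I <= \sum_(t < B) Q (I * B + t)%N.
  rewrite -(ler_pM2l (h_gt0 (k + l))) mulrA [h _ * B%:R]mulrC -hD.
  apply: le_trans (W_le_sum _ _ _); rewrite hqE.
  by rewrite (hD k l) !mulrA -!natrM -mulSnr.
have q0 := q_ge0 k I; move: (q k I) q0 hc => p p0.
rewrite big_split/= sumrB sumr_const card_ord -[_ ^+ 2 *+ B]mulr_natl.
have -> : \sum_(t < B) Q (I * B + t)%N * p *+ 2 =
    2 * p * \sum_(t < B) Q (I * B + t)%N.
  by rewrite mulr_sumr; apply: eq_bigr => t _; rewrite -mulr_natl; ring.
move: (\sum_(t < B) Q (I * B + t)%N) (\sum_(t < B) Q (I * B + t)%N ^+ 2) => s1 s2.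
move=> hs; have h'0 : 0 < h' := h_gt0 _.
have : 0 <= h' * (p * (s1 - B%:R * p)).
  apply: mulr_ge0; first exact: ltW.
  by apply: mulr_ge0 => //; rewrite subr_ge0.
nra.
Qed.

Let e_le_mono k n : (k <= n)%N -> e k <= e n.
Proof.
move=> kn; rewrite -(subnKC kn); apply: le_trans (e_refine _ _).
by rewrite lerDl mulr_ge0 ?(ltW (h_gt0 _))// sumr_ge0// => i _; exact: sqr_ge0.
Qed.

(** [e] is monotone and bounded, so its increments can be made as small as wished. Of the two
    factors [2^(k+1)], one pays for the weight in [sqr_sum_le_weighted] and the other keeps the
    integrals summable. *)
Let subgrid : exists2 s : nat -> nat, {homo s : m n / (m < n)%N} &
  forall k n, (s k <= n)%N -> e n - e (s k) <= ((2 ^ k.+1)%:R * (2 ^ k.+1)%:R)^-1.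
Proof.
have cve : cvgn e.
  apply: nondecreasing_is_cvgn; first by move=> k n; exact: e_le_mono.
  by exists (2 * (E 0 - c)) => _ [n _ <-].
apply: (@extract_subsequence (fun k N => forall n, (N <= n)%N ->
  e n - e N <= ((2 ^ k.+1)%:R * (2 ^ k.+1)%:R)^-1)) => k N.
have d0 : 0 < ((2 ^ k.+1)%:R * (2 ^ k.+1)%:R)^-1 :> R.
  by rewrite invr_gt0 mulr_gt0// ltr0n expn_gt0.
have /cvgrPdist_le/(_ _ d0)[n0 _ n0P] := cve.
exists (maxn N n0); first exact: leq_maxl.
move=> n hn; have := n0P _ (leq_maxr N n0 : [set _ | _] _).
have := nondecreasing_cvgn_le e_le_mono cve n.
have := nondecreasing_cvgn_le e_le_mono cve (maxn N n0).
by move=> h1 h2; rewrite ger0_norm ?subr_ge0//; lra.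
Qed.

Let truncn_grid k l r : 0 <= r ->
  Num.truncn (r / h k) = (Num.truncn (r / h (k + l)) %/ 2 ^ l)%N.
Proof.
move=> r0.
(* Two naturals with the same lower bounds are equal, and the lower bounds of a truncation and of a
   quotient have exact characterisations. *)
have eqn_of_leq (a b : nat) : (forall n, (n <= a)%N = (n <= b)%N) -> a = b.
  by move=> ab; apply/eqP; rewrite eqn_leq -ab leqnn ab leqnn.
apply: eqn_of_leq => n; rewrite leq_divRL ?expn_gt0//.
have rh j : 0 <= r / h j by rewrite divr_ge0// ltW.
rewrite !truncn_ge_nat// !(ler_pdivlMr _ _ (h_gt0 _)) natrM.
by rewrite {1}(hD k l) mulrA.
Qed.

Local Notation D := (`[0, T[%classic : set R).
Local Notation lam := (@lebesgue_measure R).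

Let integral_grid n (g : nat -> R) : (forall k, 0 <= g k) ->
  (\int[lam]_(r in D) (g (Num.truncn (r / h n)))%:E)%E =
  (h n * \sum_(k < 2 ^ n) g k)%:E.
Proof.
move=> g0; have := integral_step_function 0 (2 ^ n) (h_gt0 n) g0.
rewrite mul0r add0n (_ : (2 ^ n)%:R * h n = T)//.
by rewrite natrX /h mulrC divfK// expf_neq0.
Qed.

Let integral_sqr_diff k n : (k <= n)%N ->
  (\int[lam]_(r in D) ((m n r - m k r) ^+ 2)%:E <= (e n - e k)%:E)%E.
Proof.
move=> kn; have nE := subnKC kn.
have -> : (\int[lam]_(r in D) ((m n r - m k r) ^+ 2)%:E =
    \int[lam]_(r in D) ((q n (Num.truncn (r / h n)) -
      q k (Num.truncn (r / h n) %/ 2 ^ (n - k))) ^+ 2)%:E)%E.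
  apply: eq_integral => r; rewrite inE/= in_itv/= => /andP[r0 _].
  by rewrite /m (truncn_grid k (n - k) r0) nE.
rewrite (integral_grid n (g := fun i => (q n i - q k (i %/ 2 ^ (n - k))) ^+ 2)).
  by have := e_refine k (n - k); rewrite nE lee_fin; lra.
by move=> i; exact: sqr_ge0.
Qed.

Let mm n (A : set R) : measurable_fun A (m n).
Proof. exact: measurable_step_function. Qed.

(** [M] is the quotient [m (s 0)] plus the square root of the series [H] of weighted squared
    increments. Telescoping from [m (s 0)] to [m (s k)] and applying [sqr_sum_le_weighted] bounds
    the squared difference by a partial sum of [H], and [H] is finite almost everywhere because its
    integral is at most [1]. *)
Let dyadic_speed : exists M : R -> R, exists s : nat -> nat,
  [/\ measurable_fun setT M, forall r, 0 <= M r,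
      (\int[lam]_(r in D) (M r ^+ 2)%:E < +oo)%E,
      {homo s : m n / (m < n)%N} &
      forall k, {ae lam, forall r, D r -> m (s k) r <= M r}].
Proof.
have [s hs sP] := subgrid.
pose b k r : R := 2 ^+ k.+1 * (m (s k.+1) r - m (s k) r) ^+ 2.
have b0 k r : 0 <= b k r by rewrite mulr_ge0 ?sqr_ge0// exprn_ge0.
have mb k A : measurable_fun A (b k).
  apply: measurable_funM => //; apply: measurable_funX.
  exact: measurable_funB.
pose H r : \bar R := (\sum_(0 <= k <oo) (b k r)%:E)%E.
have H0 r : (0 <= H r)%E by apply: nneseries_ge0 => k _ _; rewrite lee_fin.
have mH A : measurable_fun A H.
  apply: measurable_funTS; apply: (@ge0_emeasurable_sum _ _ _ setT
    (fun k r => (b k r)%:E) xpredT) => [k r _ _|k _].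
    by rewrite lee_fin.
  exact/measurable_EFinP.
have iH : (\int[lam]_(r in D) H r <= 1)%E.
  rewrite integral_nneseries//=; last 2 first.
  - by move=> k; apply/measurable_EFinP; exact: mb.
  - by move=> k r _; rewrite lee_fin.
  apply: le_trans (epsilon_trick0 xpredT ler01).
  apply: lee_nneseries => [k _ _|k _].
    by apply: integral_ge0 => r _; rewrite lee_fin.
  under eq_integral do rewrite EFinM.
  rewrite ge0_integralZl_EFin//; last 2 first.
  - by move=> r _; rewrite lee_fin sqr_ge0.
  - apply/measurable_EFinP; apply: measurable_funX.
    by apply: measurable_funB; exact: mm.
  have sk : (s k <= s k.+1)%N by apply: ltnW; exact: hs.
  apply: (@le_trans _ _ ((2 ^+ k.+1)%:E * (e (s k.+1) - e (s k))%:E)%E).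
    apply: lee_wpmul2l; first by rewrite lee_fin exprn_ge0.
    exact: integral_sqr_diff.
  rewrite -EFinM lee_fin.
  have w0 : 0 <= 2 ^+ k.+1 :> R by exact: exprn_ge0.
  apply: le_trans (ler_wpM2l w0 (sP k _ sk)) _.
  by rewrite natrX invfM mulrA divff ?mul1r// expf_neq0.
(* [M] dominates all [m (s k)] where [H] is finite; at the other points [fine]
   returns the junk value [0]. *)
pose M r := m (s 0%N) r + Num.sqrt (fine (H r)).
have mM : measurable_fun setT M.
  apply: measurable_funD => //.
  have mS : measurable_fun setT (@Num.sqrt R).
    by apply: continuous_measurable_fun; exact: sqrt_continuous.
  apply: (measurableT_comp mS).
  exact: (measurableT_comp (fine_measurable measurableT)).
exists M, s; split => //.
- by move=> r; rewrite addr_ge0 ?sqrtr_ge0//; exact: q_ge0.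
- apply: (@le_lt_trans _ _
    (\int[lam]_(r in D) ((2 * m (s 0%N) r ^+ 2)%:E + 2%:E * H r))%E).
    apply: ge0_le_integral => //.
    + by move=> r _; rewrite lee_fin sqr_ge0.
    + by apply/measurable_EFinP; apply: measurable_funX; exact: measurable_funTS.
    + apply: emeasurable_funD.
        apply/measurable_EFinP; apply: measurable_funM => //.
        by apply: measurable_funX; exact: mm.
      by apply: measurable_funeM; exact: mH.
    + move=> r _.
      have [Hoo|] := eqVneq (H r) +oo%E.
        by rewrite Hoo mulry gtr0_sg// mul1e addey// leey.
      move=> Hoo; have Hfin : H r \is a fin_num by rewrite ge0_fin_numE// ltey.
      rewrite -(fineK Hfin) -EFinM -EFinD lee_fin /M.
      have := sqr_sqrtr (fine_ge0 (H0 r)); set u := Num.sqrt _ => <-.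
      by have := sqr_ge0 (m (s 0%N) r - u); nra.
  rewrite ge0_integralD//; last 4 first.
  + by move=> r _; rewrite lee_fin mulr_ge0// sqr_ge0.
  + apply/measurable_EFinP; apply: measurable_funM => //.
    by apply: measurable_funX; exact: mm.
  + by move=> r _; rewrite mule_ge0.
  + by apply: measurable_funeM; exact: mH.
  rewrite lte_add_pinfty//.
    rewrite (integral_grid (s 0%N) (g := fun i => 2 * q (s 0%N) i ^+ 2)) ?ltry//.
    by move=> i; rewrite mulr_ge0 ?sqr_ge0.
  rewrite ge0_integralZl_EFin//; last exact: mH.
  by rewrite lte_mul_pinfty// (le_lt_trans iH)// ltry.
- move=> k.
  have iHf : lam.-integrable D H.
    apply/integrableP; split; first exact: mH.
    apply: (@le_lt_trans _ _ 1%E); last exact: ltry.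
    apply: le_trans iH; rewrite le_eqVlt; apply/orP; left; apply/eqP.
    by apply: eq_integral => r _; rewrite gee0_abs.
  have := @integrable_ae _ _ _ lam D (measurable_itv _) H iHf.
  move=> [N [mN N0 hN]]; exists N; split => // r nMr; apply: hN => /= HDr.
  apply: nMr => Dr; have {HDr}Hfin := HDr Dr; rewrite /M -lerBlDl.
  have -> : m (s k) r - m (s 0%N) r =
      \sum_(i < k) (m (s i.+1) r - m (s i) r).
    elim: k => [|k IH]; first by rewrite big_ord0 subrr.
    by rewrite big_ord_recr/= -IH; ring.
  apply: (le_trans (ler_norm _)); rewrite -sqrtr_sqr ler_wsqrtr//.
  apply: (le_trans (sqr_sum_le_weighted (fun i => m (s i.+1) r - m (s i) r) k)).
  rewrite -lee_fin fineK// -sumEFin -(big_mkord xpredT (fun i => (b i r)%:E)).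
  by apply: nneseries_lim_ge => i _ _; rewrite lee_fin.
Qed.

Let W_sqr_le s t : 0 <= s -> s <= t ->
  W (x s) (x t) ^+ 2 <= 2 * (E 0 - c) * (t - s).
Proof.
move=> s0 st; apply: (le_trans (W_le s0 st)).
rewrite mulrAC ler_wpM2r ?subr_ge0// ler_pM2l//.
apply: lerB; last by apply: E_ge; exact: le_trans st.
(* [E s <= E 0] is read off from [W_le] between [0] and [s] after division by [s], hence the
   separate case [s = 0]. *)
move: s0; rewrite le_eqVlt => /predU1P[<-//|s0].
have := W_le (lexx 0) (ltW s0); have := sqr_ge0 (W (x 0) (x s)); nra.
Qed.

(** Between the first grid point after [s] and the last one before [t], [W] is at most the integral
    of a step function dominated by [M]. The two end pieces are no longer than a cell, and
    [W_sqr_le] makes them small, so the inequality holds up to any [eps]. *)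
Lemma L2_speed : exists M : R -> R,
  [/\ measurable_fun setT M, (\int[lam]_(r in D) (M r ^+ 2)%:E < +oo)%E &
      forall s t, 0 <= s -> s <= t -> t < T ->
        W (x s) (x t) <= \int[lam]_(r in `[s, t]) M r].
Proof.
have [M [s [mM M0 iM hs Ms]]] := dyadic_speed.
exists M; split => // a b a0 ab bT.
have mE A : measurable_fun A (fun r => (M r)%:E).
  by apply/measurable_EFinP; exact: measurable_funTS.
have ME0 r : (0 <= (M r)%:E)%E by rewrite lee_fin.
pose I := (\int[lam]_(r in `[a, b]) (M r)%:E)%E.
have I0 : (0 <= I)%E by apply: integral_ge0.
have Ifin : I \is a fin_num.
  rewrite ge0_fin_numE//.
  apply: (@le_lt_trans _ _ (\int[lam]_(r in D) (1 + (M r ^+ 2)%:E))%E).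
    apply: (@le_trans _ _ (\int[lam]_(r in D) (M r)%:E)%E).
      apply: ge0_subset_integral => //; first exact: mE.
      move=> r /=; rewrite !in_itv/= => /andP[ar rb].
      by rewrite (le_trans a0 ar) (le_lt_trans rb bT).
    apply: ge0_le_integral => //; first exact: mE.
      apply: emeasurable_funD => //; apply/measurable_EFinP.
      by apply: measurable_funX; exact: measurable_funTS.
    by move=> r _; rewrite -EFinD lee_fin; have := sqr_ge0 (M r - 1); nra.
  rewrite ge0_integralD//; last 2 first.
  - by move=> r _; rewrite lee_fin sqr_ge0.
  - apply/measurable_EFinP; apply: measurable_funX; exact: measurable_funTS.
  rewrite lte_add_pinfty// (integral_cst lam) ?mul1e//=.
  by rewrite lebesgue_measure_itv/= lte_fin T0 ltry.
rewrite /Rintegral -/I; apply/ler_addgt0Pr => eps eps0.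
pose C := 2 * (E 0 - c).
have C0 : 0 <= C by apply: mulr_ge0 => //; rewrite subr_ge0 E_ge.
have [k hk] : exists k, C * h (s k) <= (eps / 2) ^+ 2.
  have d0 : 0 < (eps / 2) ^+ 2 by rewrite exprn_gt0// divr_gt0.
  (* The mesh is [T / 2^(s k)], and [k < 2^k <= 2^(s k)]. *)
  exists (Num.truncn (C * T / (eps / 2) ^+ 2)).+1; set k := _.+1.
  rewrite /h mulrA ler_pdivrMr ?exprn_gt0// [leRHS]mulrC -ler_pdivrMr//.
  apply: le_trans (ltW (truncnS_gt _)) _; rewrite -/k.
  rewrite -natrX ler_nat (leq_trans (homo_ltn_ge_id hs k))//.
  exact/ltnW/ltn_expl.
move: (s k) (Ms k) hk => n mnM hn; have hn0 := h_gt0 n.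
have close u v : 0 <= u -> u <= v -> v <= u + h n -> W (x u) (x v) <= eps / 2.
  move=> u0 uv vu; rewrite -ler_sqr ?nnegrE//; last by rewrite divr_ge0// ltW.
  apply: (le_trans (W_sqr_le u0 uv)); apply: le_trans hn.
  by apply: ler_wpM2l => //; lra.
pose i := (Num.truncn (a / h n)).+1; pose j := Num.truncn (b / h n).
have ai : a <= i%:R * h n by rewrite -ler_pdivrMr// ltW// truncnS_gt.
have ia : i%:R * h n <= a + h n.
  rewrite -natr1 mulrDl mul1r lerD2r -ler_pdivlMr//.
  by rewrite truncn_le divr_ge0// ltW.
have b0 := le_trans a0 ab.
have jb : j%:R * h n <= b by rewrite -ler_pdivlMr// truncn_le divr_ge0// ltW.
have bj : b <= j.+1%:R * h n by rewrite -ler_pdivrMr// ltW// truncnS_gt.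
have [ij|ji] := leqP i j; last first.
  have : W (x a) (x b) <= eps / 2.
    apply: close => //; apply: le_trans bj (le_trans _ ia).
    by rewrite ler_pM2r// ler_nat.
  by have := fine_ge0 I0; lra.
have ihj : i%:R * h n <= j%:R * h n by rewrite ler_pM2r// ler_nat.
have h1 : W (x a) (x (i%:R * h n)) <= eps / 2 by apply: close.
have h2 : W (x (j%:R * h n)) (x b) <= eps / 2.
  apply: close => //; first by rewrite mulr_ge0// ltW.
  by move: bj; rewrite -natr1 mulrDl mul1r.
have h3 : W (x (i%:R * h n)) (x (j%:R * h n)) <= fine I.
  rewrite -(subnKC ij); apply: (le_trans (W_le_sum n i (j - i))).
  rewrite -lee_fin fineK// -(integral_step_function i (j - i) hn0)//.
  apply: (@le_trans _ _
      (\int[lam]_(r in `[(i%:R * h n)%R, ((i + (j - i))%:R * h n)%R[) (M r)%:E)%E).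
    apply: ae_ge0_le_integral => //.
    - by move=> r _; rewrite lee_fin.
    - by apply/measurable_EFinP; exact: mm.
    - exact: mE.
    - move: mnM => [N [mN N0 hN]]; exists N; split => // r nMr; apply: hN => /= HD.
      apply: nMr => /=; rewrite in_itv/= => /andP[ir rj].
      rewrite lee_fin; apply: HD; rewrite in_itv/=; apply/andP; split.
        by apply: le_trans ir; rewrite mulr_ge0// ltW.
      by apply: lt_le_trans rj _; rewrite (subnKC ij) (le_trans jb)// ltW.
  apply: ge0_subset_integral => //; first exact: mE.
  move=> r /=; rewrite !in_itv/= => /andP[ir rj].
  rewrite (le_trans ai ir)/=; apply: le_trans (ltW rj) _.
  by rewrite (subnKC ij).
have := Wtri (x a) (x (i%:R * h n)) (x b).
have := Wtri (x (i%:R * h n)) (x (j%:R * h n)) (x b).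
lra.
Qed.

End dyadic.

Lemma AC2loc_energy_curve : AC2loc W x.
Proof.
(* The speed is built on a half-open interval that has to contain [b]. *)
move=> a b a0 ab; have T0 : 0 < b + 1 by lra.
have [M [mM iM WM]] := L2_speed T0.
exists M; split; first exact: measurable_funTS.
- apply: le_lt_trans iM; apply: ge0_subset_integral => //.
  + by apply/measurable_EFinP; apply: measurable_funX; exact: measurable_funTS.
  + by move=> r _; rewrite lee_fin sqr_ge0.
  + move=> r /=; rewrite !in_itv/= => /andP[ar rb].
    by rewrite (le_trans a0 ar)/=; lra.
- by move=> s t as_ st tb; apply: WM => //; lra.
Qed.
End energy_curves.

(** * Minimizing movements in compact pseudometric spaces *)

Section movement.
Context {R : realType} (S : Type) (W : S -> S -> R) (f : S -> R) (c : R).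
Hypotheses (W0 : forall x, W x x = 0) (Wsym : forall x y, W x y = W y x)
  (Wtri : forall x y z, W x z <= W x y + W y z).

Lemma pseudometric_ge0 x y : 0 <= W x y.
Proof. by have := Wtri x y x; rewrite W0 [W y x]Wsym; lra. Qed.

Lemma pseudometric_cvg (u v : nat -> S) x y :
  W (u n) x @[n --> \oo] --> 0 -> W (v n) y @[n --> \oo] --> 0 ->
  W (u n) (v n) @[n --> \oo] --> W x y.
Proof.
move=> ux vy; apply/cvgrPdist_le => e e0.
have e20 : 0 < e / 2 by lra.
near=> n.
have h1 : `|0 - W (u n) x| <= e / 2.
  by near: n; have /cvgrPdist_le := ux; exact.
have h2 : `|0 - W (v n) y| <= e / 2.
  by near: n; have /cvgrPdist_le := vy; exact.
rewrite sub0r normrN ger0_norm ?pseudometric_ge0// in h1.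
rewrite sub0r normrN ger0_norm ?pseudometric_ge0// in h2.
rewrite ler_norml; apply/andP; split.
  have := Wtri (u n) x (v n); have := Wtri x y (v n).
  by rewrite [W y (v n)]Wsym; lra.
have := Wtri x (u n) y; have := Wtri (u n) (v n) y.
by rewrite [W x (u n)]Wsym; lra.
Unshelve. all: by end_near. Qed.

Hypothesis f_cvg : forall (u : nat -> S) x,
  W (u n) x @[n --> \oo] --> 0 -> f (u n) @[n --> \oo] --> f x.
Hypothesis f_ge : forall x, c <= f x.
(** Sequential compactness is given through coordinates, so that one subsequence can be extracted
    for countably many sequences at once. *)
Variable phi : nat -> S -> R.
Hypothesis phi01 : forall j x, 0 <= phi j x <= 1.
Hypothesis phi_cvg : forall u : nat -> S,
  (forall j, cvgn (fun n => phi j (u n))) ->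
  exists x, W (u n) x @[n --> \oo] --> 0.

Local Notation fE := (fun x => (f x)%:E).

Lemma coordinates_seq_compact (u : nat -> S) :
  exists2 s : nat -> nat, {homo s : m n / (m < n)%N} &
    exists x, W (u (s n)) x @[n --> \oo] --> 0.
Proof.
have [s hs sP] := @bounded_diagonal R (fun n j => phi j (u n))
  (fun n j => phi01 j (u n)).
by exists s => //; exact: (@phi_cvg (u \o s)).
Qed.

(** Direct method: a minimizing sequence has a convergent subsequence, along which both [f] and the
    distance to [y] are continuous. *)
Lemma prox_step_exists tau y : 0 < tau -> exists x, prox_step W fE tau y x.
Proof.
move=> tau0; pose g v := f v + (2 * tau)^-1 * W v y ^+ 2.
have g_ge v : c <= g v.
  by apply: le_trans (f_ge v) _; rewrite lerDl mulr_ge0 ?sqr_ge0 ?invr_ge0; lra.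
have hinf : has_inf (range g).
  split; first by exists (g y), y.
  by exists c => _ [v _ <-].
have /choice[u uP] n : exists v, g v < inf (range g) + n.+1%:R^-1.
  have e0 : 0 < n.+1%:R^-1 :> R by [].
  by have [_ [v _ <-] h] := inf_adherent e0 hinf; exists v.
have g_inf v : inf (range g) <= g v.
  by apply: ge_inf; [case: hinf | exists v].
have gu : g (u n) @[n --> \oo] --> inf (range g).
  apply/cvgrPdist_lt => e e0; near=> n.
  rewrite distrC ger0_norm ?subr_ge0// ltrBlDl (lt_trans (uP n))// ltrD2l.
  by near: n; exact: near_infty_natSinv_lt (PosNum e0).
have [s hs [x ux]] := coordinates_seq_compact u.
have gx : g (u (s n)) @[n --> \oo] --> g x.
  apply: cvgD; first exact: f_cvg.
  apply: cvgMl_tmp; rewrite expr2.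
  under eq_fun do rewrite expr2.
  have h : W (u (s n)) y @[n --> \oo] --> W x y.
    by apply: (pseudometric_cvg ux); under eq_fun do rewrite W0; exact: cvg_cst.
  exact: cvgM.
exists x => v; rewrite -!EFinD lee_fin.
suff -> : f x + (2 * tau)^-1 * W x y ^+ 2 = inf (range g) by exact: g_inf.
apply: (cvg_unique _ gx) => //; exact: cvg_subsequence hs gu.
Unshelve. all: by end_near. Qed.

Lemma minimizing_scheme_exists x0 : exists x, minimizing_scheme W fE x0 x.
Proof.
have /choice[g gP] (p : R * S) : exists x, 0 < p.1 -> prox_step W fE p.1 p.2 x.
  have [p0|p0] := ltP 0 p.1; last by exists p.2.
  by have [x] := prox_step_exists p.2 p0; exists x.
exists (fun tau k => iter k (fun y => g (tau, y)) x0) => tau tau0; split => // k.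
exact: (gP (tau, _)).
Qed.

Section scheme.
Variables (x0 : S) (x : R -> nat -> S) (xbar : R -> R -> S).
Hypothesis x_scheme : minimizing_scheme W fE x0 x.
Hypothesis xbar0 : forall tau, 0 < tau -> xbar tau 0 = x0.
Hypothesis xbarE : forall tau k t, 0 < tau -> (1 <= k)%N ->
  (k%:R - 1) * tau < t -> t <= k%:R * tau -> xbar tau t = x tau k.

Lemma scheme_step tau k : 0 < tau ->
  W (x tau k) (x tau k.+1) ^+ 2 <= 2 * tau * (f (x tau k) - f (x tau k.+1)).
Proof.
move=> tau0; have [_ /(_ k (x tau k))] := x_scheme tau0.
rewrite W0 -!EFinD lee_fin expr0n/= mulr0 addr0 [W (x _ k) _]Wsym => h.
rewrite mulrC -ler_pdivrMr; last lra.
by rewrite mulrC; lra.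
Qed.

(* Cauchy-Schwarz over the steps, one step at a time:
   [(a + b)^2 <= (n + 1) (a^2 / n + b^2)]. *)
Lemma scheme_steps tau k n : 0 < tau ->
  W (x tau k) (x tau (k + n)) ^+ 2 <=
  2 * tau * n%:R * (f (x tau k) - f (x tau (k + n))).
Proof.
move=> tau0; elim: n => [|n IH].
  by rewrite addn0 W0 expr0n/= mulr0 mul0r.
have stp := scheme_step (k + n) tau0; rewrite -addnS in stp.
have [n0|n0] := posnP n; first by move: stp; rewrite n0 addn0 mulr1.
have n1 : (1 : R) <= n%:R by rewrite ler1n.
move: IH stp (Wtri (x tau k) (x tau (k + n)) (x tau (k + n.+1))).
move: (pseudometric_ge0 (x tau k) (x tau (k + n.+1))).
set a := W _ (x tau (k + n)); set b := W (x tau (k + n)) _; set e := W _ _.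
rewrite -[n.+1%:R]natr1; move: (n%:R) n1 => m m1.
set p := f (x tau k); set q := f (x tau (k + n)); set r := f _.
move=> e0 ha hb heab.
have he : e ^+ 2 <= (a + b) ^+ 2 by rewrite ler_sqr ?nnegrE//; lra.
apply: (le_trans he).
rewrite -(ler_pM2l (_ : 0 < m)); last lra.
apply: (@le_trans _ _ ((m + 1) * (a ^+ 2 + m * b ^+ 2))).
  by have := sqr_ge0 (a - m * b); nra.
have : a ^+ 2 + m * b ^+ 2 <= 2 * tau * m * (p - r) by nra.
move=> h; have -> : m * (2 * tau * (m + 1) * (p - r)) =
  (m + 1) * (2 * tau * m * (p - r)) by ring.
by rewrite ler_wpM2l//; lra.
Qed.

Lemma scheme_energy tau k n : 0 < tau -> f (x tau (k + n)) <= f (x tau k).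
Proof.
move=> tau0; elim: n => [|n]; first by rewrite addn0.
apply: le_trans; rewrite addnS.
by have := scheme_step (k + n) tau0;
  have := sqr_ge0 (W (x tau (k + n)) (x tau (k + n).+1)); nra.
Qed.

(** [k] is the ceiling of [t / tau], because the interpolation takes the value attached to the right
    end of the step. Time [0] belongs to no step and is treated apart. *)
Lemma scheme_time tau t : 0 < tau -> 0 <= t ->
  exists k, [/\ xbar tau t = x tau k, t <= k%:R * tau & k%:R * tau < t + tau].
Proof.
move=> tau0; rewrite le_eqVlt => /predU1P[<-|t0].
  exists 0%N; rewrite xbar0// mul0r add0r; split => //.
  by have [] := x_scheme tau0.
pose z := Num.ceil (t / tau).
have z0 : (0 < z)%R by rewrite /z ceil_gt0 divr_gt0.
have [k kz] : exists k, z = k%:Z by exists `|z|%N; rewrite gez0_abs // ltW.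
have k1 : (1 <= k)%N by rewrite kz in z0.
have h1 : t <= k%:R * tau.
  by rewrite -ler_pdivrMr// -[k%:R]/(k%:Z%:~R) -kz ceil_ge.
have h2 : k%:R * tau < t + tau.
  rewrite -ltrBlDr -[X in _ - X]mul1r -mulrBl -ltr_pdivlMr//.
  have : z%:~R - 1 < t / tau by have := ceilB1_lt (t / tau); rewrite intrB.
  by rewrite kz.
exists k; split => //; apply: xbarE => //.
by rewrite mulrBl mul1r; lra.
Qed.

(** Rounding both times up to the grid lengthens their difference by less than [tau], which is the
    extra term. *)
Lemma scheme_interpolation tau s t : 0 < tau -> 0 <= s -> s <= t ->
  W (xbar tau s) (xbar tau t) ^+ 2 <=
  2 * (t - s + tau) * (f (xbar tau s) - f (xbar tau t)).
Proof.
move=> tau0 s0 st.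
have [k [-> k1 k2]] := scheme_time tau0 s0.
have [l [-> l1 l2]] := scheme_time tau0 (le_trans s0 st).
have kl : (k <= l)%N.
  rewrite -ltnS -(ltr_nat R) -(ltr_pM2r tau0) -natr1 mulrDl mul1r; lra.
rewrite -(subnKC kl); apply: (le_trans (scheme_steps _ _ tau0)).
have h := scheme_energy k (l - k) tau0.
rewrite ler_wpM2r ?subr_ge0// -mulrA ler_wpM2l// natrB// mulrC mulrBl.
lra.
Qed.

Lemma scheme_energy_le tau t : 0 < tau -> 0 <= t -> f (xbar tau t) <= f x0.
Proof.
move=> tau0 t0; have [k [-> _ _]] := scheme_time tau0 t0.
have [<- _] := x_scheme tau0; exact: (scheme_energy 0).
Qed.

Lemma scheme_converges : exists (tau : nat -> R) (y : R -> S),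
  [/\ forall l, 0 < tau l < 1, decreasing_seq tau, tau @ \oo --> 0,
      AC2loc W y &
      forall t, 0 <= t -> W (xbar (tau l) t) (y t) @[l --> \oo] --> 0]
  /\ minimizing_movement W fE x0 y.
Proof.
(* One code stands for a time [i/(j+1)] and a coordinate [p], so a single extraction settles all
   rational times. The step [1/(n+2)] lies strictly below [1]; numbers that code nothing get the
   value [0]. *)
pose a n k := if unpickle k is Some (i, j, p)
  then phi p (xbar n.+2%:R^-1 ((i : nat)%:R / (j : nat).+1%:R)) else 0.
have [|s hs sP] := @bounded_diagonal R a.
  by move=> n k; rewrite /a; case: unpickle => [[[i j] p]|] //; rewrite lexx ler01.
pose tau l : R := (s l).+2%:R^-1.
have tau0 l : 0 < tau l by rewrite invr_gt0.
have tau1 l : tau l < 1 by rewrite invf_lt1// ltr1n.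
have tau_cvg : tau @ \oo --> 0.
  have := cvg_subsequence hs (cvg_subsequence (fun m n (mn : (m < n)%N) =>
    (mn : (m.+1 < n.+1)%N)) (@cvg_harmonic R)).
  exact.
have rat_cvg i j : exists y,
    W (xbar (tau l) (i%:R / j.+1%:R)) y @[l --> \oo] --> 0.
  apply: (@phi_cvg (fun l => xbar (tau l) (i%:R / j.+1%:R))) => p.
  by have := sP (pickle (i, j, p)); rewrite /a pickleK.
have equi l t u : 0 <= t -> t <= u ->
    W (xbar (tau l) t) (xbar (tau l) u) ^+ 2 <= 2 * (f x0 - c) * (u - t + tau l).
  move=> t0 tu; apply: (le_trans (scheme_interpolation (tau0 l) t0 tu)).
  rewrite mulrAC ler_wpM2r//; first by have := ltW (tau0 l); lra.
  rewrite ler_pM2l// lerB//; exact: scheme_energy_le.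
have C0 : 0 <= 2 * (f x0 - c) by rewrite mulr_ge0// subr_ge0.
(* At a real time a further subsequence only supplies the candidate [y]. The whole sequence
   converges to it by comparison with a nearby rational time, whose limit [z] is known: [z] and [y]
   are within [3 e / 5], and two more steps of [e / 5] lead from the curve to [z]. *)
have time_cvg t : exists y, 0 <= t -> W (xbar (tau l) t) y @[l --> \oo] --> 0.
  have [t0|t0] := leP 0 t; last first.
    by exists x0.
  have [r hr [y uy]] := coordinates_seq_compact (fun l => xbar (tau l) t).
  exists y => _; apply/cvgrPdist_le => e e0.
  have e5 : 0 < e / 5 by lra.
  (* Half of [(e / 5)^2] is kept for the term [tau l] in [equi]. *)
  have [j hj] : exists j, 2 * (f x0 - c) * j.+1%:R^-1 <= (e / 5) ^+ 2 / 2.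
    have d0 : 0 < (e / 5) ^+ 2 / 2 by rewrite divr_gt0// exprn_gt0.
    exists (Num.truncn (2 * (f x0 - c) / ((e / 5) ^+ 2 / 2))).
    rewrite ler_pdivrMr// [leRHS]mulrC -ler_pdivrMr//.
    exact: ltW (truncnS_gt _).
  pose i := (Num.truncn (t * j.+1%:R)).+1.
  have tq : t <= i%:R / j.+1%:R by rewrite ler_pdivlMr// ltW// truncnS_gt.
  have qt : i%:R / j.+1%:R <= t + j.+1%:R^-1.
    rewrite ler_pdivrMr// mulrDl mulVf// -[i%:R]natr1 lerD2r truncn_le.
    by rewrite mulr_ge0.
  have [z qz] := rat_cvg i j.
  have near_q : \forall l \near \oo,
      W (xbar (tau l) t) (xbar (tau l) (i%:R / j.+1%:R)) <= e / 5.
    have : 2 * (f x0 - c) * tau l @[l --> \oo] --> 2 * (f x0 - c) * 0.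
      exact: cvgMl_tmp.
    have d0 : 0 < (e / 5) ^+ 2 / 2 by rewrite divr_gt0// exprn_gt0.
    rewrite mulr0 => /cvgrPdist_le/(_ _ d0); apply: filterS => l.
    rewrite sub0r normrN => /(le_trans (ler_norm _)) hl.
    rewrite -ler_sqr ?nnegrE ?pseudometric_ge0//; last exact: ltW.
    apply: (le_trans (equi l _ _ t0 tq)).
    apply: (@le_trans _ _ (2 * (f x0 - c) * (j.+1%:R^-1 + tau l))).
      by apply: ler_wpM2l => //; rewrite lerD2r lerBlDl.
    by rewrite mulrDr; apply: le_trans (lerD hj hl) _; rewrite -splitr.
  have near_z : \forall l \near \oo, W (xbar (tau l) (i%:R / j.+1%:R)) z <= e / 5.
    move/cvgrPdist_le : qz => /(_ _ e5); apply: filterS => l.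
    by rewrite sub0r normrN => /(le_trans (ler_norm _)).
  have near_y : \forall n \near \oo, W (xbar (tau (r n)) t) y <= e / 5.
    move/cvgrPdist_le : uy => /(_ _ e5); apply: filterS => l.
    by rewrite sub0r normrN => /(le_trans (ler_norm _)).
  have zy : W z y <= e / 5 + e / 5 + e / 5.
    have [n [[h1 h2] h3]] : exists n,
        (W (xbar (tau (r n)) t) (xbar (tau (r n)) (i%:R / j.+1%:R)) <= e / 5 /\
         W (xbar (tau (r n)) (i%:R / j.+1%:R)) z <= e / 5) /\
        W (xbar (tau (r n)) t) y <= e / 5.
      have near_qz := @filterI _ _ eventually_filter _ _ near_q near_z.
      have near_qzr : \forall n \near \oo,
          W (xbar (tau (r n)) t) (xbar (tau (r n)) (i%:R / j.+1%:R)) <= e / 5 /\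
          W (xbar (tau (r n)) (i%:R / j.+1%:R)) z <= e / 5.
        exact: (homo_ltn_cvgnyy hr near_qz).
      by have [n nP] := filter_ex (filterI near_qzr near_y); exists n.
    have := Wtri z (xbar (tau (r n)) (i%:R / j.+1%:R)) y.
    have := Wtri (xbar (tau (r n)) (i%:R / j.+1%:R)) (xbar (tau (r n)) t) y.
    have := Wsym z (xbar (tau (r n)) (i%:R / j.+1%:R)).
    have := Wsym (xbar (tau (r n)) t) (xbar (tau (r n)) (i%:R / j.+1%:R)).
    lra.
  near=> l.
  rewrite sub0r normrN ger0_norm ?pseudometric_ge0//.
  have h1 : W (xbar (tau l) t) (xbar (tau l) (i%:R / j.+1%:R)) <= e / 5.
    by near: l.
  have h2 : W (xbar (tau l) (i%:R / j.+1%:R)) z <= e / 5 by near: l.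
  have := Wtri (xbar (tau l) t) (xbar (tau l) (i%:R / j.+1%:R)) y.
  have := Wtri (xbar (tau l) (i%:R / j.+1%:R)) z y.
  lra.
have [y yP] := choice time_cvg.
have y_energy t u : 0 <= t -> t <= u ->
    W (y t) (y u) ^+ 2 <= 2 * (u - t) * (f (y t) - f (y u)).
  move=> t0 tu; have u0 := le_trans t0 tu.
  have cW : W (xbar (tau l) t) (xbar (tau l) u) ^+ 2 @[l --> \oo] -->
      W (y t) (y u) ^+ 2.
    have h := pseudometric_cvg (yP _ t0) (yP _ u0).
    by rewrite expr2; under eq_fun do rewrite expr2; exact: cvgM.
  (* Energies converge along with the points, so the discrete inequality passes to the limit and the
     rounding term disappears. *)
  have cR : 2 * (u - t + tau l) * (f (xbar (tau l) t) - f (xbar (tau l) u))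
      @[l --> \oo] --> 2 * (u - t + 0) * (f (y t) - f (y u)).
    apply: cvgM; first by apply: cvgMl_tmp; apply: cvgD => //; exact: cvg_cst.
    by apply: cvgB; apply: f_cvg; exact: yP.
  rewrite -[u - t]addr0; apply: (ler_cvg_to cW cR); apply: nearW => l.
  exact: scheme_interpolation.
exists tau, y; split.
  split => //.
  - by move=> l; rewrite tau0 tau1.
  - apply/decreasing_seqP => l.
    by rewrite ltf_pV2 ?posrE// ltr_nat !ltnS; exact: hs.
  - apply: (@AC2loc_energy_curve _ _ W y (fun t => f (y t)) c) => //.
split; first exact: ltry.
exists (fun k _ => tau k), (fun k => x (tau k)), (fun k => xbar (tau k)).
have x00 k : x (tau k) 0%N = x0 by have [] := x_scheme (tau0 k).
split.
- split => //.
  + move=> k; apply/eqyP => A A0.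
    pose n := (Num.truncn (A / tau k)).+1.
    apply: le_trans (nneseries_lim_ge n.+1 _); last first.
      by move=> i _ _; rewrite lee_fin ltW.
    rewrite sumEFin lee_fin sumr_const_nat subn1/= -mulr_natl.
    by rewrite -ler_pdivrMr// ltW// truncnS_gt.
  + rewrite (_ : (fun k => _) = (fun k => (tau k)%:E)).
      by apply: cvg_EFin; [exact: nearW | exact: tau_cvg].
    apply/funext => k; rewrite (_ : [set _ | _ in _] = [set (tau k)%:E]) ?ereal_sup1//.
    apply/seteqP; split => [_ [m _ <-]//|_ ->]; by exists 1%N.
- move=> k [//|m] _ /=; have [_] := x_scheme (tau0 k); exact.
- by under eq_fun do rewrite x00; exact: cvg_cst.
- under eq_fun do rewrite x00 W0.
  by rewrite (cvg_limn_einf_sup (cvg_cst _)).2 ltry.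
- split; last by move=> t t0; exact: yP.
  move=> k; split; first by rewrite x00 xbar0.
  move=> m t m1; rewrite !sumr_const_nat subn1/= => h1 h2.
  apply: xbarE => //; last by rewrite mulr_natl (le_trans h2)// subn1.
  by move: h1; rewrite -subn1 -[tau k *+ _]mulr_natl natrB.
Unshelve. all: by end_near. Qed.

End scheme.
End movement.

(** * Gluing of probability spaces along finite labels *)

Section finite_gluing.
Context {R : realType}.

Section probability_of_measure.
Context d (T : measurableType d) (m : {measure set T -> \bar R}).
Hypothesis m1 : m setT = 1%E.

(** The proof that the total mass is one is an argument, so that a probability structure can be
    attached to the term. *)
Definition mprobability & m setT = 1%E : set T -> \bar R := m.

HB.instance Definition _ := isMeasure.Build _ _ _ (mprobability m1)
  (measure0 m) (measure_ge0 m) (@measure_semi_sigma_additive _ _ _ m).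
HB.instance Definition _ := Measure_isProbability.Build _ _ _ (mprobability m1) m1.

End probability_of_measure.

Section finite_sum.
Context d (T : measurableType d) (I : finType)
  (m : I -> {measure set T -> \bar R}).

Definition fin_msum (A : set T) : \bar R := (\sum_i m i A)%E.

Let fin_msum0 : fin_msum set0 = 0%E.
Proof. by rewrite /fin_msum big1. Qed.

Let fin_msum_ge0 B : (0 <= fin_msum B)%E.
Proof. by apply: sume_ge0. Qed.

Let fin_msum_sigma_additive : semi_sigma_additive fin_msum.
Proof.
move=> F mF tF mUF; rewrite [X in _ --> X](_ : _ =
    lim ((fun n => \sum_(0 <= i < n) fin_msum (F i))%E @ \oo)).
  by apply: is_cvg_ereal_nneg_natsum => k _; exact: sume_ge0.
by rewrite nneseries_sum//; apply: eq_bigr => i _; exact: measure_semi_bigcup.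
Qed.

HB.instance Definition _ := isMeasure.Build _ _ _ fin_msum
  fin_msum0 fin_msum_ge0 fin_msum_sigma_additive.

End finite_sum.

Lemma measure_fiber_partition d (T : measurableType d) (m : {measure set T -> \bar R})
    (I : finType) (a : T -> I) (A : set T) :
  (forall i, measurable (a @^-1` [set i])) -> measurable A ->
  (\sum_i m (A `&` a @^-1` [set i]))%E = m A.
Proof.
move=> ma mA; rewrite -[in RHS](setIT A).
have -> : setT = \bigcup_(i in [set: I]) (a @^-1` [set i]).
  by apply/seteqP; split => x // _; exists (a x).
rewrite setI_bigcupr measure_fin_bigcup//; last 2 first.
- apply/trivIsetP => i j _ _ /eqP ij.
  apply/seteqP; split => // x [[_ /= xi] [_ /= xj]].
  by apply: ij; rewrite -xi -xj.
- by move=> i _; exact: measurableI.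
rewrite (_ : [set: I] = [set` index_enum I]).
- by rewrite -fsbig_seq// index_enum_uniq.
- by apply/seteqP; split => i //= _; exact: mem_index_enum.
- exact: finite_finset.
Qed.

Section glue.
Context d1 d2 (T1 : measurableType d1) (T2 : measurableType d2).
Variables (mu : probability T1 R) (nu : probability T2 R).
Variables (I : finType) (a : T1 -> I) (b : T2 -> I) (pi : I -> I -> R).
Hypotheses (ma : forall i, measurable (a @^-1` [set i]))
  (mb : forall i, measurable (b @^-1` [set i])).
Hypothesis pi_ge0 : forall i j, 0 <= pi i j.
Hypothesis pi_l : forall i, (\sum_j pi i j)%:E = mu (a @^-1` [set i]).
Hypothesis pi_r : forall j, (\sum_i pi i j)%:E = nu (b @^-1` [set j]).

Let p i := \sum_j pi i j.
Let q j := \sum_i pi i j.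

Let p0 i : 0 <= p i. Proof. exact: sumr_ge0. Qed.
Let q0 i : 0 <= q i. Proof. exact: sumr_ge0. Qed.

Let pi_p0 i j : p i = 0 -> pi i j = 0.
Proof. by move=> /eqP; rewrite psumr_eq0// => /allP/(_ j)/(_ (mem_index_enum _))/eqP. Qed.
Let pi_q0 i j : q j = 0 -> pi i j = 0.
Proof. by move=> /eqP; rewrite psumr_eq0// => /allP/(_ i)/(_ (mem_index_enum _))/eqP. Qed.

(** Density of the glued measure with respect to the product measure on [D ij]. When a label has
    mass zero the quotient is [0], and so is [pi] there by [pi_p0] and [pi_q0]. *)
Let c (ij : I * I) := pi ij.1 ij.2 / (p ij.1 * q ij.2).
Let c_ge0 ij : 0 <= c ij. Proof. by rewrite divr_ge0// mulr_ge0. Qed.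

Let D (ij : I * I) : set (T1 * T2) :=
  a @^-1` [set ij.1] `*` b @^-1` [set ij.2].
Let mD ij : measurable (D ij). Proof. exact: measurableX. Qed.

Let G : {measure set (T1 * T2) -> \bar R} :=
  fin_msum (fun ij => mscale (NngNum (c_ge0 ij)) (mrestr (mu \x nu)%E (mD ij))).

Let GX A B : measurable A -> measurable B -> G (A `*` B) =
  (\sum_ij (c ij)%:E * (mu (A `&` a @^-1` [set ij.1]) *
                        nu (B `&` b @^-1` [set ij.2])))%E.
Proof.
move=> mA mB; apply: eq_bigr => ij _.
rewrite -product_measure1E; [|exact: measurableI|exact: measurableI].
by rewrite setXI.
Qed.

(* The conditional laws given the labels are glued with the product coupling. *)
Lemma finite_glue : exists G' : probability (T1 * T2)%type R,
  [/\ forall A, measurable A -> G' (fst @^-1` A) = mu A,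
      forall B, measurable B -> G' (snd @^-1` B) = nu B &
      G' [set z | a z.1 != b z.2] = (\sum_i \sum_(j | j != i) pi i j)%:E].
Proof.
have fmu A : measurable A -> mu A \is a fin_num by move=> mA; exact: fin_num_measure.
have fnu A : measurable A -> nu A \is a fin_num by move=> mA; exact: fin_num_measure.
have pE i : mu (a @^-1` [set i]) = (p i)%:E by rewrite -pi_l.
have qE j : nu (b @^-1` [set j]) = (q j)%:E by rewrite -pi_r.
have GE A B : measurable A -> measurable B -> G (A `*` B) =
    (\sum_i \sum_j (c (i, j))%:E * (mu (A `&` a @^-1` [set i]) *
                                     nu (B `&` b @^-1` [set j])))%E.
  by move=> mA mB; rewrite GX// pair_bigA.
have Gl A : measurable A -> G (fst @^-1` A) = mu A.
  move=> mA; have -> : fst @^-1` A = A `*` [set: T2].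
    by apply/seteqP; split => z //= [].
  rewrite GE// -(measure_fiber_partition mu ma mA).
  apply: eq_bigr => i _.
  have mAi : measurable (A `&` a @^-1` [set i]) by exact: measurableI.
  have [pi0|pi0] := eqVneq (p i) 0.
    have mu0 : mu (A `&` a @^-1` [set i]) = 0%E.
      have : (mu (A `&` a @^-1` [set i]) <= (p i)%:E)%E by rewrite -pE le_measure ?inE.
      by rewrite pi0 => h; apply/eqP; rewrite eq_le measure_ge0 h.
    by rewrite mu0 big1// => j _; rewrite mul0e mule0.
  rewrite -(fineK (fmu _ mAi)).
  under eq_bigr => j _ do rewrite setTI qE -!EFinM.
  rewrite sumEFin -[RHS](fineK (fmu _ mAi)); congr EFin.
  transitivity (\sum_j pi i j / p i * fine (mu (A `&` a @^-1` [set i]))).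
    apply: eq_bigr => j _; rewrite /c/=.
    have [qj0|qj0] := eqVneq (q j) 0; first by rewrite qj0 (pi_q0 i qj0) !mul0r.
    by field; rewrite pi0 qj0.
  by rewrite -!mulr_suml -/(p i) divff// mul1r.
have Gr B : measurable B -> G (snd @^-1` B) = nu B.
  move=> mB; have -> : snd @^-1` B = [set: T1] `*` B.
    by apply/seteqP; split => z //= [].
  rewrite GE// exchange_big/= -(measure_fiber_partition nu mb mB).
  apply: eq_bigr => j _.
  have mBj : measurable (B `&` b @^-1` [set j]) by exact: measurableI.
  have [qj0|qj0] := eqVneq (q j) 0.
    have nu0 : nu (B `&` b @^-1` [set j]) = 0%E.
      have : (nu (B `&` b @^-1` [set j]) <= (q j)%:E)%E by rewrite -qE le_measure ?inE.
      by rewrite qj0 => h; apply/eqP; rewrite eq_le measure_ge0 h.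
    by rewrite nu0 big1// => i _; rewrite !mule0.
  rewrite -(fineK (fnu _ mBj)).
  under eq_bigr => i _ do rewrite setTI pE -!EFinM.
  rewrite sumEFin -[RHS](fineK (fnu _ mBj)); congr EFin.
  transitivity (\sum_i pi i j / q j * fine (nu (B `&` b @^-1` [set j]))).
    apply: eq_bigr => i _; rewrite /c/=.
    have [pi0|pi0] := eqVneq (p i) 0; first by rewrite pi0 (pi_p0 j pi0) !mul0r.
    by field; rewrite pi0 qj0.
  by rewrite -!mulr_suml -/(q j) divff// mul1r.
have G1 : G setT = 1%E by rewrite -(probability_setT mu) -Gl.
exists (mprobability G1); split; [exact: Gl|exact: Gr|].
change (G [set z | a z.1 != b z.2] = (\sum_i \sum_(j | j != i) pi i j)%:E).
have -> : [set z : T1 * T2 | a z.1 != b z.2] =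
    \bigcup_(ij in [set ij : I * I | ij.2 != ij.1]) D ij.
  apply/seteqP; split => [z ab|z [ij /= ij12 [/= z1 z2]]].
    by exists (a z.1, b z.2) => //=; rewrite eq_sym.
  by rewrite z1 z2 eq_sym.
rewrite measure_fin_bigcup//; [|exact: finite_finset|]; last first.
  apply/trivIsetP => ij ij' _ _ /eqP ne; apply/seteqP; split => // z.
  move=> [[/= z1 z2] [/= z1' z2']]; apply: ne.
  by rewrite [ij]surjective_pairing [ij']surjective_pairing -z1 -z2 -z1' -z2'.
rewrite (_ : [set ij | _] =
    [set` [seq ij <- index_enum (I * I)%type | ij.2 != ij.1]]); last first.
  by apply/seteqP; split => ij /=; rewrite mem_filter mem_index_enum andbT.
rewrite -fsbig_seq ?filter_uniq ?index_enum_uniq// big_filter.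
rewrite -sumEFin; under [RHS]eq_bigr do rewrite -sumEFin.
rewrite [RHS]pair_big_dep; apply: eq_bigr => -[i j] /= ij.
have -> : G (D (i, j)) = (\sum_ij' if ij' == (i, j) then
    (c (i, j))%:E * (mu (a @^-1` [set i]) * nu (b @^-1` [set j])) else 0)%E.
  rewrite GX//; apply: eq_bigr => -[i' j'] _ /=.
  case: eqVneq => [[-> ->]|ne]; first by rewrite !setIid.
  have [ii|ii] := eqVneq i i'; last first.
    rewrite [X in mu X](_ : _ = set0) ?measure0 ?mul0e ?mule0//.
    by apply/seteqP; split => // x [/= xi xi']; move: ii; rewrite -xi -xi' eqxx.
  have [jj|jj] := eqVneq j j'; last first.
    rewrite [X in nu X](_ : _ = set0) ?measure0 ?mule0//.
    by apply/seteqP; split => // x [/= xi xi']; move: jj; rewrite -xi -xi' eqxx.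
  by move: ne; rewrite ii jj eqxx.
rewrite -big_mkcond/= big_pred1_eq pE qE -!EFinM; congr EFin; rewrite /c/=.
have [pi0|pi0] := eqVneq (p i) 0; first by rewrite (pi_p0 j pi0) !mul0r.
have [qj0|qj0] := eqVneq (q j) 0; first by rewrite (pi_q0 i qj0) !mul0r.
by rewrite divfK// mulf_neq0.
Qed.

End glue.
End finite_gluing.

(** * The Wasserstein distance on a sequentially compact space *)

Section cells.
Context {R : realType} (X : pointedType) (d : X -> X -> R).
Hypotheses (d0 : forall x, d x x = 0) (dsym : forall x y, d x y = d y x)
  (dtri : forall x y z, d x z <= d x y + d y z).
Hypothesis d_cpt : forall u : nat -> X,
  exists2 s : nat -> nat, {homo s : m n / (m < n)%N} &
    exists x, d (u (s n)) x @[n --> \oo] --> 0.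

Let d_ge0 x y : 0 <= d x y. Proof. exact: (pseudometric_ge0 d0 dsym dtri). Qed.

(** Otherwise points could be chosen one after another at distance at least [e] from all earlier
    ones, and no subsequence of them would converge. *)
Lemma totally_bounded e : 0 < e ->
  exists l : seq X, forall x, exists2 y, y \in l & d x y < e.
Proof.
move=> e0; apply: contrapT => nl.
have /choice[g gP] (l : seq X) : exists x, forall y, y \in l -> e <= d x y.
  apply: contrapT => /forallNP h; apply: nl; exists l => x.
  have /existsNP[y /not_implyP[yl /negP]] := h x.
  by rewrite -ltNge => dxy; exists y.
pose l := fix l n := if n is n'.+1 then g (l n') :: l n' else [::].
have mem_l m n : (m < n)%N -> g (l m) \in l n.
  elim: n => // n IH; rewrite ltnS leq_eqVlt => /predU1P[->|/IH h].
    by rewrite /= inE eqxx.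
  by rewrite /= inE h orbT.
have [s hs [x ux]] := d_cpt (g \o l).
have e20 : 0 < e / 2 by lra.
have /cvgrPdist_lt/(_ _ e20)[n _ nP] := ux.
have h1 := nP n (leqnn n); have h2 := nP n.+1 (leqnSn n).
rewrite /= sub0r normrN ger0_norm// in h1.
rewrite /= sub0r normrN ger0_norm// in h2.
have := gP _ _ (mem_l _ _ (hs n n.+1 (ltnSn n))).
have := dtri (g (l (s n.+1))) x (g (l (s n))).
by rewrite [d x (g _)]dsym; lra.
Qed.

Lemma diameter_bound : exists2 D, 0 <= D & forall x y, d x y <= D.
Proof.
have [l lP] := totally_bounded (@ltr01 R).
(* The sum of all mutual distances in a [1]-net stands in for their maximum. *)
exists (2 + \sum_(y <- l) \sum_(z <- l) d y z).
  by rewrite addr_ge0// sumr_ge0// => y _; exact: sumr_ge0.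
move=> x y; have [x' x'l xx'] := lP x; have [y' y'l yy'] := lP y.
have h : d x' y' <= \sum_(y <- l) \sum_(z <- l) d y z.
  rewrite (big_rem x')//= (big_rem y')//= -addrA lerDl addr_ge0//.
    exact: sumr_ge0.
  by apply: sumr_ge0 => z _; exact: sumr_ge0.
have := dtri x x' y; have := dtri x' y' y; rewrite [d y' y]dsym; lra.
Qed.

Lemma metric_open_ball x e : metric_open d [set y | d x y < e].
Proof.
move=> y /= xy; exists (e - d x y); first by rewrite subr_gt0.
by move=> z yz; have := dtri x y z; lra.
Qed.

(** The sets are the balls of radius [1/(n+1)] around the points of a finite [1/(n+1)]-net, for all
    [n], listed by [pickle]. Two points in the same balls of a fine enough net share a ball of
    radius at most [e / 2]. *)
Lemma separating_opens : exists2 U : nat -> set X,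
  forall i, metric_open d (U i) &
  forall e, 0 < e -> exists m, forall x y,
    (forall i, (i < m)%N -> U i x <-> U i y) -> d x y < e.
Proof.
have /choice[l lP] (n : nat) : exists l : seq X,
    forall x, exists2 y, y \in l & d x y < n.+1%:R^-1.
  by apply: totally_bounded; rewrite invr_gt0.
pose U k := if unpickle k is Some (n, j)
  then [set y | d (nth point (l n) j) y < (n : nat).+1%:R^-1] else setT.
exists U.
  move=> k; rewrite /U; case: unpickle => [[n j]|]; first exact: metric_open_ball.
  by move=> x _; exists 1.
move=> e e0; pose n := Num.truncn (2 / e).
have ne : n.+1%:R^-1 <= e / 2.
  rewrite -[leRHS]invrK lef_pV2 ?posrE ?invr_gt0 ?divr_gt0//.
  by rewrite invf_div ltW// truncnS_gt.
exists (\max_(j < size (l n)) (pickle (n, (j : nat))).+1) => x y xy.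
have [z zl xz] := lP n x.
have jl : (index z (l n) < size (l n))%N by rewrite index_mem.
have := xy (pickle (n, index z (l n))) _.
rewrite /U pickleK /= nth_index// => h.
have [|h1 _] := h.
  apply: leq_trans (leq_bigmax_cond (F := fun j : 'I__ => (pickle (n, (j : nat))).+1)
    (Ordinal jl) _) => //.
have := h1 _; rewrite dsym => /(_ xz) zy.
apply: le_lt_trans (dtri x z y) _; rewrite [ltRHS]splitr ltrD//.
  exact: lt_le_trans xz ne.
exact: lt_le_trans zy ne.
Qed.

End cells.

Section bits.
Context (X : pointedType) (U : nat -> set X).

(* The most recent bit comes first. *)
Fixpoint bits m x : seq bool :=
  if m is m'.+1 then `[< U m' x >] :: bits m' x else [::].

Lemma size_bits m x : size (bits m x) = m.
Proof. by elim: m => //= m ->. Qed.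

(** Tuples give these labels a finite type, as gluing requires. *)
Definition bits_tuple m x : m.-tuple bool :=
  Tuple (introT eqP (size_bits m x)).

Lemma bits_eq m x y : bits m x = bits m y ->
  forall i, (i < m)%N -> U i x <-> U i y.
Proof.
elim: m => // m IH /= [Uxy /IH h] i; rewrite ltnS leq_eqVlt => /predU1P[->|/h//].
by split => /asboolP ?; apply/asboolP; [rewrite -Uxy | rewrite Uxy].
Qed.

Definition cell w : set X := [set x | bits (size w) x = w].

Definition cell_point w : X := get (cell w).

Lemma cell_pointP w : cell w !=set0 -> cell w (cell_point w).
Proof. by case => x wx; exact: (getPex (ex_intro _ x wx)). Qed.

Lemma cell_bits m x : cell (bits m x) x.
Proof. by rewrite /cell /= size_bits. Qed.

Lemma cell_cons b w : cell (b :: w) =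
  cell w `&` (if b then U (size w) else ~` U (size w)).
Proof.
apply/seteqP; split => x; rewrite /cell /=.
  by case => /= Ub ->; split => //; move: Ub; case: b => /asboolP.
move=> [-> Ub]; congr cons; move: Ub; case: b => Ub; first exact: asboolT.
exact: asboolF.
Qed.

Lemma bits_fiber m w : bits m @^-1` [set w] = if size w == m then cell w else set0.
Proof.
case: eqVneq => [<-//|ne]; apply/seteqP; split => // x /= mxw.
by move: ne; rewrite -mxw size_bits eqxx.
Qed.

Lemma bits_tuple_fiber m (t : m.-tuple bool) :
  bits_tuple m @^-1` [set t] = cell t.
Proof.
rewrite /cell size_tuple; apply/seteqP; split => x /=; first by move=> <-.
by move=> h; exact/val_inj.
Qed.

End bits.

Section borel_cells.
Context {R : realType} (X : pointedType) (d : X -> X -> R).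
Hypotheses (d0 : forall x, d x x = 0) (dsym : forall x y, d x y = d y x)
  (dtri : forall x y z, d x z <= d x y + d y z).
Variable U : nat -> set X.
Hypothesis U_open : forall i, metric_open d (U i).
Hypothesis U_sep : forall e, 0 < e -> exists m, forall x y,
    (forall i, (i < m)%N -> U i x <-> U i y) -> d x y < e.

Local Notation B := (borel d).

Lemma measurable_metric_open (A : set B) : metric_open d A -> measurable A.
Proof. by move=> oA; exact: sub_sigma_algebra. Qed.

Lemma measurable_cell w : measurable (cell U w : set B).
Proof.
elim: w => [|b w IH].
  rewrite (_ : cell U [::] = setT); last by apply/seteqP.
  exact: measurableT.
rewrite cell_cons; apply: measurableI => //.
have mU : measurable (U (size w) : set B) by exact: measurable_metric_open.
by case: b => //; exact: measurableC.
Qed.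

Lemma measurable_bits_fiber m w : measurable (bits U m @^-1` [set w] : set B).
Proof. by rewrite bits_fiber; case: ifP => // _; exact: measurable_cell. Qed.

Lemma bits_close e : 0 < e -> exists m, forall m' x y, (m <= m')%N ->
  bits U m' x = bits U m' y -> d x y < e.
Proof.
move=> e0; have [m mP] := U_sep e0; exists m => m' x y mm exy.
by apply: mP => i im; apply: (bits_eq exy); exact: leq_trans im mm.
Qed.

Lemma bits_cell_point m x : bits U m (cell_point U (bits U m x)) = bits U m x.
Proof.
have := @cell_pointP _ U (bits U m x) (ex_intro _ x (cell_bits U m x)).
by rewrite /cell/= size_bits.
Qed.

Lemma metric_lipschitz x y x' y' : `|d x y - d x' y'| <= d x x' + d y y'.
Proof.
have := dtri x x' y; have := dtri x' y' y; have := dtri x' x y'; have := dtri x y y'.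
rewrite [d y' y]dsym [d x' x]dsym => h1 h2 h3 h4.
by rewrite ler_norml; apply/andP; split; lra.
Qed.

(** [B * B] carries the product sigma-algebra, so the distance is approximated by functions of
    finitely many bits of each factor, whose label fibres are rectangles. *)
Lemma measurable_metric : measurable_fun setT (fun p : B * B => d p.1 p.2).
Proof.
pose h m (p : B * B) : R :=
  d (cell_point U (bits U m p.1)) (cell_point U (bits U m p.2)).
apply: (@measurable_fun_cvg _ _ _ setT h) => [m|p _].
  pose a (p : B * B) := (bits U m p.1, bits U m p.2).
  have ma w : measurable (a @^-1` [set w]).
    case: w => w1 w2; rewrite (_ : _ @^-1` _ =
      (bits U m @^-1` [set w1]) `*` (bits U m @^-1` [set w2])).
      by apply: measurableX; exact: measurable_bits_fiber.
    by apply/seteqP; split => q /= [<- <-].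
  exact: (measurable_fun_fibers (fun w => d (cell_point U w.1) (cell_point U w.2)) ma).
apply/cvgrPdist_le => e e0; have e20 : 0 < e / 2 by lra.
have [m mP] := bits_close e20.
exists m => // m' /= mm.
apply: (le_trans (metric_lipschitz _ _ _ _)); rewrite [leRHS]splitr lerD//.
  by apply: ltW; apply: (mP m') => //; rewrite bits_cell_point.
by apply: ltW; apply: (mP m') => //; rewrite bits_cell_point.
Qed.

End borel_cells.

Section images.
Context {R : realType} d d' (T : measurableType d) (T' : measurableType d').
Variables (P : probability T R) (f : T -> T').
Hypothesis mf : measurable_fun setT f.

Lemma image_probability : exists Q : probability T' R,
  forall A, Q A = P (f @^-1` A).
Proof.
pose g : {mfun T >-> T'} := HB.pack f (isMeasurableFun.Build _ _ _ _ f mf).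
by exists (distribution P g).
Qed.

Variable Q : probability T' R.
Hypothesis PQ : forall A, measurable A -> P (f @^-1` A) = Q A.

Lemma ge0_integral_marginal (g : T' -> \bar R) : measurable_fun setT g ->
  (forall y, 0 <= g y)%E -> (\int[P]_x g (f x) = \int[Q]_y g y)%E.
Proof.
move=> mg g0; have := @ge0_integral_pushforward _ _ _ _ _ _ mf P setT g.
rewrite preimage_setT => <-//.
by apply: eq_measure_integral => A mA _; exact: PQ.
Qed.

Lemma Rintegral_marginal (g : T' -> R) (M : R) : measurable_fun setT g ->
  (forall y, `|g y| <= M) -> \int[P]_x g (f x) = \int[Q]_y g y.
Proof.
move=> mg gM; have iP : P.-integrable setT ((EFin \o g) \o f).
  change (P.-integrable setT (EFin \o (g \o f))).
  apply: measurable_bounded_integrable => //.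
  - by rewrite (le_lt_trans (probability_le1 P _)) ?ltry.
  - exact: measurableT_comp.
  - exists M; split; first by rewrite num_real.
    by move=> r Mr x _; apply: le_trans (gM _) (ltW Mr).
have mE : measurable_fun setT (EFin \o g) by exact/measurable_EFinP.
have := @integral_pushforward _ _ _ _ _ _ mf P setT (EFin \o g) mE iP measurableT.
rewrite preimage_setT /Rintegral => <-; congr fine.
by apply: eq_measure_integral => A mA _; exact: PQ.
Qed.

End images.

Lemma measurable_neq_labels d1 d2 (T1 : measurableType d1)
    (T2 : measurableType d2) (I : finType) (a : T1 -> I) (b : T2 -> I) :
  (forall i, measurable (a @^-1` [set i])) ->
  (forall i, measurable (b @^-1` [set i])) ->
  measurable [set z : T1 * T2 | a z.1 != b z.2].
Proof.
move=> ma mb; rewrite (_ : mkset _ = ~` \bigcup_(i in [set: I])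
    ((a @^-1` [set i]) `*` (b @^-1` [set i]))).
  apply: measurableC; apply: fin_bigcup_measurable => // i _.
  exact: measurableX.
apply/seteqP; split => z /=.
  by move=> /eqP ab [i _ [/= ai bi]]; apply: ab; rewrite ai bi.
by move=> h; apply/eqP => ab; apply: h; exists (b z.2).
Qed.

Section wasserstein.
Context {R : realType} (X : pointedType) (d : X -> X -> R).
Hypotheses (d0 : forall x, d x x = 0) (dsym : forall x y, d x y = d y x)
  (dtri : forall x y z, d x z <= d x y + d y z).
Hypothesis d_cpt : forall u : nat -> X,
  exists2 s : nat -> nat, {homo s : m n / (m < n)%N} &
    exists x, d (u (s n)) x @[n --> \oo] --> 0.

Local Notation B := (borel d).

Let d_ge0 x y : 0 <= d x y. Proof. exact: (pseudometric_ge0 d0 dsym dtri). Qed.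

Lemma measurable_dist : measurable_fun setT (fun p : B * B => d p.1 p.2).
Proof.
have [U Uo Us] := separating_opens d0 dsym dtri d_cpt.
exact: (measurable_metric dsym dtri Uo Us).
Qed.

Lemma measurable_dist_comp dd (T : measurableType dd) (f g : T -> B) :
  measurable_fun setT f -> measurable_fun setT g ->
  measurable_fun setT (fun t => d (f t) (g t)).
Proof.
move=> mf mg.
exact: (measurableT_comp measurable_dist (measurable_fun_pair mf mg)).
Qed.

Lemma measurable_cost dd (T : measurableType dd) (f g : T -> B) :
  measurable_fun setT f -> measurable_fun setT g ->
  measurable_fun setT (fun t => (d (f t) (g t) ^+ 2)%:E).
Proof.
move=> mf mg; apply/measurable_EFinP; apply: measurable_funX.
exact: measurable_dist_comp.
Qed.

Let costs (mu nu : P2 d) : set (\bar R) :=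
  [set (\int[g]_p (d p.1 p.2 ^+ 2)%:E)%E | g in coupling mu nu].

Let sqr_ge0E r : (0 <= (r ^+ 2)%:E :> \bar R)%E.
Proof. by rewrite lee_fin sqr_ge0. Qed.

(** With a single label the gluing is the product measure. *)
Lemma coupling_neq0 (mu nu : P2 d) : coupling mu nu !=set0.
Proof.
have one : ((\sum_(j : unit) 1)%:E = 1%E :> \bar R)%E.
  by rewrite sumr_const card_unit.
have [|||||G [Gl Gr _]] := @finite_glue R _ _ _ _ mu nu unit (fun=> tt) (fun=> tt)
  (fun _ _ => 1).
- by move=> []; rewrite (_ : _ @^-1` _ = setT)//; apply/seteqP.
- by move=> []; rewrite (_ : _ @^-1` _ = setT)//; apply/seteqP.
- by [].
- move=> []; rewrite (_ : _ @^-1` _ = setT) ?probability_setT ?one//.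
  by apply/seteqP.
- move=> []; rewrite (_ : _ @^-1` _ = setT) ?probability_setT ?one//.
  by apply/seteqP.
- by exists G => A mA; split; [exact: Gl|exact: Gr].
Qed.

Lemma cost_le_diam D (g : probability (B * B)%type R) :
  (forall x y, d x y <= D) -> (\int[g]_p (d p.1 p.2 ^+ 2)%:E <= (D ^+ 2)%:E)%E.
Proof.
move=> dD; apply: (@le_trans _ _ (\int[g]_p (D ^+ 2)%:E)%E).
  apply: ge0_le_integral => //; first exact: measurable_cost.
  by move=> p _; rewrite lee_fin ler_sqr ?nnegrE ?dD//; exact: le_trans (dD p.1 p.2).
have g1 : g setT = 1%E by exact: probability_setT.
by rewrite (@integral_cst _ _ _ g setT measurableT) [X in (_ * X)%E]g1 mule1.
Qed.

(** The diameter bounds the cost of every coupling, so the infimum is finite and [fine] loses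
    nothing. *)
Lemma W2_sqr mu nu : ((W2 mu nu ^+ 2)%:E = ereal_inf (costs mu nu))%E.
Proof.
have ge0 : (0 <= ereal_inf (costs mu nu))%E.
  by apply: le_ereal_inf_tmp => _ [g _ <-]; exact: integral_ge0.
rewrite /W2 -/(costs mu nu) sqr_sqrtr ?fine_ge0// fineK//.
have [g gc] := coupling_neq0 mu nu.
have [D _ dD] := diameter_bound d0 dsym dtri d_cpt.
rewrite ge0_fin_numE//; apply: le_lt_trans (ltry (D ^+ 2)).
apply: le_trans (cost_le_diam g dD); apply: ereal_inf_lbound.
by exists g.
Qed.

Lemma W2_ge0 (mu nu : P2 d) : 0 <= W2 mu nu.
Proof. exact: sqrtr_ge0. Qed.

(** The joint law of [f] and [g] is a coupling. Letting it live on any probability space suits the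
    glued spaces, which have four factors in the triangle inequality and a factor of codes in the
    compactness proof. *)
Lemma W2_le_coupling (mu nu : P2 d) dd (T : measurableType dd)
    (P : probability T R) (f g : T -> B) (r : R) :
  measurable_fun setT f -> measurable_fun setT g ->
  (forall A, measurable A -> P (f @^-1` A) = mu A) ->
  (forall A, measurable A -> P (g @^-1` A) = nu A) ->
  0 <= r -> (\int[P]_t (d (f t) (g t) ^+ 2)%:E <= (r ^+ 2)%:E)%E ->
  W2 mu nu <= r.
Proof.
move=> mf mg Pf Pg r0 Pr.
have mfg := measurable_fun_pair mf mg.
have [Q QE] := image_probability P mfg.
rewrite -ler_sqr ?nnegrE ?W2_ge0// -lee_fin W2_sqr; apply: le_trans Pr.
rewrite (@ge0_integral_marginal _ _ _ _ _ _ _ mfg Q _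
  (fun p => (d p.1 p.2 ^+ 2)%:E)) //; last exact: measurable_cost.
apply: ereal_inf_lbound; exists Q => // A mA; rewrite !QE.
by split; [exact: Pf|exact: Pg].
Qed.

Lemma W2_lt_coupling (mu nu : P2 d) (r : R) : W2 mu nu < r ->
  exists2 g, coupling mu nu g & (\int[g]_p (d p.1 p.2 ^+ 2)%:E <= (r ^+ 2)%:E)%E.
Proof.
move=> Wr; have : (ereal_inf (costs mu nu) < (r ^+ 2)%:E)%E.
  rewrite -W2_sqr lte_fin ltr_sqr ?nnegrE ?W2_ge0//.
  exact/ltW/(le_lt_trans (W2_ge0 mu nu)).
by move=> /ereal_inf_lt[_ [g gc <-] gr]; exists g => //; exact: ltW.
Qed.

Lemma W2_refl (mu : P2 d) : W2 mu mu = 0.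
Proof.
apply/eqP; rewrite eq_le W2_ge0 andbT.
apply: (@W2_le_coupling _ _ _ _ mu id id) => //.
by under eq_integral do rewrite d0 expr0n; rewrite integral0 expr0n.
Qed.

Lemma W2_sym (mu nu : P2 d) : W2 mu nu = W2 nu mu.
Proof.
suff h (a b : P2 d) : W2 a b <= W2 b a by apply/eqP; rewrite eq_le !h.
apply/ler_addgt0Pr => e e0; have [|g gc gr] := @W2_lt_coupling b a (W2 b a + e).
  by rewrite ltrDl.
apply: (@W2_le_coupling _ _ _ _ g snd fst) => //.
- by move=> A mA; have [_ ->] := gc _ mA.
- by move=> A mA; have [-> _] := gc _ mA.
- by rewrite addr_ge0 ?W2_ge0// ltW.
- by under eq_integral do rewrite dsym.
Qed.

(* With [A] and [C] the [L^2] norms of [p] and [q], integrating this pointwise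
   bound gives Minkowski's inequality [||p + q + e|| <= A + C + e]. *)
Lemma sqr_le_weighted (A C e p q : R) : 0 < A -> 0 < C ->  0 < e ->
  (p + q + e) ^+ 2 <=
  (A + C + e) / A * p ^+ 2 + (A + C + e) / C * q ^+ 2 + (A + C + e) * e.
Proof.
move=> A0 C0 e0; have An : A != 0 by rewrite gt_eqF.
have Cn : C != 0 by rewrite gt_eqF.
have -> : p = A * (p / A) by rewrite mulrC divfK.
have -> : q = C * (q / C) by rewrite mulrC divfK.
move: (p / A) (q / C) => u v.
have -> : (A + C + e) / A * (A * u) ^+ 2 = (A + C + e) * (A * u ^+ 2) by field.
have -> : (A + C + e) / C * (C * v) ^+ 2 = (A + C + e) * (C * v ^+ 2) by field.
rewrite -subr_ge0.
have -> : (A + C + e) * (A * u ^+ 2) + (A + C + e) * (C * v ^+ 2) +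
    (A + C + e) * e - (A * u + C * v + e) ^+ 2 =
    A * C * (u - v) ^+ 2 + A * e * (u - 1) ^+ 2 + C * e * (v - 1) ^+ 2 by ring.
by rewrite !addr_ge0// mulr_ge0 ?sqr_ge0// mulr_ge0// ltW.
Qed.

(* A coupling of [m1] with [m2] and one of [m2] with [m3] are glued along the
   cell of the middle point; the two middle points are then [e]-close. *)
Lemma W2_triangle (m1 m2 m3 : P2 d) : W2 m1 m3 <= W2 m1 m2 + W2 m2 m3.
Proof.
apply/ler_addgt0Pr => e3 e30.
pose e := e3 / 3; have e0 : 0 < e by rewrite divr_gt0.
(* Adding [e] makes near-optimal couplings available and keeps both constants positive, hence usable
   as denominators. *)
pose A := W2 m1 m2 + e; pose C := W2 m2 m3 + e.
have A0 : 0 < A by rewrite ltr_wpDl// W2_ge0.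
have C0 : 0 < C by rewrite ltr_wpDl// W2_ge0.
have -> : W2 m1 m2 + W2 m2 m3 + e3 = A + C + e by rewrite /A /C /e; field.
have [g12 c12 i12] : exists2 g, coupling m1 m2 g &
    (\int[g]_p (d p.1 p.2 ^+ 2)%:E <= (A ^+ 2)%:E)%E.
  by apply: W2_lt_coupling; rewrite ltrDl.
have [g23 c23 i23] : exists2 g, coupling m2 m3 g &
    (\int[g]_p (d p.1 p.2 ^+ 2)%:E <= (C ^+ 2)%:E)%E.
  by apply: W2_lt_coupling; rewrite ltrDl.
have [U Uo Us] := separating_opens d0 dsym dtri d_cpt.
have [m mP] := bits_close Us e0.
have [D D0 dD] := diameter_bound d0 dsym dtri d_cpt.
have mcell (i : m.-tuple bool) : measurable (cell U i : set B).
  exact: measurable_cell.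
(* The matrix is diagonal, so the two middle points lie in one cell outside a null set. *)
pose pi (i j : m.-tuple bool) : R := if i == j then fine (m2 (cell U i)) else 0.
have pi_l i : ((\sum_j pi i j)%:E = m2 (cell U i))%E.
  rewrite /pi -big_mkcond/= (big_pred1 i); last by move=> j; rewrite eq_sym.
  by rewrite fineK// fin_num_measure.
have pi_r j : ((\sum_i pi i j)%:E = m2 (cell U j))%E.
  rewrite -pi_l; congr EFin; apply: eq_bigr => i _; rewrite /pi eq_sym.
  by case: eqP => // ->.
pose a (p : B * B) := bits_tuple U m p.2.
pose b (p : B * B) := bits_tuple U m p.1.
have aE i : a @^-1` [set i] = snd @^-1` cell U i by rewrite -bits_tuple_fiber.
have bE i : b @^-1` [set i] = fst @^-1` cell U i by rewrite -bits_tuple_fiber.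
have [||||| G [Gl Gr Gn]] := @finite_glue R _ _ _ _ g12 g23 (m.-tuple bool) a b pi.
- move=> i; rewrite aE -[X in measurable X]setTI; exact: measurable_snd.
- move=> i; rewrite bE -[X in measurable X]setTI; exact: measurable_fst.
- by move=> i j; rewrite /pi; case: ifP => // _; rewrite fine_ge0.
- by move=> i; rewrite pi_l aE; have [_ ->] := c12 _ (mcell i).
- by move=> i; rewrite pi_r bE; have [-> _] := c23 _ (mcell i).
have {}Gn : G [set z | a z.1 != b z.2] = 0%E.
  rewrite Gn; congr EFin; rewrite big1// => i _; rewrite big1// => j ji.
  by rewrite /pi eq_sym (negbTE ji).
set N := [set z | _] in Gn.
have mN : measurable N.
  apply: measurable_neq_labels => i; rewrite ?aE ?bE -[X in measurable X]setTI.
    exact: measurable_snd.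
  exact: measurable_fst.
pose s := A + C + e; have s0 : 0 < s := addr_gt0 (addr_gt0 A0 C0) e0.
have mf : measurable_fun setT (fun z : (B * B) * (B * B) => z.1.1).
  exact: measurableT_comp measurable_fst measurable_fst.
have mg : measurable_fun setT (fun z : (B * B) * (B * B) => z.2.2).
  exact: measurableT_comp measurable_snd measurable_snd.
have m12 : measurable_fun setT (fun z : (B * B) * (B * B) => z.1.2).
  exact: measurableT_comp measurable_snd measurable_fst.
have m21 : measurable_fun setT (fun z : (B * B) * (B * B) => z.2.1).
  exact: measurableT_comp measurable_fst measurable_snd.
apply: (@W2_le_coupling _ _ _ _ G _ _ s mf mg); last 2 first.
- exact: ltW.
- pose F1 (z : (B * B) * (B * B)) := ((s / A)%:E * (d z.1.1 z.1.2 ^+ 2)%:E)%E.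
  pose F2 (z : (B * B) * (B * B)) := ((s / C)%:E * (d z.2.1 z.2.2 ^+ 2)%:E)%E.
  (* On the null set [N] only the diameter bounds the distance. *)
  pose F4 (z : (B * B) * (B * B)) := ((D ^+ 2)%:E * (\1_N z)%:E)%E.
  have mF1 : measurable_fun setT F1.
    by apply: measurable_funeM; exact: (measurable_cost mf m12).
  have mF2 : measurable_fun setT F2.
    by apply: measurable_funeM; exact: (measurable_cost m21 mg).
  have mF4 : measurable_fun setT F4.
    by apply: measurable_funeM; apply/measurable_EFinP; exact: measurable_indic.
  have F10 z : (0 <= F1 z)%E.
    by rewrite mule_ge0 ?sqr_ge0E// lee_fin divr_ge0// ltW.
  have F20 z : (0 <= F2 z)%E.
    by rewrite mule_ge0 ?sqr_ge0E// lee_fin divr_ge0// ltW.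
  have F40 z : (0 <= F4 z)%E.
    by rewrite mule_ge0 ?sqr_ge0E// lee_fin.
  have se0 : (0 <= (s * e)%:E)%E by rewrite lee_fin mulr_ge0// ltW.
  apply: (@le_trans _ _ (\int[G]_z (F1 z + F2 z + (s * e)%:E + F4 z))%E).
    apply: ge0_le_integral => //.
    + by apply: measurable_cost.
    + by do 3?apply: emeasurable_funD.
    + move=> z _; rewrite /F1 /F2 /F4 -!EFinM -!EFinD lee_fin indicE.
      have [|zN] := boolP (z \in N).
        move=> _; rewrite mulr1 -[leLHS]add0r lerD//.
          by rewrite !addr_ge0// mulr_ge0 ?sqr_ge0// ?divr_ge0// ltW.
        by rewrite ler_sqr ?nnegrE.
      rewrite mulr0 addr0; apply: le_trans (sqr_le_weighted _ _ A0 C0 e0).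
      rewrite ler_sqr ?nnegrE ?addr_ge0// ?(ltW e0)//.
      have ab : bits U m z.1.2 = bits U m z.2.1.
        move: zN; rewrite notin_setE /N /= => /negP; rewrite negbK => /eqP.
        by move=> /(congr1 val).
      have := mP _ _ _ (leqnn m) ab.
      have := dtri z.1.1 z.1.2 z.2.2; have := dtri z.1.2 z.2.1 z.2.2; lra.
  rewrite !ge0_integralD//; last 4 first.
  - by move=> z _; rewrite adde_ge0.
  - exact: emeasurable_funD.
  - by move=> z _; rewrite !adde_ge0.
  - by do 2?apply: emeasurable_funD.
  have I1 : (\int[G]_z F1 z <= (s / A * A ^+ 2)%:E)%E.
    rewrite ge0_integralZl//; last 2 first.
    - exact: (measurable_cost mf m12).
    - by rewrite lee_fin divr_ge0// ltW.
    rewrite [leRHS]EFinM lee_wpmul2l ?lee_fin ?divr_ge0// ?(ltW s0)// ?(ltW A0)//.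
    rewrite (@ge0_integral_marginal _ _ _ _ _ G fst measurable_fst g12 Gl
      (fun p => (d p.1 p.2 ^+ 2)%:E))//.
    exact: measurable_cost.
  have I2 : (\int[G]_z F2 z <= (s / C * C ^+ 2)%:E)%E.
    rewrite ge0_integralZl//; last 2 first.
    - exact: (measurable_cost m21 mg).
    - by rewrite lee_fin divr_ge0// ltW.
    rewrite [leRHS]EFinM lee_wpmul2l ?lee_fin ?divr_ge0// ?(ltW s0)// ?(ltW C0)//.
    rewrite (@ge0_integral_marginal _ _ _ _ _ G snd measurable_snd g23 Gr
      (fun p => (d p.1 p.2 ^+ 2)%:E))//.
    exact: measurable_cost.
  have I3 : (\int[G]_z (s * e)%:E = (s * e)%:E)%E.
    rewrite (@integral_cst _ _ _ G setT measurableT).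
    by rewrite [X in (_ * X)%E](_ : _ = 1%E) ?mule1//; exact: probability_setT.
  have I4 : (\int[G]_z F4 z = 0)%E.
    rewrite ge0_integralZl//; last first.
      by apply/measurable_EFinP; exact: measurable_indic.
    rewrite integral_indic// setIT [X in (_ * X)%E](_ : _ = 0%E) ?mule0//.
  rewrite I3 I4 adde0.
  have -> : (s ^+ 2)%:E = ((s / A * A ^+ 2)%:E + (s / C * C ^+ 2)%:E + (s * e)%:E)%E.
    rewrite -!EFinD; congr EFin.
    have -> : s / A * A ^+ 2 = s * A by rewrite expr2 mulrA divfK ?gt_eqF.
    have -> : s / C * C ^+ 2 = s * C by rewrite expr2 mulrA divfK ?gt_eqF.
    by rewrite -!mulrDr expr2.
  by rewrite leeD2r// leeD.
- move=> S mS; rewrite -(c12 _ mS).1 -Gl//.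
  by rewrite -[X in measurable X]setTI; exact: measurable_fst.
- move=> S mS; rewrite -(c23 _ mS).2 -Gr//.
  by rewrite -[X in measurable X]setTI; exact: measurable_snd.
Qed.

End wasserstein.

(** The common part of [P] and [Q] stays on the diagonal, and the two excesses, which have the same
    total [r], are coupled independently; the mass off the diagonal is at most [r]. If [r = 0] all
    excesses vanish, so the division by zero is harmless. *)
Lemma overlap_matrix (R : realType) (I : finType) (P Q : I -> R) :
  (forall i, 0 <= P i) -> (forall i, 0 <= Q i) ->
  \sum_i P i = 1 -> \sum_i Q i = 1 ->
  exists pi : I -> I -> R, [/\ forall i j, 0 <= pi i j,
    forall i, \sum_j pi i j = P i, forall j, \sum_i pi i j = Q j &
    \sum_i \sum_(j | j != i) pi i j <= \sum_i `|P i - Q i|].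
Proof.
move=> P0 Q0 P1 Q1; pose m i := Num.min (P i) (Q i).
pose a i := P i - m i; pose b i := Q i - m i.
have a0 i : 0 <= a i by rewrite subr_ge0 ge_min lexx.
have b0 i : 0 <= b i by rewrite subr_ge0 ge_min lexx orbT.
pose r := \sum_i a i.
have rb : \sum_i b i = r by rewrite /r !sumrB P1 Q1.
have r0 : 0 <= r by exact: sumr_ge0.
have a_r i : a i * (r / r) = a i.
  have [r00|rn] := eqVneq r 0; last by rewrite divff// mulr1.
  move/eqP : (r00); rewrite /r psumr_eq0// => /allP/(_ i)/(_ (mem_index_enum _))/eqP ->.
  by rewrite mul0r.
have b_r i : r * b i / r = b i.
  have [r00|rn] := eqVneq r 0; last by rewrite mulrAC divff// mul1r.
  move/eqP : (r00); rewrite -rb psumr_eq0// => /allP/(_ i)/(_ (mem_index_enum _))/eqP ->.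
  by rewrite mulr0 mul0r.
exists (fun i j => (if j == i then m i else 0) + a i * b j / r); split.
- move=> i j; apply: addr_ge0; last by rewrite divr_ge0// mulr_ge0.
  by case: ifP => // _; rewrite le_min P0 Q0.
- move=> i; rewrite big_split/= -big_mkcond big_pred1_eq -mulr_suml -mulr_sumr rb.
  by rewrite -mulrA a_r addrCA subrr addr0.
- move=> j; rewrite big_split/= -big_mkcond/=.
  rewrite (big_pred1 j) => [|i]; last by rewrite eq_sym.
  by rewrite -mulr_suml -mulr_suml b_r addrCA subrr addr0.
- apply: (@le_trans _ _ (\sum_i a i)); last first.
    apply: ler_sum => i _; rewrite /a /m; case: (lerP (P i) (Q i)) => // PQ.
    by rewrite lerD2r.
  apply: ler_sum => i _.
  have aE : a i = \sum_j a i * b j / r.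
    by rewrite -mulr_suml -mulr_sumr rb -mulrA a_r.
  rewrite [leRHS]aE [leRHS](bigID (fun j => j != i))/=.
  apply: ler_wpDr; first by apply: sumr_ge0 => j _; rewrite divr_ge0// mulr_ge0.
  by apply: ler_sum => j /negbTE ->; rewrite add0r.
Qed.

(** * Nested intervals with prescribed lengths *)

Section interval_coding.
Context {R : realType} (p : seq bool -> R).
Hypotheses (p_ge0 : forall w, 0 <= p w) (p_nil : p [::] = 1)
  (p_split : forall w, p w = p (true :: w) + p (false :: w)).

(* The interval of [w] is [[lower_end w, lower_end w + p w[]; those of
   [false :: w] and [true :: w] follow one another in it. *)
Fixpoint lower_end w : R := if w is b :: w' then
  lower_end w' + (if b then p (false :: w') else 0) else 0.

Fixpoint address (s : R) m : seq bool := if m is m'.+1 then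
  (lower_end (address s m') + p (false :: address s m') <= s) :: address s m'
  else [::].

Lemma size_address s m : size (address s m) = m.
Proof. by elim: m => //= m ->. Qed.

Lemma lower_end_bounds w : 0 <= lower_end w /\ lower_end w + p w <= 1.
Proof.
elim: w => [|b w [IH1 IH2]] /=; first by rewrite p_nil add0r.
have := p_ge0 (true :: w); have := p_ge0 (false :: w); have := p_split w.
by case: b => h1 h2 h3; split; lra.
Qed.

Lemma address_bounds s m : 0 <= s < 1 ->
  lower_end (address s m) <= s < lower_end (address s m) + p (address s m).
Proof.
move=> s01; elim: m => [|m IH] /=; first by rewrite p_nil add0r.
have := p_split (address s m).
have [h|h] := leP (lower_end (address s m) + p (false :: address s m)) s; lra.
Qed.

Lemma address_of_bounds s w : lower_end w <= s < lower_end w + p w ->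
  address s (size w) = w.
Proof.
elim: w => //= b w IH sw.
have := p_split w; have := p_ge0 (true :: w); have := p_ge0 (false :: w) => h1 h2 h3.
have -> : address s (size w) = w by apply: IH; case: b sw; lra.
congr cons; case: b sw => sw; first by apply/idP; lra.
by apply/negP/negP; rewrite -ltNge; lra.
Qed.

(* Outside [[0, 1[] the code is that of [0], so that every code has positive mass. *)
Definition clamp (s : R) := if 0 <= s < 1 then s else 0.

Lemma clamp_itv s : 0 <= clamp s < 1.
Proof. by rewrite /clamp; case: ifP => // _; rewrite lexx ltr01. Qed.

Definition code s m := address (clamp s) m.

Lemma code_pos s m : 0 < p (code s m).
Proof. by have := address_bounds m (clamp_itv s); rewrite -/(code s m); lra. Qed.

Lemma code_fiber_itv w :
  code ^~ (size w) @^-1` [set w] `&` `[0, 1[ =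
  `[lower_end w, lower_end w + p w[%classic.
Proof.
have [l0 l1] := lower_end_bounds w.
apply/seteqP; split => s /=; rewrite !in_itv/=.
  move=> [ws s01]; have := address_bounds (size w) s01.
  by move: ws; rewrite /code /clamp s01 => ->.
move=> ws; have s01 : 0 <= s < 1 by lra.
by split => //; rewrite /code /clamp s01; exact: address_of_bounds.
Qed.

(** Outside [[0, 1[] the code is constant, so there the fibre is everything or nothing. *)
Lemma measurable_code_fiber m w :
  measurable (code ^~ m @^-1` [set w] : set R).
Proof.
have [wm|wm] := eqVneq (size w) m; last first.
  rewrite (_ : _ @^-1` _ = set0)//; apply/seteqP; split => // s /= h.
  by move: wm; rewrite -h size_address eqxx.
rewrite -wm -[X in measurable X](setIT) -(setUv `[0, 1[%classic) setIUr.
rewrite code_fiber_itv; apply: measurableU => //.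
have [h|h] := eqVneq (address 0 (size w)) w.
  rewrite (_ : _ `&` _ = ~` `[0, 1[%classic); first exact: measurableC.
  apply/seteqP; split => s; first by case.
  by move=> /[dup] + s01; rewrite /= in_itv/= => /negP/negbTE; rewrite /code /clamp => ->.
rewrite (_ : _ `&` _ = set0)//; apply/seteqP; split => // s [/= + /negP/negbTE].
by rewrite in_itv/= /code /clamp => + s01; rewrite s01 => /eqP; rewrite (negbTE h).
Qed.

Let lam01 : {measure set (measurableTypeR R) -> \bar R} :=
  mrestr (@lebesgue_measure R) (measurable_itv `[0 : R, 1[).

Lemma unit_interval_probability : exists P : probability (measurableTypeR R) R,
  forall w, P (code ^~ (size w) @^-1` [set w]) = (p w)%:E.
Proof.
have l1 : lam01 setT = 1%E.
  by rewrite /lam01/= /mrestr setTI lebesgue_measure_itv/= lte_fin ltr01 -EFinB subr0.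
exists (mprobability l1) => w.
rewrite [LHS](_ : _ = lebesgue_measure (code ^~ (size w) @^-1` [set w] `&` `[0, 1[))//.
rewrite code_fiber_itv lebesgue_measure_itv/= lte_fin ltrDl.
have [p0|/le_gtF p0] := ltP 0 (p w).
  by rewrite -EFinB addrC addKr.
by have := p_ge0 w; rewrite le_eqVlt p0 orbF => /eqP <-.
Qed.

End interval_coding.

Lemma measurable_preimage_fibers d (T : measurableType d) (I : countType)
    (a : T -> I) (S : set I) :
  (forall i, measurable (a @^-1` [set i])) -> measurable (a @^-1` S).
Proof.
move=> ma; have := @measurable_fun_fibers _ _ _ _ _ a (fun i => `[< S i >]) ma.
move=> /(_ measurableT [set true]); rewrite setTI.
rewrite (_ : _ @^-1` [set true] = a @^-1` S); first exact.
by apply/seteqP; split => x /= /asboolP.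
Qed.

Lemma cvg_sum_seq (R : realType) (I : Type) (r : seq I) (f : nat -> I -> R) (l : I -> R) :
  (forall i, f n i @[n --> \oo] --> l i) ->
  \sum_(i <- r) f n i @[n --> \oo] --> \sum_(i <- r) l i.
Proof.
move=> fl; elim: r => [|i r IH].
  by under eq_fun do rewrite big_nil; rewrite big_nil; exact: cvg_cst.
by under eq_fun do rewrite big_cons; rewrite big_cons; exact: cvgD.
Qed.

(** * Measures rebuilt from the limits of cell masses *)

Section limit_measure.
Context {R : realType} (X : pointedType) (d : X -> X -> R).
Hypotheses (d0 : forall x, d x x = 0) (dsym : forall x y, d x y = d y x)
  (dtri : forall x y z, d x z <= d x y + d y z).
Hypothesis d_cpt : forall u : nat -> X,
  exists2 s : nat -> nat, {homo s : m n / (m < n)%N} &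
    exists x, d (u (s n)) x @[n --> \oo] --> 0.
Variable U : nat -> set X.
Hypothesis U_open : forall i, metric_open d (U i).
Hypothesis U_sep : forall e, 0 < e -> exists m, forall x y,
    (forall i, (i < m)%N -> U i x <-> U i y) -> d x y < e.

Local Notation B := (borel d).

Let d_ge0 x y : 0 <= d x y. Proof. exact: (pseudometric_ge0 d0 dsym dtri). Qed.

Variables (u : nat -> P2 d) (p : seq bool -> R).
Hypothesis u_cvg : forall w, fine (u n (cell U w)) @[n --> \oo] --> p w.

Let mcell w : measurable (cell U w : set B).
Proof. exact: measurable_cell. Qed.

Let p_ge0 w : 0 <= p w.
Proof.
apply: (ler_cvg_to (cvg_cst 0) (@u_cvg w)).
by apply: nearW => n; rewrite fine_ge0.
Qed.

Let p_nil : p [::] = 1.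
Proof.
apply: (cvg_unique _ (@u_cvg [::])) => //.
rewrite (_ : (fun n => _) = cst 1); first exact: cvg_cst.
apply/funext => n; rewrite (_ : cell U [::] = setT) ?probability_setT//.
exact/seteqP.
Qed.

Let p_split w : p w = p (true :: w) + p (false :: w).
Proof.
apply: (cvg_unique _ (@u_cvg w)) => //.
rewrite (_ : (fun n => _) = (fun n => fine (u n (cell U (true :: w))) +
    fine (u n (cell U (false :: w))))); first exact: cvgD.
apply/funext => n.
rewrite (_ : cell U w = cell U (true :: w) `|` cell U (false :: w)).
  rewrite measureU//; first by rewrite fineD// fin_num_measure.
  rewrite !cell_cons; apply/seteqP; split => // x [[_ Ux] [_ nUx]]; exact: nUx.
by rewrite !cell_cons -setIUr setUv setIT.
Qed.

(** An empty cell has mass zero for every [u n]. Since codes have positive mass, each of them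
    addresses a cell with points. *)
Let cell_neq0 w : 0 < p w -> cell U w !=set0.
Proof.
move=> pw; apply/set0P/negP => /eqP w0; move: pw.
suff -> : p w = 0 by rewrite ltxx.
apply: (cvg_unique _ (@u_cvg w)) => //; rewrite w0.
rewrite (_ : (fun n => _) = cst 0); first exact: cvg_cst.
by apply/funext => n /=; rewrite measure0.
Qed.

Let z s m := cell_point U (code p s m).

Let z_cell s m m' : (m <= m')%N -> bits U m (z s m') = code p s m.
Proof.
move=> mm.
have : cell U (code p s m) (z s m').
  have : cell U (code p s m') (z s m') by exact/cell_pointP/cell_neq0/code_pos.
  move: (z s m') => y; elim: m' mm => [|m' IH].
    by rewrite leqn0 => /eqP ->.
  rewrite leq_eqVlt => /predU1P[->//|/IH h].
  rewrite (_ : code p s m'.+1 = (lower_end p (code p s m') +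
    p (false :: code p s m') <= clamp s) :: code p s m')//.
  by rewrite cell_cons => -[/h].
by rewrite /cell/= size_address.
Qed.

(** The cells need not be closed, so the limit of the points [z s m] can leave them. What survives
    is the distance bound, weakened to a non-strict one, with the same [y] for all depths [m]. *)
Let limit_point s : exists y, forall e m,
  (forall y y', bits U m y = bits U m y' -> d y y' < e) -> d (z s m) y <= e.
Proof.
have [t ht [y ty]] := d_cpt (z s); exists y => e m mP.
apply/ler_addgt0Pr => e' e'0.
have /cvgrPdist_lt/(_ _ e'0)[n _ nP] := ty.
have := nP (maxn n m) (leq_maxl _ _); rewrite sub0r normrN ger0_norm// => h.
apply: le_trans (dtri _ (z s (t (maxn n m))) _) _; apply: lerD (ltW h).
apply/ltW/mP; rewrite !z_cell//.
exact: leq_trans (leq_maxr n m) (homo_ltn_ge_id ht _).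
Qed.

Lemma limit_measure_exists : exists mu : P2 d,
  W2 (u n) mu @[n --> \oo] --> 0.
Proof.
have [T TP] := choice limit_point.
have mcode m w : measurable (code p ^~ m @^-1` [set w] : set (measurableTypeR R)).
  exact: measurable_code_fiber.
have [P PE] := unit_interval_probability p_ge0 p_nil p_split.
have mT : measurable_fun setT (T : measurableTypeR R -> B).
  apply: (@measurability _ _ (measurableTypeR R) B setT T (metric_open d)) => //.
  move=> _ [A oA <-].
  rewrite setTI.
  have /choice[M MP] (k : nat) : exists m, forall y y', bits U m y = bits U m y' ->
      d y y' < k.+1%:R^-1.
    have k0 : 0 < k.+1%:R^-1 :> R by rewrite invr_gt0.
    have [m mP] := bits_close U_sep k0.
    by exists m => y y'; exact: mP.
  (* Membership of [T s] in the open set [A] is visible on a finite code of [s]. The point [T s] is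
     within [1/(k+1)] of the cell point, less than the radius [3/(k+1)]; conversely a ball of radius
     [e > 4/(k+1)] around [T s] contains the ball of radius [3/(k+1)] around the cell point. *)
  rewrite (_ : T @^-1` A = \bigcup_k (code p ^~ (M k) @^-1` [set w | forall y,
      d (cell_point U w) y < 3 * k.+1%:R^-1 -> A y])).
    by apply: bigcupT_measurable => k; exact: measurable_preimage_fibers.
  apply/seteqP; split => s /=.
    move=> /oA[e e0 eA].
    have [k ke] : exists k, 4 * k.+1%:R^-1 < e.
      exists (Num.truncn (4 / e)).
      by rewrite ltr_pdivrMr// mulrC -ltr_pdivrMr// truncnS_gt.
    exists k => // y /= hy; apply: eA.
    have := TP s _ _ (MP k); rewrite dsym => h.
    apply: le_lt_trans (dtri _ (z s (M k)) _) _; apply: lt_trans ke.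
    have {}hy : d (z s (M k)) y < 3 * k.+1%:R^-1 by exact: hy.
    move: (k.+1%:R^-1) h hy => r h hy; lra.
  move=> [k _ /=]; apply; apply: le_lt_trans (TP s _ _ (MP k)) _.
  have : 0 < k.+1%:R^-1 :> R by rewrite invr_gt0.
  by move: (k.+1%:R^-1) => r; lra.
have [mu muE] := image_probability P mT.
exists mu; apply/cvgrPdist_le => e e0.
have e40 : 0 < e / 4 by lra.
have [m mP] := bits_close U_sep e40.
have {}mP y y' : bits U m y = bits U m y' -> d y y' < e / 4 by exact: mP.
have [D D0 dD] := diameter_bound d0 dsym dtri d_cpt.
pose dif n := \sum_(i : m.-tuple bool) `|fine (u n (cell U i)) - p i|.
have dif_cvg : D ^+ 2 * dif n @[n --> \oo] --> 0.
  rewrite -(mulr0 (D ^+ 2)); apply: cvgMl_tmp.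
  rewrite (_ : 0 = \sum_(i : m.-tuple bool) (0 : R)); last by rewrite big1.
  apply: cvg_sum_seq => i; rewrite -(normr0 R) -(subrr (p i)); apply: cvg_norm.
  by apply: cvgB; [exact: u_cvg | exact: cvg_cst].
(* Where the labels agree the distance is at most [e / 4 + e / 4], which costs [(e / 2)^2].
   Mismatches cost at most [D^2] times their mass, here at most [3 (e / 2)^2]. The total is
   [e^2]. *)
have small : \forall n \near \oo, D ^+ 2 * dif n <= 3 * (e / 2) ^+ 2.
  have h : 0 < 3 * (e / 2) ^+ 2 by rewrite mulr_gt0// exprn_gt0// divr_gt0.
  move/cvgrPdist_le : dif_cvg => /(_ _ h); apply: filterS => n.
  by rewrite sub0r normrN; exact: le_trans (ler_norm _).
near=> n.
rewrite sub0r normrN ger0_norm ?W2_ge0//.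
have smalln : D ^+ 2 * dif n <= 3 * (e / 2) ^+ 2 by near: n.
pose a (x : B) := bits_tuple U m x.
pose b (s : measurableTypeR R) : m.-tuple bool :=
  Tuple (introT eqP (size_address p (clamp s) m)).
have aE i : a @^-1` [set i] = cell U i by exact: (@bits_tuple_fiber X U m i).
have bE i : b @^-1` [set i] = code p ^~ m @^-1` [set (i : seq bool)].
  apply/seteqP; split => s /= h; first by rewrite -h.
  exact/val_inj.
have PbE i : P (b @^-1` [set i]) = (p i)%:E.
  by rewrite bE -PE size_tuple.
have ma i : measurable (a @^-1` [set i]) by rewrite aE.
have mb i : measurable (b @^-1` [set i]) by rewrite bE.
(* [u n] is glued with the space of codes and not with [mu]: the code [i] has mass exactly [p i],
   whereas the [mu]-mass of the cell can be different. *)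
have [||||pi [pi0 pi_l pi_r pi_n]] := @overlap_matrix R (m.-tuple bool)
  (fun i => fine (u n (cell U i))) (fun i => p i).
- by move=> i; rewrite fine_ge0.
- by move=> i; exact: p_ge0.
- apply: EFin_inj; rewrite -sumEFin -[RHS](probability_setT (u n)).
  rewrite -(measure_fiber_partition (u n) ma measurableT).
  by apply: eq_bigr => i _; rewrite setTI aE fineK// fin_num_measure.
- apply: EFin_inj; rewrite -sumEFin -[RHS](probability_setT P).
  rewrite -(measure_fiber_partition P mb measurableT).
  by apply: eq_bigr => i _; rewrite setTI; exact/esym/PbE.
have [||G [Gl Gr Gn]] := @finite_glue R _ _ _ _ (u n) P (m.-tuple bool) a b pi ma mb pi0.
- by move=> i; rewrite pi_l aE fineK// fin_num_measure.
- by move=> i; rewrite pi_r PbE.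
have mN := measurable_neq_labels ma mb.
set N := [set z | _] in Gn mN.
have mTs : measurable_fun setT (fun q : B * measurableTypeR R => T q.2 : B).
  exact: (measurableT_comp mT measurable_snd).
have mf : measurable_fun setT (fun q : B * measurableTypeR R => q.1).
  exact: measurable_fst.
apply: (W2_le_coupling d0 dsym dtri d_cpt mf mTs Gl _ (ltW e0)).
  move=> A mA; apply: etrans (esym (muE A)); apply: (Gr (T @^-1` A)).
  by rewrite -[X in measurable X]setTI; exact: mT.
pose F (q : B * measurableTypeR R) := ((D ^+ 2)%:E * (\1_N q)%:E)%E.
have mF : measurable_fun setT F.
  by apply: measurable_funeM; apply/measurable_EFinP; exact: measurable_indic.
have D20 : (0 <= (D ^+ 2)%:E)%E by rewrite lee_fin sqr_ge0.
have F0 q : (0 <= F q)%E by rewrite mule_ge0// lee_fin.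
have e20 : (0 <= ((e / 2) ^+ 2)%:E)%E by rewrite lee_fin sqr_ge0.
apply: (@le_trans _ _ (\int[G]_q (((e / 2) ^+ 2)%:E + F q))%E).
  apply: ge0_le_integral => //.
  - by move=> q _; rewrite lee_fin sqr_ge0.
  - exact: (measurable_cost d0 dsym dtri d_cpt mf mTs).
  - exact: emeasurable_funD.
  - move=> q _; rewrite /F -EFinM -EFinD lee_fin indicE.
    have [|qN] := boolP (q \in N).
      by move=> _; rewrite mulr1 -[leLHS]add0r lerD ?sqr_ge0// ler_sqr ?nnegrE.
    rewrite mulr0 addr0 ler_sqr ?nnegrE ?d_ge0//; last by rewrite divr_ge0// ltW.
    have ab : bits U m q.1 = code p q.2 m.
      move: qN; rewrite notin_setE /N /= => /negP; rewrite negbK => /eqP.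
      by move=> /(congr1 val).
    have h1 : d q.1 (z q.2 m) < e / 4 by apply: mP; rewrite ab z_cell.
    have h2 : d (z q.2 m) (T q.2) <= e / 4 by exact: TP.
    have := dtri q.1 (z q.2 m) (T q.2); lra.
rewrite ge0_integralD//.
rewrite [X in (X + _)%E](_ : _ = ((e / 2) ^+ 2)%:E); last first.
  rewrite (@integral_cst _ _ _ G setT measurableT).
  by rewrite [X in (_ * X)%E](_ : _ = 1%E) ?mule1//; exact: probability_setT.
rewrite ge0_integralZl//; last first.
  by apply/measurable_EFinP; exact: measurable_indic.
rewrite integral_indic// setIT.
have GN : (G N <= (dif n)%:E)%E by rewrite Gn lee_fin.
apply: (@le_trans _ _ (((e / 2) ^+ 2)%:E + (D ^+ 2 * dif n)%:E)%E).
  by rewrite leeD2l// [leRHS]EFinM lee_wpmul2l.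
rewrite -EFinD lee_fin; have -> : e ^+ 2 = (e / 2) ^+ 2 + 3 * (e / 2) ^+ 2 by field.
by rewrite lerD2l.
Unshelve. all: by end_near. Qed.

End limit_measure.

(** * Bochner integrals of continuous Hilbert-valued functions *)

Section inner_product.
Context {R : realType} (Y : completeNormedModType R) (ip : Y -> Y -> R).
Hypotheses (ip_sym : forall x y, ip x y = ip y x)
  (ip_lin : forall z, linear (fun x => ip x z : R^o))
  (ip_norm : forall x, ip x x = `|x| ^+ 2).

Lemma ip_linear a x y z : ip (a *: x + y) z = a * ip x z + ip y z.
Proof. exact: (ip_lin z a x y). Qed.

Lemma ip0 z : ip 0 z = 0.
Proof. by have := ip_linear 1 0 0 z; rewrite scaler0 addr0; lra. Qed.

Lemma ipD x y z : ip (x + y) z = ip x z + ip y z.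
Proof. by rewrite -[x]scale1r ip_linear scale1r mul1r. Qed.

Lemma ipZ a x z : ip (a *: x) z = a * ip x z.
Proof. by rewrite -[a *: x]addr0 ip_linear ip0 addr0. Qed.

Lemma ipB x y z : ip (x - y) z = ip x z - ip y z.
Proof. by rewrite ipD -scaleN1r ipZ mulN1r. Qed.

Lemma ip_sum (I : Type) (r : seq I) (F : I -> Y) z :
  ip (\sum_(i <- r) F i) z = \sum_(i <- r) ip (F i) z.
Proof.
elim: r => [|i r IH]; first by rewrite !big_nil ip0.
by rewrite !big_cons ipD IH.
Qed.

Lemma cauchy_schwarz x y : `|ip x y| <= `|x| * `|y|.
Proof.
have [->|y0] := eqVneq y 0; first by rewrite ip_sym ip0 !normr0 mulr0.
have n0 : 0 < `|y| by rewrite normr_gt0.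
rewrite -ler_sqr ?nnegrE ?mulr_ge0// exprMn real_normK ?num_real//.
have : 0 <= ip (`|y| ^+ 2 *: x - ip x y *: y) (`|y| ^+ 2 *: x - ip x y *: y).
  by rewrite ip_norm sqr_ge0.
rewrite ipB ipZ ipZ [ip x (_ - _)]ip_sym [ip y (_ - _)]ip_sym.
rewrite !ipB !ipZ !ip_norm [ip y x]ip_sym.
set a := ip x y; set b := `|x|; have : 0 < `|y| ^+ 2 by rewrite exprn_gt0.
move: (`|y| ^+ 2) => c c0 h.
have : 0 <= c * (b ^+ 2 * c - a ^+ 2) by nra.
by rewrite pmulr_rge0// subr_ge0.
Qed.

End inner_product.

Section bounded_integrals.
Context {R : realType} d (T : measurableType d) (mu : probability T R).

Lemma bounded_integrable (g : T -> R) M : measurable_fun setT g ->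
  (forall x, `|g x| <= M) -> mu.-integrable setT (EFin \o g).
Proof.
move=> mg gM; apply: measurable_bounded_integrable => //.
- by rewrite (le_lt_trans (probability_le1 mu _)) ?ltry.
- exists M; split; first by rewrite num_real.
  by move=> r Mr x _; apply: le_trans (gM _) (ltW Mr).
Qed.

Lemma Rintegral_bounded_le (g : T -> R) M : measurable_fun setT g ->
  (forall x, `|g x| <= M) -> `|\int[mu]_x g x| <= M.
Proof.
move=> mg gM; have ig := bounded_integrable mg gM.
apply: (le_trans (le_normr_Rintegral measurableT ig)).
have mn : measurable_fun setT (fun x => `|g x|) by exact: measurableT_comp.
have -> : M = \int[mu]_x M.
  rewrite Rintegral_cst// [X in fine X](_ : _ = 1%E) ?mulr1//.
  exact: probability_setT.
apply: le_Rintegral => //.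
- by apply: (bounded_integrable (M := M) mn) => x; rewrite normr_id.
- by apply: (bounded_integrable (M := `|M|)).
Qed.

Lemma RintegralB_bounded (g h : T -> R) M N : measurable_fun setT g ->
  measurable_fun setT h -> (forall x, `|g x| <= M) -> (forall x, `|h x| <= N) ->
  \int[mu]_x (g x - h x) = \int[mu]_x g x - \int[mu]_x h x.
Proof.
by move=> mg mh gM hN; apply: RintegralB => //;
  [exact: bounded_integrable mg gM | exact: bounded_integrable mh hN].
Qed.

End bounded_integrals.

Section bochner_integral.
Context {R : realType} (Y : completeNormedModType R) (ip : Y -> Y -> R).
Hypotheses (ip_sym : forall x y, ip x y = ip y x)
  (ip_lin : forall z, linear (fun x => ip x z : R^o))
  (ip_norm : forall x, ip x x = `|x| ^+ 2).
Context d (T : measurableType d) (mu : probability T R).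

Lemma simple_bounded (s : T -> Y) : simple s -> exists M, forall x, `|s x| <= M.
Proof.
move=> [fs _]; exists (\sum_(v <- finmap.enum_fset (fset_set (range s))) `|v|) => x.
have sx : s x \in finmap.enum_fset (fset_set (range s)).
  by rewrite in_fset_set//; apply/mem_set; exists x.
by rewrite (big_rem (s x))//= lerDl; exact: sumr_ge0.
Qed.

Lemma simple_sum (s : T -> Y) (h : Y -> R) x : simple s ->
  h (s x) = \sum_(v <- finmap.enum_fset (fset_set (range s)))
    h v * \1_(s @^-1` [set v]) x.
Proof.
move=> [fs _]; have sx : s x \in finmap.enum_fset (fset_set (range s)).
  by rewrite in_fset_set//; apply/mem_set; exists x.
rewrite (bigD1_seq (s x) sx (finmap.fset_uniq _))/= big1 ?addr0.
  by rewrite indicE mem_set// mulr1.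
move=> v vx; rewrite indicE memNset ?mulr0//= => xv.
by move: vx; rewrite xv eqxx.
Qed.

Lemma measurable_simple_comp (s : T -> Y) (h : Y -> R) : simple s ->
  measurable_fun setT (h \o s).
Proof.
move=> ss; apply: (eq_measurable_fun (fun x =>
    \sum_(v <- finmap.enum_fset (fset_set (range s))) h v * \1_(s @^-1` [set v]) x)).
  by move=> x _; rewrite /= -simple_sum.
apply: measurable_sum => v; apply: measurable_funM => //.
by apply: measurable_indic; exact: ss.2.
Qed.

Lemma ip_simple_integral (s : T -> Y) e : simple s ->
  ip (simple_integral mu s) e = \int[mu]_x ip (s x) e.
Proof.
move=> ss; have [fs ms] := ss.
rewrite /simple_integral fsbig_finite//= ip_sum//.
rewrite /Rintegral (eq_integral (fun x => \sum_(v <- finmap.enum_fset (fset_set (range s)))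
    (ip v e * \1_(s @^-1` [set v]) x)%:E)%E); last first.
  by move=> x _; rewrite sumEFin (simple_sum (fun v => ip v e)).
have ind v : mu.-integrable setT (EFin \o \1_(s @^-1` [set v])).
  apply: (@bounded_integrable _ _ _ mu _ 1) => [|x].
    by apply: measurable_indic; exact: ms.
  by rewrite indicE; case: (x \in _); rewrite ?normr1 ?normr0.
rewrite integral_sum//; last first.
  by move=> v; under eq_fun do rewrite EFinM; apply: integrableZl => //; exact: ind.
have intE v : (\int[mu]_x (ip v e * \1_(s @^-1` [set v]) x)%:E =
    (ip v e * fine (mu (s @^-1` [set v])))%:E)%E.
  have mv : measurable (s @^-1` [set v]) by exact: ms.
  transitivity ((ip v e)%:E * \int[mu]_x (\1_(s @^-1` [set v]) x)%:E)%E.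
    by under eq_integral do rewrite EFinM; apply: integralZl => //; exact: ind.
  by rewrite integral_indic// setIT EFinM fineK// fin_num_measure.
by under [in RHS]eq_bigr do rewrite intE; rewrite sumEFin/=;
  apply: eq_bigr => v _; rewrite ipZ// mulrC.
Qed.

Variables (f : T -> Y) (M : R).
Hypothesis f_bounded : forall x, `|f x| <= M.
Hypothesis f_measurable : forall e, measurable_fun setT (fun x => ip (f x) e).

Let ip_f_bounded e x : `|ip (f x) e| <= M * `|e|.
Proof.
apply: (le_trans (cauchy_schwarz ip_sym ip_lin ip_norm _ _)).
by rewrite ler_wpM2r.
Qed.

Let ip_s_bounded (s : T -> Y) N e : (forall x, `|s x| <= N) ->
  forall x, `|ip (s x) e| <= N * `|e|.
Proof.
move=> sN x; apply: (le_trans (cauchy_schwarz ip_sym ip_lin ip_norm _ _)).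
by rewrite ler_wpM2r.
Qed.

(** Testing against [e] reduces the vector integral to a real one. The value is thus the same for
    every approximating sequence, and real integrals can be compared through couplings. *)
Lemma ip_is_bochner y e : is_bochner mu f y ->
  ip y e = \int[mu]_x ip (f x) e.
Proof.
move=> [s_ [ss sm si sy]].
have lim1 : ip (simple_integral mu (s_ n)) e @[n --> \oo] --> ip y e.
  apply/cvgrPdist_le => eps eps0.
  have e1 : 0 < `|e| + 1 by rewrite ltr_wpDl.
  have h : 0 < eps / (`|e| + 1) by rewrite divr_gt0.
  move/cvgrPdist_le : sy => /(_ _ h); apply: filterS => n hn.
  rewrite -(ipB ip_lin).
  apply: (le_trans (cauchy_schwarz ip_sym ip_lin ip_norm _ _)).
  apply: (@le_trans _ _ (eps / (`|e| + 1) * (`|e| + 1))); last by rewrite divfK// gt_eqF.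
  by rewrite ler_pM// lerDl.
have lim2 : ip (simple_integral mu (s_ n)) e @[n --> \oo] --> \int[mu]_x ip (f x) e.
  have eint : (`|e|%:E * \int[mu]_x `|f x - s_ n x|%:E)%E @[n --> \oo] --> 0%E.
    by rewrite -(mule0 `|e|%:E); apply: cvgeZl.
  apply/cvgrPdist_le => eps eps0.
  have /fine_cvgP[fin_e /cvgrPdist_le/(_ _ eps0) lim_e] := eint.
  apply: filterS2 fin_e lim_e => n fin_n; rewrite sub0r normrN => h.
  have [N sN] := simple_bounded (ss n).
  have m1 := f_measurable e.
  have m2 := measurable_simple_comp (fun v => ip v e) (ss n).
  rewrite ip_simple_integral// -(RintegralB_bounded mu m1 m2 (ip_f_bounded e)
    (ip_s_bounded e sN)).
  apply: le_trans h; apply: le_trans (ler_norm _); rewrite -lee_fin fineK//.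
  have m12 : measurable_fun setT (fun x => ip (f x) e - ip (s_ n x) e).
    exact: measurable_funB.
  have b12 x : `|ip (f x) e - ip (s_ n x) e| <= M * `|e| + N * `|e|.
    apply: le_trans (ler_normB _ _) _; apply: lerD; first exact: ip_f_bounded.
    exact: ip_s_bounded.
  rewrite (EFin_normr_Rintegral measurableT (bounded_integrable mu m12 b12)).
  rewrite -ge0_integralZl//; last first.
    exact/measurable_EFinP.
  apply: le_trans (le_abse_integral mu measurableT _) _; first exact/measurable_EFinP.
  apply: ge0_le_integral => //.
  - by apply: measurableT_comp => //; exact/measurable_EFinP.
  - by apply: measurable_funeM; exact/measurable_EFinP.
  - move=> x _; rewrite -(ipB ip_lin) -EFinM abse_EFin lee_fin mulrC.
    exact: (cauchy_schwarz ip_sym ip_lin ip_norm).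
exact: (cvg_unique _ lim1 lim2).
Qed.

Lemma bochner_exists (s_ : nat -> T -> Y) : (forall n, simple (s_ n)) ->
  (forall n, measurable_fun setT (fun x => `|f x - s_ n x|)) ->
  (forall eps, 0 < eps -> \forall n \near \oo, forall x, `|f x - s_ n x| <= eps) ->
  exists y, is_bochner mu f y.
Proof.
move=> ss sm s_f.
have Iclose n m eps : 0 <= eps -> (forall x, `|f x - s_ n x| <= eps) ->
    (forall x, `|f x - s_ m x| <= eps) ->
    `|simple_integral mu (s_ n) - simple_integral mu (s_ m)| <= eps + eps.
  move=> eps0 fn fm; set e := _ - _.
  have [->|e0] := eqVneq e 0; first by rewrite normr0 addr_ge0.
  have ne0 : 0 < `|e| by rewrite normr_gt0.
  (* With the difference [e] as test vector, [|e|^2] is a real integral of size at most [2 eps |e|];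
     this is the Cauchy property of the simple integrals. *)
  rewrite -(ler_pM2r ne0) -expr2 -ip_norm {1}/e (ipB ip_lin) !ip_simple_integral//.
  have [N sN] := simple_bounded (ss n); have [N' sN'] := simple_bounded (ss m).
  have m1 := measurable_simple_comp (fun v => ip v e) (ss n).
  have m2 := measurable_simple_comp (fun v => ip v e) (ss m).
  rewrite -(RintegralB_bounded mu m1 m2 (ip_s_bounded e sN) (ip_s_bounded e sN')).
  apply: (le_trans (ler_norm _)); apply: Rintegral_bounded_le.
    exact: measurable_funB.
  move=> x; rewrite /= -(ipB ip_lin).
  apply: (le_trans (cauchy_schwarz ip_sym ip_lin ip_norm _ _)).
  rewrite ler_wpM2r//.
  have -> : s_ n x - s_ m x = - (f x - s_ n x) + (f x - s_ m x).
    by rewrite opprB addrA subrK.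
  by apply: (le_trans (ler_normD _ _)); rewrite normrN lerD.
have : cauchy (simple_integral mu (s_ n) @[n --> \oo]).
  apply: cauchy_exP => eps eps0.
  have e3 : 0 < eps / 3 by rewrite divr_gt0.
  have [N _ NP] := s_f _ e3.
  exists (simple_integral mu (s_ N)); exists N => // n /= Nn.
  rewrite -ball_normE /=.
  apply: (le_lt_trans (Iclose N n (eps / 3) (ltW e3) (NP _ (leqnn N)) (NP _ Nn))).
  lra.
move=> /cauchy_cvg/cvg_ex[y sy]; exists y, s_; split => //.
have small eps : 0 < eps -> \forall n \near \oo,
    (0 <= \int[mu]_x `|f x - s_ n x|%:E <= eps%:E)%E.
  move=> eps0; apply: filterS (s_f _ eps0) => n fn.
  rewrite integral_ge0//=.
  apply: (@le_trans _ _ (\int[mu]_x eps%:E)%E).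
    apply: ge0_le_integral => //; first exact/measurable_EFinP.
    by move=> x _; rewrite lee_fin.
  rewrite integral_cst//= [X in (_ * X)%E](_ : _ = 1%E) ?mule1//.
  exact: probability_setT.
apply/fine_cvgP; split.
  apply: filterS (small _ ltr01) => n /andP[h0 h1].
  by rewrite ge0_fin_numE// (le_lt_trans h1)// ltry.
apply/cvgrPdist_le => eps eps0.
apply: filterS (small _ eps0) => n /andP[h0 h1].
rewrite sub0r normrN ger0_norm ?fine_ge0//= -lee_fin fineK//.
by rewrite ge0_fin_numE// (le_lt_trans h1)// ltry.
Qed.

End bochner_integral.

(** * Integrals of continuous functions as functions of the measure *)

Section compact_integrands.
Context {R : realType} (X : pointedType) (d : X -> X -> R).
Hypotheses (d0 : forall x, d x x = 0) (dsym : forall x y, d x y = d y x)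
  (dtri : forall x y z, d x z <= d x y + d y z).
Hypothesis d_cpt : forall u : nat -> X,
  exists2 s : nat -> nat, {homo s : m n / (m < n)%N} &
    exists x, d (u (s n)) x @[n --> \oo] --> 0.

Local Notation B := (borel d).

Let d_ge0 x y : 0 <= d x y. Proof. exact: (pseudometric_ge0 d0 dsym dtri). Qed.

(** Continuity is stated along sequences because [X] carries only the function [d], and because (A5)
    yields it in this form. *)
Definition seq_continuous (V : normedModType R) (f : X -> V) :=
  forall (u : nat -> X) x, d (u n) x @[n --> \oo] --> 0 ->
    f (u n) @[n --> \oo] --> f x.

(** The square matches the transport cost. If no [C] worked, pairs violating the bound with [C = n]
    would have a convergent subsequence; its two limits are at distance zero because the values of
    [f] converge along it, and then continuity contradicts a gap larger than [e]. *)
Lemma quadratic_modulus (V : normedModType R) (f : X -> V) e :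
  seq_continuous f -> 0 < e ->
  exists2 C, 0 <= C & forall x y, `|f x - f y| <= e + C * d x y ^+ 2.
Proof.
move=> cf e0; apply: contrapT => nC.
have /choice[w wP] (n : nat) : exists w : X * X,
    e + n%:R * d w.1 w.2 ^+ 2 < `|f w.1 - f w.2|.
  apply: contrapT => /forallNP h; apply: nC; exists n%:R => // x y.
  by rewrite leNgt; apply/negP; exact: h (x, y).
have [s hs [x sx]] := d_cpt (fst \o w).
have [t ht [y ty]] := d_cpt (snd \o w \o s).
have xx : d (w (s (t n))).1 x @[n --> \oo] --> 0 := cvg_subsequence ht sx.
have fx := cf _ _ xx; have fy := cf _ _ ty.
have dxy : d (w (s (t n))).1 (w (s (t n))).2 @[n --> \oo] --> d x y.
  exact: (pseudometric_cvg d0 dsym dtri xx ty).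
have fxy : `|f (w (s (t n))).1 - f (w (s (t n))).2| @[n --> \oo] --> `|f x - f y|.
  by apply: cvg_norm; exact: cvgB.
have st n : (n <= s (t n))%N.
  exact: leq_trans (homo_ltn_ge_id ht n) (homo_ltn_ge_id hs _).
have d_small : d x y = 0.
  apply/eqP; rewrite -[_ == _]negbK; apply/negP => dn.
  have dp : 0 < d x y by rewrite lt_neqAle eq_sym dn d_ge0.
  have d2 : 0 < d x y / 2 by rewrite divr_gt0.
  pose k := (Num.truncn ((`|f x - f y| + 1) / (d x y / 2) ^+ 2)).+1.
  near \oo => n.
  have h1 : `|d x y - d (w (s (t n))).1 (w (s (t n))).2| <= d x y / 2.
    by near: n; move/cvgrPdist_le : dxy; exact.
  have h2 : `| `|f x - f y| - `|f (w (s (t n))).1 - f (w (s (t n))).2| | <= 1.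
    by near: n; move/cvgrPdist_le : fxy; exact.
  have h3 : (k <= n)%N by near: n; exact: nbhs_infty_ge.
  have := wP (s (t n)); apply/negP; rewrite -leNgt.
  have h4 : (`|f x - f y| + 1) <= n%:R * (d x y / 2) ^+ 2.
    rewrite -ler_pdivrMr ?exprn_gt0//.
    by apply: le_trans (ltW (truncnS_gt _)) _; rewrite ler_nat.
  have h5 : d x y / 2 <= d (w (s (t n))).1 (w (s (t n))).2.
    by move: h1; rewrite ler_norml => /andP[_]; lra.
  have h6 : n%:R * (d x y / 2) ^+ 2 <=
      (s (t n))%:R * d (w (s (t n))).1 (w (s (t n))).2 ^+ 2.
    rewrite ler_pM ?sqr_ge0 ?ler_nat ?st//.
    by rewrite ler_sqr ?nnegrE// ltW.
  move: h2; rewrite ler_norml => /andP[h2 _]; lra.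
have xy : d (w (s (t n))).1 y @[n --> \oo] --> 0.
  apply/cvgrPdist_le => eps eps0; move/cvgrPdist_le : xx => /(_ _ eps0).
  apply: filterS => n; rewrite !sub0r !normrN !ger0_norm// => h.
  by have := dtri (w (s (t n))).1 x y; rewrite d_small; lra.
have fE : f x = f y := cvg_unique (@norm_hausdorff _ _) fx (cf _ _ xy).
have fxy0 : `|f x - f y| = 0 by rewrite fE subrr normr0.
rewrite fxy0 in fxy.
move/cvgrPdist_lt : fxy => /(_ _ e0)[n _ nP].
have := nP n (leqnn n); rewrite /= sub0r normrN normr_id; apply/negP; rewrite -leNgt.
apply: le_trans (ltW (wP _)); rewrite lerDl mulr_ge0// sqr_ge0//.
Unshelve. all: by end_near. Qed.

Lemma seq_continuous_bounded (V : normedModType R) (f : X -> V) :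
  seq_continuous f -> exists M, forall x, `|f x| <= M.
Proof.
move=> cf; have [C C0 fC] := quadratic_modulus cf (@ltr01 R).
have [D D0 dD] := diameter_bound d0 dsym dtri d_cpt.
exists (1 + C * D ^+ 2 + `|f point|) => x.
rewrite -[f x](subrK (f point)); apply: (le_trans (ler_normD _ _)).
rewrite lerD2r (le_trans (fC _ _))// lerD2l ler_wpM2l// ler_sqr ?nnegrE//.
Qed.

Lemma seq_continuous_measurable (g : X -> R) :
  seq_continuous (g : X -> R^o) -> measurable_fun setT (g : B -> R).
Proof.
move=> cg; have [U Uo Us] := separating_opens d0 dsym dtri d_cpt.
apply: (@measurable_fun_cvg _ _ _ setT
  (fun m (x : B) => g (cell_point U (bits U m x)))) => [m|x _].
  exact: (measurable_fun_fibers (fun w => g (cell_point U w))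
    (measurable_bits_fiber Uo m)).
apply: cg; apply/cvgrPdist_le => e e0.
have [m mP] := bits_close Us e0.
exists m => // n /= mn; rewrite sub0r normrN ger0_norm// ltW//.
by apply: (mP n) => //; exact: bits_cell_point.
Qed.

Lemma Rintegral_W2_modulus (mu nu : P2 d) (g : X -> R) (A C r : R) :
  seq_continuous (g : X -> R^o) -> 0 <= A -> 0 <= C ->
  (forall x y, `|g x - g y| <= A + C * d x y ^+ 2) -> W2 mu nu < r ->
  `|\int[mu]_x g x - \int[nu]_x g x| <= A + C * r ^+ 2.
Proof.
move=> cg A0 C0 gAC Wr.
have mg := seq_continuous_measurable cg.
have [M gM] := seq_continuous_bounded cg.
have [G Gc Gr] := W2_lt_coupling d0 dsym dtri d_cpt Wr.
have G1 S : measurable S -> G (fst @^-1` S) = mu S by move=> /Gc[].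
have G2 S : measurable S -> G (snd @^-1` S) = nu S by move=> /Gc[].
rewrite -(@Rintegral_marginal _ _ _ _ _ G fst measurable_fst mu G1 g M mg gM).
rewrite -(@Rintegral_marginal _ _ _ _ _ G snd measurable_snd nu G2 g M mg gM).
have m1 : measurable_fun setT (fun p : B * B => g p.1).
  exact: measurableT_comp mg measurable_fst.
have m2 : measurable_fun setT (fun p : B * B => g p.2).
  exact: measurableT_comp mg measurable_snd.
rewrite -(RintegralB_bounded G m1 m2 (fun p => gM p.1) (fun p => gM p.2)).
have m12 : measurable_fun setT (fun p : B * B => g p.1 - g p.2).
  exact: measurable_funB.
have b12 (p : B * B) : `|g p.1 - g p.2| <= M + M.
  by apply: le_trans (ler_normB _ _) _; apply: lerD.
rewrite -lee_fin (EFin_normr_Rintegral measurableT (bounded_integrable G m12 b12)).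
apply: le_trans (le_abse_integral G measurableT _) _; first exact/measurable_EFinP.
have md := measurable_cost d0 dsym dtri d_cpt measurable_fst measurable_snd.
apply: (@le_trans _ _ (\int[G]_p (A%:E + C%:E * (d p.1 p.2 ^+ 2)%:E))%E).
  apply: ge0_le_integral => //.
  - by apply: measurableT_comp => //; exact/measurable_EFinP.
  - by apply: emeasurable_funD => //; exact: measurable_funeM.
  - by move=> p _; rewrite -EFinM -EFinD abse_EFin lee_fin.
rewrite ge0_integralD//; last 2 first.
- by move=> p _; rewrite mule_ge0 ?lee_fin ?sqr_ge0.
- exact: measurable_funeM.
rewrite EFinD leeD//.
  rewrite (@integral_cst _ _ _ G setT measurableT).
  by rewrite [X in (_ * X)%E](_ : _ = 1%E) ?mule1//; exact: probability_setT.
rewrite ge0_integralZl//; last by move=> p _; rewrite lee_fin sqr_ge0.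
by rewrite [leRHS]EFinM lee_wpmul2l ?lee_fin.
Qed.

Lemma Rintegral_cvg (u : nat -> P2 d) (mu : P2 d) (g : X -> R) :
  seq_continuous (g : X -> R^o) -> W2 (u n) mu @[n --> \oo] --> 0 ->
  \int[u n]_x g x @[n --> \oo] --> \int[mu]_x g x.
Proof.
move=> cg um; apply/cvgrPdist_le => e e0.
have e20 : 0 < e / 2 by rewrite divr_gt0.
have [C C0 gC] := quadratic_modulus cg e20.
(* The square of this radius times [C] is at most [e / 2]; [C + 1] covers the case [C = 0]. *)
have r0 : 0 < Num.sqrt (e / 2 / (C + 1)) by rewrite sqrtr_gt0 !divr_gt0// ltr_wpDl.
move/cvgrPdist_lt : um => /(_ _ r0); apply: filterS => n.
rewrite sub0r normrN => /(le_lt_trans (ler_norm _)) hn.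
rewrite distrC; apply: (le_trans (Rintegral_W2_modulus cg (ltW e20) C0 gC hn)).
rewrite sqr_sqrtr; last by rewrite ltW// !divr_gt0// ltr_wpDl.
rewrite [leRHS]splitr lerD2l mulrA ler_pdivrMr ?ltr_wpDl//.
by rewrite mulrC ler_pM2l// lerDl.
Qed.

End compact_integrands.

Section bochner_continuity.
Context {R : realType} (X : pointedType) (d : X -> X -> R).
Hypotheses (d0 : forall x, d x x = 0) (dsym : forall x y, d x y = d y x)
  (dtri : forall x y z, d x z <= d x y + d y z).
Hypothesis d_cpt : forall u : nat -> X,
  exists2 s : nat -> nat, {homo s : m n / (m < n)%N} &
    exists x, d (u (s n)) x @[n --> \oo] --> 0.

Local Notation B := (borel d).

Let d_ge0 x y : 0 <= d x y. Proof. exact: (pseudometric_ge0 d0 dsym dtri). Qed.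

(** The coordinates are the masses of the cells, indexed by finite words through [pickle];
    [limit_measure_exists] rebuilds a measure from their limits. *)
Lemma W2_coordinates : exists phi : nat -> P2 d -> R,
  (forall j mu, 0 <= phi j mu <= 1) /\
  forall u : nat -> P2 d, (forall j, cvgn (fun n => phi j (u n))) ->
    exists mu, W2 (u n) mu @[n --> \oo] --> 0.
Proof.
have [U Uo Us] := separating_opens d0 dsym dtri d_cpt.
have mcell w : measurable (cell U w : set B) by exact: measurable_cell.
exists (fun j (mu : P2 d) =>
  if unpickle j is Some w then fine (mu (cell U w)) else 0).
split=> [j mu|u uc].
  case: unpickle => [w|]; last by rewrite lexx ler01.
  rewrite fine_ge0//= -lee_fin fineK ?fin_num_measure//.
  exact: probability_le1.
apply: (limit_measure_exists d0 dsym dtri d_cpt Uo Us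
  (p := fun w => limn (fun n => fine (u n (cell U w))))) => w.
by have := uc (pickle w); rewrite pickleK.
Qed.

Context (Y : completeNormedModType R) (ip : Y -> Y -> R).
Hypotheses (ip_sym : forall x y, ip x y = ip y x)
  (ip_lin : forall z, linear (fun x => ip x z : R^o))
  (ip_norm : forall x, ip x x = `|x| ^+ 2).
Variable f : X -> Y.
Hypothesis cf : seq_continuous d f.

Lemma seq_continuous_ip e : seq_continuous d (fun x => ip (f x) e : R^o).
Proof.
move=> u x ux; apply/cvgrPdist_le => eps eps0.
have e1 : 0 < `|e| + 1 by rewrite ltr_wpDl.
have h : 0 < eps / (`|e| + 1) by rewrite divr_gt0.
move/cvgrPdist_le : (cf ux) => /(_ _ h); apply: filterS => n hn.
rewrite -(ipB ip_lin); apply: (le_trans (cauchy_schwarz ip_sym ip_lin ip_norm _ _)).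
apply: (@le_trans _ _ (eps / (`|e| + 1) * (`|e| + 1))); last by rewrite divfK// gt_eqF.
by rewrite ler_pM// lerDl.
Qed.

(** [bochner] is chosen by [get], so some integral has to be exhibited. Functions constant on the
    cells of depth [n] approximate [f] uniformly, by [quadratic_modulus]. *)
Lemma is_bochner_bochner (mu : P2 d) : is_bochner mu (f : B -> Y) (bochner mu f).
Proof.
suff [y hy] : exists y, is_bochner mu (f : B -> Y) y by exact: (getPex (ex_intro _ y hy)).
have [U Uo Us] := separating_opens d0 dsym dtri d_cpt.
have mbits m w : measurable (bits U m @^-1` [set w] : set B).
  exact: measurable_bits_fiber.
pose s_ n (x : B) := f (cell_point U (bits U n x)).
have s_f eps : 0 < eps -> \forall n \near \oo, forall x, `|f x - s_ n x| <= eps.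
  move=> eps0; have e20 : 0 < eps / 2 by rewrite divr_gt0.
  have [C C0 fC] := quadratic_modulus d0 dsym dtri d_cpt cf e20.
  have r0 : 0 < Num.sqrt (eps / 2 / (C + 1)) by rewrite sqrtr_gt0 !divr_gt0// ltr_wpDl.
  have [m mP] := bits_close Us r0.
  exists m => // n /= mn x; apply: (le_trans (fC _ _)).
  rewrite [leRHS]splitr lerD2l.
  apply: (@le_trans _ _ (C * Num.sqrt (eps / 2 / (C + 1)) ^+ 2)).
    rewrite ler_wpM2l// ler_sqr ?nnegrE ?(ltW r0)// ltW//.
    by apply: (mP n) => //; rewrite bits_cell_point.
  rewrite sqr_sqrtr; last by rewrite ltW// !divr_gt0// ltr_wpDl.
  rewrite mulrA ler_pdivrMr ?ltr_wpDl//.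
  by rewrite mulrC ler_pM2l// lerDl.
have [M fM] := seq_continuous_bounded d0 dsym dtri d_cpt cf.
have mf e : measurable_fun setT (fun x : B => ip (f x) e).
  exact: (seq_continuous_measurable d0 dsym dtri d_cpt
    (g := fun x => ip (f x) e) (@seq_continuous_ip e)).
apply: (@bochner_exists _ _ _ ip_sym ip_lin ip_norm _ B mu f s_) => //.
  move=> n; split.
    apply: (@sub_finite_set _ _ ((fun t : n.-tuple bool => f (cell_point U t)) @` setT)).
      by move=> _ [x _ <-]; exists (bits_tuple U n x).
    by apply: finite_image; exact: finite_finset.
  move=> v; exact: (@measurable_preimage_fibers _ B _ (bits U n)
    [set w | f (cell_point U w) = v] (mbits n)).
(* The norm of [f - s_ n] is a pointwise limit of functions of finitely many bits, which gives its
   measurability. *)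
move=> n; apply: (@measurable_fun_cvg _ _ _ setT
    (fun k (x : B) => `|s_ k x - s_ n x|)) => [k|x _].
  pose a (x : B) := (bits U k x, bits U n x).
  have ma w : measurable (a @^-1` [set w]).
    case: w => w1 w2; rewrite (_ : _ @^-1` _ =
      (bits U k @^-1` [set w1]) `&` (bits U n @^-1` [set w2])).
      exact: measurableI.
    by apply/seteqP; split => q /= [<- <-].
  exact: (measurable_fun_fibers
    (fun w => `|f (cell_point U w.1) - f (cell_point U w.2)|) ma).
apply: cvg_norm; apply: cvgB; last exact: cvg_cst.
apply/cvgrPdist_le => eps eps0.
by apply: filterS (s_f _ eps0) => k.
Qed.

Lemma ip_bochner (mu : P2 d) e : ip (bochner mu (f : B -> Y)) e = \int[mu]_x ip (f x) e.
Proof.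
have [M fM] := seq_continuous_bounded d0 dsym dtri d_cpt cf.
have mf e' : measurable_fun setT (fun x : B => ip (f x) e').
  exact: (seq_continuous_measurable d0 dsym dtri d_cpt
    (g := fun x => ip (f x) e') (@seq_continuous_ip e')).
exact: (@ip_is_bochner _ _ _ ip_sym ip_lin ip_norm _ B mu f M fM mf _ e
  (is_bochner_bochner mu)).
Qed.

(** With the difference [e] of the two integrals as test vector, the norm becomes a difference of
    real integrals of [ip (f x) e], whose modulus is that of [f] times [|e|]. *)
Lemma bochner_W2_modulus (mu nu : P2 d) (A C r : R) : 0 <= A -> 0 <= C ->
  (forall x y, `|f x - f y| <= A + C * d x y ^+ 2) -> W2 mu nu < r ->
  `|bochner mu (f : B -> Y) - bochner nu (f : B -> Y)| <= A + C * r ^+ 2.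
Proof.
move=> A0 C0 fAC Wr; set e := _ - _.
have [->|e0] := eqVneq e 0; first by rewrite normr0 addr_ge0// mulr_ge0// sqr_ge0.
have ne0 : 0 < `|e| by rewrite normr_gt0.
rewrite -(ler_pM2r ne0) -expr2 -ip_norm {1}/e (ipB ip_lin) !ip_bochner.
apply: (le_trans (ler_norm _)).
rewrite mulrDl -[leRHS](_ : A * `|e| + (C * `|e|) * r ^+ 2 = _); last by ring.
apply: (Rintegral_W2_modulus d0 dsym dtri d_cpt
  (g := fun x => ip (f x) e) (@seq_continuous_ip e) _ _ _ Wr).
- by rewrite mulr_ge0.
- by rewrite mulr_ge0.
- move=> x y; rewrite -(ipB ip_lin).
  apply: (le_trans (cauchy_schwarz ip_sym ip_lin ip_norm _ _)).
  have -> : A * `|e| + C * `|e| * d x y ^+ 2 = (A + C * d x y ^+ 2) * `|e| by ring.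
  by rewrite ler_wpM2r.
Qed.

Lemma bochner_cvg (u : nat -> P2 d) (mu : P2 d) : W2 (u n) mu @[n --> \oo] --> 0 ->
  bochner (u n) (f : B -> Y) @[n --> \oo] --> bochner mu (f : B -> Y).
Proof.
move=> um; apply/cvgrPdist_le => e e0.
have e20 : 0 < e / 2 by rewrite divr_gt0.
have [C C0 fC] := quadratic_modulus d0 dsym dtri d_cpt cf e20.
have r0 : 0 < Num.sqrt (e / 2 / (C + 1)) by rewrite sqrtr_gt0 !divr_gt0// ltr_wpDl.
move/cvgrPdist_lt : um => /(_ _ r0); apply: filterS => n.
rewrite sub0r normrN => /(le_lt_trans (ler_norm _)) hn.
rewrite distrC; apply: (le_trans (bochner_W2_modulus (ltW e20) C0 fC hn)).
rewrite sqr_sqrtr; last by rewrite ltW// !divr_gt0// ltr_wpDl.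
rewrite [leRHS]splitr lerD2l mulrA ler_pdivrMr ?ltr_wpDl//.
by rewrite mulrC ler_pM2l// lerDl.
Qed.

End bochner_continuity.

(** * Weak-star compactness and the space [Omega] *)

Section weak_star_compactness.
Context {R : realType} (C : completeNormedModType R).

Lemma weak_star_eval_continuous (x : C) :
  continuous (fun f : weak_star C => (f : dual C) x : R^o).
Proof.
move=> f.
apply: (@continuous_comp _ _ _ (fun g : weak_star C => (g : C -> R^o) : {ptws C -> R^o})
  (fun g => g x)).
  exact: initial_continuous.
exact: (@proj_continuous C (fun _ => R^o) x).
Qed.

Lemma weak_star_cvgP (u : nat -> dual C) (g : dual C) :
  (forall x, u n x @[n --> \oo] --> (g x : R^o)) -> weak_star_cvg u g.
Proof.
move=> ug A; rewrite nbhsE => -[_ [[V oV <-] Vg] VA].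
apply: filterS VA _.
have : {ptws, (fun n => (u n : C -> R^o)) @ \oo --> (g : C -> R^o)}.
  by apply/pointwise_cvgP => x; exact: ug.
by apply; exact: open_nbhs_nbhs.
Qed.

Lemma dual_bounded_on_balls (f : dual C) : bounded_fun_norm (f : C -> R^o).
Proof.
move=> r; exists (dual_norm f * (`|r| + 1)) => x xr.
have r1 : 0 < `|r| + 1 by rewrite ltr_wpDl.
rewrite -ler_pdivrMr// -[leLHS]ger0_norm ?divr_ge0// ?(ltW r1)//.
have -> : `| `|f x| / (`|r| + 1)| = `|f ((`|r| + 1)^-1 *: x)|.
  by rewrite linearZ normrZ normrM normr_id mulrC.
apply: dual_norm_ub; rewrite normrZ normfV (gtr0_norm r1) mulrC ler_pdivrMr// mul1r.
by apply: le_trans xr (le_trans (ler_norm r) _); rewrite lerDl.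
Qed.

(** Evaluations are weak-star continuous, so [A] is pointwise bounded, and the uniform boundedness
    principle applies on the complete space [C]. *)
Lemma weak_star_compact_bounded (A : set (dual C)) : weak_star_compact A ->
  exists M, forall f, A f -> forall x, `|f x| <= M * `|x|.
Proof.
move=> cA; pose F := [set (f : C -> R^o) | f in A].
have [||M MP] := @Banach_Steinhauss R C R^o F _ _ 1.
- move=> _ [f Af <-]; split; first exact: dual_bounded_on_balls.
  exact: dual_linear.
- move=> x; have := compact_bounded (continuous_compact
    (continuous_subspaceT (@weak_star_eval_continuous x)) cA).
  move=> [N [_ NP]]; exists (N + 1) => _ [f Af <-].
  by apply: (NP (N + 1)); [rewrite ltrDl | exists f].
exists M => f Af x; have [->|x0] := eqVneq x 0.
  by rewrite linear0 !normr0 mulr0.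
have nx : 0 < `|x| by rewrite normr_gt0.
rewrite -ler_pdivrMr//.
have Ff : F f by exists f.
have x1 : `| `|x|^-1 *: x| <= 1 by rewrite normrZ normfV normr_id mulVf// gt_eqF.
have := MP _ Ff _ x1.
by rewrite linearZ normrZ normfV normr_id mulrC.
Qed.

(** The evaluations at a countable dense set are made to converge by [cluster_extraction]; the
    uniform bound on [A] carries the convergence over to all of [C]. *)
Lemma weak_star_seq_compact (A : set (dual C)) (u : nat -> dual C) :
  separable_space C -> weak_star_compact A -> (forall n, A (u n)) ->
  exists2 s : nat -> nat, {homo s : m n / (m < n)%N} &
    exists2 g, A g & weak_star_cvg (fun n => u (s n)) g.
Proof.
move=> [D cD dD] cA Au.
have [M MP] := weak_star_compact_bounded cA.
have /pcard_surjP[x xD] := cD.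
have [|g [Ag clg]] := @cA ((u : nat -> weak_star C) @ \oo) _.
  by rewrite nbhs_simpl /=; exists 0%N => // n _; exact: Au.
have [|s hs sP] := @cluster_extraction R (weak_star C) u g
  (fun j f => (f : dual C) (x j)) clg.
  by move=> j; exact: weak_star_eval_continuous.
exists s => //; exists g => //; apply: weak_star_cvgP => y.
apply/cvgrPdist_le => e e0.
(* [M] is not known to be positive, and [M1] has to be a denominator. *)
pose M1 := `|M| + 1; have M10 : 0 < M1 by rewrite ltr_wpDl.
have M1P f : A f -> forall z, `|f z| <= M1 * `|z|.
  move=> Af z; apply: (le_trans (MP _ Af z)); rewrite ler_wpM2r//.
  by rewrite (le_trans (ler_norm M))// lerDl.
have r0 : 0 < e / 3 / M1 by rewrite !divr_gt0.
have [z [/= yw Dz]] : ball y (e / 3 / M1) `&` D !=set0.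
  apply: dD; last exact: ball_open.
  by exists y; apply: ballxx.
have [j _ xj] := xD _ Dz; rewrite -xj -ball_normE /= in yw.
near=> n.
have h1 : `|g (x j) - u (s n) (x j)| <= e / 3.
  near: n; have e3 : 0 < e / 3 by rewrite divr_gt0.
  by move/cvgrPdist_le : (sP j); exact.
have small f : A f -> `|f (y - x j)| <= e / 3.
  move=> Af; apply: (le_trans (M1P _ Af _)).
  by rewrite mulrC -ler_pdivlMr// ltW.
have -> : g y - u (s n) y =
    g (y - x j) + (g (x j) - u (s n) (x j)) - u (s n) (y - x j).
  by rewrite !linearB /=; ring.
have h2 := small _ Ag; have h3 := small _ (Au (s n)).
apply: (le_trans (ler_normB _ _)).
have := ler_normD (g (y - x j)) (g (x j) - u (s n) (x j)); lra.
Unshelve. all: by end_near. Qed.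

End weak_star_compactness.

Section product_metric.
Context {R : realType} (M : choiceType) (L : R) (L0 : 0 < L) (B : set M)
  (B0 : B !=set0) (dB : B -> B -> R).
Hypothesis dB_metric : is_metric dB.

Local Notation dO := (@dOmega R M L L0 B B0 dB).

Let dB0 x : dB x x = 0. Proof. by case: dB_metric => h _ _; exact: (h x x).2. Qed.
Let dB_sym x y : dB x y = dB y x. Proof. by case: dB_metric. Qed.
Let dB_tri x y z : dB x z <= dB x y + dB y z. Proof. by case: dB_metric. Qed.
Let dB_ge0 x y : 0 <= dB x y. Proof. exact: (pseudometric_ge0 dB0 dB_sym dB_tri). Qed.

Lemma dOmega_refl w : dO w w = 0.
Proof. by rewrite /dOmega subrr normr0 dB0 expr0n addr0 sqrtr0. Qed.

Lemma dOmega_sym w w' : dO w w' = dO w' w.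
Proof. by rewrite /dOmega distrC dB_sym. Qed.

(** Minkowski's inequality in the plane; its cross term is bounded by [(a q - p b)^2 >= 0]. *)
Lemma sqrt_sqrD_triangle (a b p q : R) : 0 <= a -> 0 <= b -> 0 <= p -> 0 <= q ->
  Num.sqrt ((a + b) ^+ 2 + (p + q) ^+ 2) <=
  Num.sqrt (a ^+ 2 + p ^+ 2) + Num.sqrt (b ^+ 2 + q ^+ 2).
Proof.
move=> a0 b0 p0 q0.
have h1 : 0 <= a ^+ 2 + p ^+ 2 by rewrite addr_ge0 ?sqr_ge0.
have h2 : 0 <= b ^+ 2 + q ^+ 2 by rewrite addr_ge0 ?sqr_ge0.
rewrite -ler_sqr ?nnegrE ?addr_ge0 ?sqrtr_ge0// sqr_sqrtr ?addr_ge0 ?sqr_ge0//.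
rewrite [leRHS]sqrrD !sqr_sqrtr// -sqrtrM//.
have h : a * b + p * q <= Num.sqrt ((a ^+ 2 + p ^+ 2) * (b ^+ 2 + q ^+ 2)).
  have ab : 0 <= a * b + p * q by rewrite addr_ge0// mulr_ge0.
  rewrite -[leLHS](ger0_norm ab) -sqrtr_sqr ler_wsqrtr//.
  by have := sqr_ge0 (a * q - p * b); nra.
lra.
Qed.

Lemma dOmega_tri w1 w2 w3 : dO w1 w3 <= dO w1 w2 + dO w2 w3.
Proof.
rewrite /dOmega.
apply: le_trans (sqrt_sqrD_triangle (normr_ge0 (mass w1 - mass w2))
  (normr_ge0 (mass w2 - mass w3)) (dB_ge0 w1.2 w2.2) (dB_ge0 w2.2 w3.2)).
rewrite ler_wsqrtr// lerD// ler_sqr ?nnegrE ?addr_ge0//.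
exact: ler_distD.
Qed.

Lemma dOmega_cvg (w : nat -> Omega L0 B0) (w' : Omega L0 B0) :
  dO (w n) w' @[n --> \oo] --> 0 <->
  (mass (w n) @[n --> \oo] --> mass w') /\ (dB (w n).2 w'.2 @[n --> \oo] --> 0).
Proof.
split=> [ww|[m_cvg b_cvg]].
  split; apply/cvgrPdist_le => e e0; move/cvgrPdist_le : ww => /(_ _ e0);
    apply: filterS => n; rewrite sub0r normrN ger0_norm ?sqrtr_ge0// => h.
    rewrite distrC -[leLHS]normr_id -sqrtr_sqr; apply: le_trans h.
    by rewrite ler_wsqrtr// lerDl sqr_ge0.
  rewrite sub0r normrN -sqrtr_sqr; apply: le_trans h.
  by rewrite ler_wsqrtr// lerDr sqr_ge0.
have h : `|mass (w n) - mass w'| ^+ 2 + dB (w n).2 w'.2 ^+ 2 @[n --> \oo] --> 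
    `|mass w' - mass w'| ^+ 2 + 0 ^+ 2.
  apply: cvgD; rewrite expr2; under eq_fun do rewrite expr2; apply: cvgM => //;
    by apply: cvg_norm; apply: cvgB => //; exact: cvg_cst.
rewrite subrr normr0 expr0n addr0 /= in h.
rewrite -(sqrtr0 R).
by apply: (continuous_cvg _ _ h); exact: sqrt_continuous.
Qed.

Lemma Omega_seq_compact :
  (forall u : nat -> B, exists2 s : nat -> nat, {homo s : m n / (m < n)%N} &
     exists x, dB (u (s n)) x @[n --> \oo] --> 0) ->
  forall w : nat -> Omega L0 B0,
    exists2 s : nat -> nat, {homo s : m n / (m < n)%N} &
    exists w', dO (w (s n)) w' @[n --> \oo] --> 0.
Proof.
move=> Bcpt w.
have massP (v : Omega L0 B0) : 0 <= mass v <= L.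
  by have := valP v.1; rewrite inE /= in_itv.
(* A family independent of [j] turns the diagonal lemma into Bolzano-Weierstrass for the masses,
   rescaled to [[0, 1]]. *)
have [|s hs sP] := @bounded_diagonal R (fun n _ => mass (w n) / L).
  move=> n _; have /andP[m0 mL] := massP (w n).
  by rewrite divr_ge0 ?(ltW L0)//= ler_pdivrMr// mul1r.
have [t ht [b tb]] := Bcpt (fun n => (w (s n)).2).
exists (s \o t); first by move=> m n mn; apply: hs; exact: ht.
have /cvg_ex[l cl] := sP 0%N.
have cm : mass (w (s (t n))) @[n --> \oo] --> l * L.
  have : mass (w (s (t n))) / L * L @[n --> \oo] --> l * L.
    by apply: cvgMr_tmp; exact: (cvg_subsequence ht cl).
  by under eq_fun do rewrite divfK ?gt_eqF//.
have lL : (l * L) \in `[0, L]%classic.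
  rewrite inE /= in_itv /=; apply/andP; split.
    apply: (ler_cvg_to (cvg_cst 0) cm); apply: nearW => n.
    by have /andP[] := massP (w (s (t n))).
  apply: (ler_cvg_to cm (cvg_cst L)); apply: nearW => n.
  by have /andP[] := massP (w (s (t n))).
exists (SigSub lL, b); apply/dOmega_cvg; split => //=.
Qed.

End product_metric.

Lemma weak_star_sublevel_closed (R : realType) (C : normedModType R)
    (Rg : dual C -> \bar R) (a : R) :
  weak_star_lsc Rg -> weak_star_closed [set u | (Rg u <= a%:E)%E].
Proof.
move=> /lower_semicontinuousP/(_ a) oR.
rewrite /weak_star_closed (_ : [set u | _] = ~` [set u | (a%:E < Rg u)%E]).
  exact: open_closedC.
by apply/seteqP; split => u /=; rewrite leNgt => /negP.
Qed.

(** The first conjunct ensures that the quantification over schemes in the second is not vacuous. *)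
Theorem theorem4p9 (R : realType)
  (C : completeNormedModType R) (C_separable : separable_space C)
  (Y : completeNormedModType R) (Y_hilbert : hilbert Y)
  (K : dual C -> Y) (F : Y -> R) (Rg : dual C -> \bar R)
  (Rg_ge0 : forall u, (0 <= Rg u)%E)
  (B : set (dual C))
  (B_closed : weak_star_closed B)
  (B_sub : B `<=` weak_star_closure (extreme_points [set u | (Rg u <= 1)%E]))
  (B_neq0 : B !=set0)
  (dB : B -> B -> R) (dB_metric : is_metric dB)
  (dB_metrizes : forall (u_ : nat -> B) (u : B),
     weak_star_cvg (fun n => val (u_ n)) (val u) <-> (dB (u_ n) u @[n --> \oo] --> 0))
  (dB_geodesic : geodesically_complete dB)
  (A1_linear : linear K)
  (A1_continuous : weak_star_to_weak_continuous K)
  (A2_bounded : exists c, forall y, c <= F y)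
  (A2_convex : convex_function [set: convex_lmodType Y] F)
  (A2_differentiable : twice_differentiable F)
  (A3_convex : ereal_convex Rg)
  (A3_lsc : weak_star_lsc Rg)
  (A3_homogeneous : forall (l : R) u, 0 <= l -> Rg (l *: u) = (l%:E * Rg u)%E)
  (A4 : forall a : R, 0 <= a ->
     weak_star_compact [set u | (Rg u <= a%:E)%E])
  (A5 : forall (u_ : nat -> dual C) (u : dual C),
     (forall n, (Rg (u_ n) < +oo)%E) -> (Rg u < +oo)%E ->
     weak_star_cvg u_ u -> K (u_ n) @[n --> \oo] --> K u)
  (A6 : forall (n : nat) (a : 'I_n -> R) (u : 'I_n -> dual C),
     (forall j, 0 <= a j) -> (forall j, B (u j)) ->
     Rg (\sum_(j < n) a j *: u j) = (\sum_(j < n) (a j)%:E * Rg (u j))%E)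
  (A7 : ~ B 0)
  (L : R) (L_gt0 : 0 < L)
  (nu0 : P2Omega L_gt0 B_neq0 dB) :
  let d := @W2Omega R (dual C) L L_gt0 B B_neq0 dB in
  let JE := fun nu : P2Omega L_gt0 B_neq0 dB => (J K F nu)%:E in
  (exists nu, minimizing_scheme d JE nu0 nu) /\
  forall (nu : R -> nat -> P2Omega L_gt0 B_neq0 dB)
         (nubar : R -> R -> P2Omega L_gt0 B_neq0 dB),
    minimizing_scheme d JE nu0 nu ->
    (forall tau, 0 < tau -> nubar tau 0 = nu0) ->
    (forall tau k t, 0 < tau -> (1 <= k)%N ->
       (k%:R - 1) * tau < t -> t <= k%:R * tau -> nubar tau t = nu tau k) ->
    exists (tau : nat -> R) (x : R -> P2Omega L_gt0 B_neq0 dB),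
      [/\ forall l, 0 < tau l < 1,
          decreasing_seq tau,
          tau @ \oo --> 0,
          AC2loc d x &
          forall t, 0 <= t -> d (nubar (tau l) t) (x t) @[l --> \oo] --> 0]
      /\ minimizing_movement d JE nu0 x.
Proof.
(* The extreme points lie in the sublevel set at [1], which is weak-star closed by (A3); (A4) then
   makes [B] compact. *)
have B_le1 u : B u -> (Rg u <= 1)%E.
  have cl := @weak_star_sublevel_closed _ _ _ 1 A3_lsc.
  move=> /B_sub; rewrite /weak_star_closure => h.
  by apply: cl; apply: closureS h => v [].
have B_compact : weak_star_compact B.
  apply: (subclosed_compact B_closed (A4 1 ler01)) => u; exact: B_le1.
have B_seq_compact (u : nat -> B) :
    exists2 s : nat -> nat, {homo s : m n / (m < n)%N} &
    exists x, dB (u (s n)) x @[n --> \oo] --> 0.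
  have Bu n : B (val (u n)) by apply: set_mem; exact: valP.
  have [s hs [g Bg ug]] := weak_star_seq_compact C_separable B_compact Bu.
  exists s => //; exists (SigSub (mem_set Bg)).
  by apply/dB_metrizes.
have d_refl := @dOmega_refl R (dual C) L L_gt0 B B_neq0 dB dB_metric.
have d_sym := @dOmega_sym R (dual C) L L_gt0 B B_neq0 dB dB_metric.
have d_tri := @dOmega_tri R (dual C) L L_gt0 B B_neq0 dB dB_metric.
have d_cpt := @Omega_seq_compact R (dual C) L L_gt0 B B_neq0 dB B_seq_compact.
have [c Fc] := A2_bounded.
have [ip [ip_sym ip_lin ip_norm]] := Y_hilbert.
have mass_cont : seq_continuous (@dOmega R (dual C) L L_gt0 B B_neq0 dB)
    (fun w => mass w ^+ 2 : R^o).
  move=> u w /dOmega_cvg[um _].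
  by rewrite expr2; under eq_fun do rewrite expr2; exact: cvgM.
(* (A5) upgrades weak-star convergence of the atoms to norm convergence in [Y]; the finiteness of
   [Rg] that it asks for comes from [B_le1]. *)
have f_cont : seq_continuous (@dOmega R (dual C) L L_gt0 B B_neq0 dB)
    (fun w => mass w ^+ 2 *: K (atom w)).
  move=> u w uw; apply: cvgZ; first exact: (mass_cont _ _ uw).
  have /dOmega_cvg[_ ub] := uw.
  have Rfin (v : B) : (Rg (val v) < +oo)%E.
    by apply: le_lt_trans (B_le1 _ (set_mem (valP v))) _; exact: ltry.
  by apply: A5 => [n||]; [exact: Rfin | exact: Rfin | apply/dB_metrizes].
have F_cont : continuous (F : Y -> R^o).
  move: A2_differentiable => [DF DFP _] y.
  by apply: differentiable_continuous; have [] := DFP y.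
have J_cvg (u : nat -> P2Omega L_gt0 B_neq0 dB) mu :
    W2Omega (u n) mu @[n --> \oo] --> 0 -> J K F (u n) @[n --> \oo] --> J K F mu.
  move=> um; apply: cvgD.
    have := bochner_cvg d_refl d_sym d_tri d_cpt ip_sym ip_lin ip_norm f_cont um.
    by move=> /cvg_comp; apply; exact: F_cont.
  exact: (Rintegral_cvg d_refl d_sym d_tri d_cpt mass_cont um).
have J_ge (mu : P2Omega L_gt0 B_neq0 dB) : c <= J K F mu.
  rewrite -[c]addr0 lerD//; apply: Rintegral_ge0 => w _; exact: sqr_ge0.
have [phi [phi01 phi_cvg]] := W2_coordinates d_refl d_sym d_tri d_cpt.
have W0 := W2_refl d_refl d_sym d_tri d_cpt.
have Wsym := W2_sym d_refl d_sym d_tri d_cpt.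
have Wtri := W2_triangle d_refl d_sym d_tri d_cpt.
move=> d JE; split.
  exact: (@minimizing_scheme_exists R _ d (fun mu => J K F mu) c W0 Wsym Wtri
    J_cvg J_ge phi phi01 phi_cvg nu0).
move=> nu nubar nuS nubar0 nubarE.
exact: (@scheme_converges R _ d (fun mu => J K F mu) c W0 Wsym Wtri
  J_cvg J_ge phi phi01 phi_cvg nu0 nu nubar nuS nubar0 nubarE).
Qed.
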